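(* Let $\bar Q$ be a gentle bound quiver with finite reduced non-kissing complex $\widetilde{\mathcal K}(\bar Q)$. Then the fan $\{\mathbb R_{\ge0}\{\mathbf g(\omega):\omega\in F\}: F\text{ face of }\widetilde{\mathcal K}(\bar Q)\}$ is the normal fan of the polytope $\mathrm{Asso}(\bar Q)$ defined equivalently as (i) the convex hull of the points $\mathbf p(F)=\sum_{\omega\in F}\kappa(\omega)\,\mathbf c(\omega,F)$ for all facets $F$ of $\widetilde{\mathcal K}(\bar Q)$, or (ii) the intersection of the halfspaces $\{\mathbf x\in\mathbb R^{Q_0}:\langle\mathbf g(\omega),\mathbf x\rangle\le\kappa(\omega)\}$ for all non-self-kissing walks $\omega$ of $\bar Q$.
   Context: A gentle bound quiver is $\bar Q=(Q,I)$, $Q$ finite (paths composed left to right), $I$ admissible generated by length-two paths, each vertex with at most two incoming and two outgoing arrows, and for each arrow $\beta$ at most one $\alpha$ with $t(\alpha)=s(\beta),\alpha\beta\notin I$, at most one with $\alpha\beta\in I$, and dually at most one $\gamma$ with $s(\gamma)=t(\beta),\beta\gamma\notin I$ and at most one with $\beta\gamma\in I$. Strings: reduced words in arrows and inverse arrows, composable, with no factor $\pi^{\pm1}$ for a path $\pi\in I$ (or length-zero $\varepsilon_v$), up to inversion. Blossoming quiver $\bar Q^\circledast$: add at each $v\in Q_0$ new arrows to/from new blossom vertices so that $v$ has exactly two incoming and two outgoing arrows, with length-two relations at $v$ making it gentle. Walks: maximal strings of $\bar Q^\circledast$ (joining blossom vertices), up to inversion. A substring of a walk: occurrence of a factor (possibly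 a vertex) with all vertices in $Q_0$; top (bottom) if both adjacent arrows point away from (towards) it. Peak/deep: top/bottom substring of length zero. $\omega$ kisses $\omega'$ if a string is a top substring of $\omega$ and a bottom substring of $\omega'$. Straight walks: paths of $Q^\circledast$ or inverses. $\widetilde{\mathcal K}(\bar Q)$: complex of sets of pairwise non-kissing, non-self-kissing, non-straight walks. $\mathbf g(\omega)=\sum_{\text{peaks}}\mathbf e_v-\sum_{\text{deeps}}\mathbf e_v$ (with multiplicity). Kissing number: $\kappa(\omega,\omega')$ is the number of kisses of $\omega$ to $\omega'$ counted with multiplicity (pairs of an occurrence of a top substring of $\omega$ and an occurrence of a bottom substring of $\omega'$ equal as strings); $\mathrm{KN}(\omega,\omega')=\kappa(\omega,\omega')+\kappa(\omega',\omega)$ and $\kappa(\omega)=\sum_{\omega'}\mathrm{KN}(\omega,\omega')$ over all non-self-kissing walks $\omega'$. Distinguished arrows: for a facet $F$ of $\widetilde{\mathcal K}(\bar Q)$ together with all straight walks, and an arrow $\alpha$ of $Q^\circledast$, among walks of $F$ through $\alpha$ (marked at an occurrence of $\alpha^{\pm1}$, oriented so it reads $\alpha$), $\mu\prec_\alpha\nu$ if at the ends of their maximal common factor containing the mark where they separate, $\mu$ uses an arrow read forward and $\nu$ one read backward; the maximum is the distinguished walk at $\alpha$ and $\alpha$ is a distinguished arrow of it. Each bending walk $\omega\in F$ has two distinguished arrows; its distinguished string $\sigma(\omega,F)$ is the substring between them. $\mathbf c(\omega,F)=\pm\mathbf m_{\sigma(\omega,F)}$, where $\mathbf m_\sigma=\sum_{\text{vertices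 }v\text{ of }\sigma}\mathbf e_v$ (with multiplicity), with sign $+$ if $\sigma(\omega,F)$ is a top substring of $\omega$ and $-$ if it is a bottom substring. *)

(* Defs.v *)
From HB Require Import structures.
From mathcomp Require Import all_boot all_order all_algebra.
From mathcomp Require Import boolp classical_sets functions cardinality fsbigop reals.
Set Implicit Arguments. Unset Strict Implicit. Unset Printing Implicit Defensive.
Import Order.TTheory GRing.Theory Num.Theory.
Local Open Scope classical_set_scope.
Local Open Scope ring_scope.

(* An arrow a goes from [src a] to [tgt a]; paths are composed left to right *)
(* and [rel Q a b] means that the length-two path  a b  lies in I.           *)
Record quiver := Quiver {
  vtx : finType; arr : finType; src : arr -> vtx; tgt : arr -> vtx }.
Record bquiver := BQuiver { bq :> quiver; rel : arr bq -> arr bq -> bool }.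
Arguments src {q}. Arguments tgt {q}. Arguments rel b : clear implicits.

(* gentle bound quiver (I generated by the length-two paths in [rel]) *)
Definition gentle (Q : bquiver) : Prop :=
  (forall a b, rel Q a b -> tgt a = src b) /\
  (forall v, #|[pred a : arr Q | tgt a == v]| <= 2)%N /\
  (forall v, #|[pred a : arr Q | src a == v]| <= 2)%N /\
  (forall b, #|[pred a | (tgt a == src b) && ~~ rel Q a b]| <= 1)%N /\
  (forall b, #|[pred a | (tgt a == src b) && rel Q a b]| <= 1)%N /\
  (forall b, #|[pred c | (src c == tgt b) && ~~ rel Q b c]| <= 1)%N /\
  (forall b, #|[pred c | (src c == tgt b) && rel Q b c]| <= 1)%N.

(* I is admissible: some power of the arrow ideal lies in I, i.e. there is an
   m such that no composable sequence of m arrows avoids the relations. *)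
Definition admissible (Q : bquiver) : Prop :=
  exists m : nat, forall p : seq (arr Q), size p = m ->
    ~~ sorted (fun a b => (tgt a == src b) && ~~ rel Q a b) p.

(* [Qb] (with embeddings iv, ia) is a blossoming quiver of [Q]: the vertices
   of Qb outside the image of iv are the blossom vertices, each new arrow
   joins a vertex of Q to a blossom vertex, every blossom vertex carries
   exactly one arrow, every vertex of Q gets exactly two incoming and two
   outgoing arrows, relations among old arrows are those of I, and Qb is
   gentle. *)
Definition blossoming (Q Qb : bquiver) (iv : vtx Q -> vtx Qb)
    (ia : arr Q -> arr Qb) : Prop :=
  injective iv /\ injective ia /\
  (forall a, src (ia a) = iv (src a)) /\ (forall a, tgt (ia a) = iv (tgt a)) /\
  (forall a b, rel Qb (ia a) (ia b) = rel Q a b) /\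
  (forall a, a \notin codom ia ->
     (src a \in codom iv) != (tgt a \in codom iv)) /\
  (forall x, x \notin codom iv ->
     #|[pred a : arr Qb | src a == x]| + #|[pred a : arr Qb | tgt a == x]| = 1)%N /\
  (forall v, #|[pred a : arr Qb | tgt a == iv v]| = 2 /\ #|[pred a : arr Qb | src a == iv v]| = 2)%N /\
  gentle Qb.
Arguments blossoming : clear implicits.

Section Walks.
Variables (R : realType) (Q B : bquiver) (iv : vtx Q -> vtx B).

Definition inQ0 (x : vtx B) : bool := x \in codom iv.

(* a letter is an arrow read forward (true) or backward (false) *)
Definition letter := (arr B * bool)%type.
Definition lsrc (l : letter) := if l.2 then src l.1 else tgt l.1.
Definition ltgt (l : letter) := if l.2 then tgt l.1 else src l.1.
Definition linv (l : letter) : letter := (l.1, ~~ l.2).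
Definition winv (w : seq letter) : seq letter := rev (map linv w).

(* the sequence of vertices visited by a nonempty word: positions 0..size w *)
Definition verts (w : seq letter) : seq (vtx B) :=
  if w is l :: _ then lsrc l :: map ltgt w else [::].

(* two consecutive letters: composable, reduced, and no factor pi or pi^-1
   with pi a length-two path of I *)
Definition adm2 (l l' : letter) : bool :=
  [&& ltgt l == lsrc l', l' != linv l,
      ~~ [&& l.2, l'.2 & rel B l.1 l'.1]
    & ~~ [&& ~~ l.2, ~~ l'.2 & rel B l'.1 l.1]].

(* walks: (maximal) strings of B joining two blossom vertices *)
Definition is_walk (w : seq letter) : bool :=
  if w is l :: _ then
    [&& sorted adm2 w, ~~ inQ0 (lsrc l) & ~~ inQ0 (ltgt (last l w))]
  else false.

(* walks are taken up to inversion: canonical representative *)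
Definition canon (w : seq letter) : bool := (pickle w <= pickle (winv w))%N.
Definition cwalk (w : seq letter) : bool := is_walk w && canon w.

(* a (possibly length zero) string, as its vertex sequence and letters *)
Definition string := (seq (vtx B) * seq letter)%type.
Definition sinv (s : string) : string := (rev s.1, winv s.2).
Definition streq (s t : string) : bool := (s == t) || (s == sinv t).

(* the factor of w between vertex positions i and j (i <= j) *)
Definition sub (w : seq letter) (i j : nat) : string :=
  (drop i (take j.+1 (verts w)), drop i (take j w)).

Definition dir_at (w : seq letter) (k : nat) : option bool := omap snd (onth w k).

Definition topocc (w : seq letter) (i j : nat) : bool :=
  [&& (0 < i)%N, (i <= j)%N, all inQ0 (sub w i j).1,
      dir_at w i.-1 == Some false & dir_at w j == Some true].
Definition botocc (w : seq letter) (i j : nat) : bool :=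
  [&& (0 < i)%N, (i <= j)%N, all inQ0 (sub w i j).1,
      dir_at w i.-1 == Some true & dir_at w j == Some false].

Definition kiss_count (w w' : seq letter) : nat :=
  (\sum_(i < (size w).+1) \sum_(j < (size w).+1)
     \sum_(i' < (size w').+1) \sum_(j' < (size w').+1)
       [&& topocc w i j, botocc w' i' j' & streq (sub w i j) (sub w' i' j')])%N.
Definition kisses (w w' : seq letter) : bool := (0 < kiss_count w w')%N.
Definition KN (w w' : seq letter) : nat := (kiss_count w w' + kiss_count w' w)%N.

Definition straight (w : seq letter) : bool :=
  all (fun l => l.2) w || all (fun l => ~~ l.2) w.
Definition nsk (w : seq letter) : bool := ~~ kisses w w.

Definition faces : set (set (seq letter)) :=
  [set F | finite_set F /\
     (forall w, F w -> [&& cwalk w, nsk w & ~~ straight w]) /\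
     (forall w w', F w -> F w' -> ~~ kisses w w')].
Definition facets : set (set (seq letter)) :=
  [set F | faces F /\ (forall G, faces G -> F `<=` G -> G = F)].

Definition kappa (w : seq letter) : R :=
  \sum_(w' \in [set w' | cwalk w' && nsk w']) ((KN w w')%:R : R).

Definition gvec (w : seq letter) (v : vtx Q) : R :=
  (\sum_(i < (size w).+1) (topocc w i i && ((sub w i i).1 == [:: iv v])))%N%:R
  - (\sum_(i < (size w).+1) (botocc w i i && ((sub w i i).1 == [:: iv v])))%N%:R.

Definition Lside (u : seq letter) (k s : nat) : option letter :=
  if (s <= k)%N then onth u (k - s) else None.
Definition Rside (u : seq letter) (k s : nat) : option letter := onth u (k + s).

Definition separates (side : seq letter -> nat -> nat -> option letter)
    (m m' : seq letter * nat) : Prop :=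
  exists s, (0 < s)%N /\
    (forall s', (0 < s' < s)%N -> side m.1 m.2 s' = side m'.1 m'.2 s') /\
    side m.1 m.2 s <> side m'.1 m'.2 s.
Definition fwd_bwd_at (side : seq letter -> nat -> nat -> option letter)
    (m m' : seq letter * nat) : Prop :=
  forall s, (0 < s)%N ->
    (forall s', (0 < s' < s)%N -> side m.1 m.2 s' = side m'.1 m'.2 s') ->
    side m.1 m.2 s <> side m'.1 m'.2 s ->
    exists a b, side m.1 m.2 s = Some (a, true) /\ side m'.1 m'.2 s = Some (b, false).
Definition prec (m m' : seq letter * nat) : Prop :=
  (separates Lside m m' \/ separates Rside m m') /\
  fwd_bwd_at Lside m m' /\ fwd_bwd_at Rside m m'.

Definition Sext (F : set (seq letter)) : set (seq letter) :=
  [set u | F u \/ F (winv u) \/ (is_walk u /\ straight u)].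
(* marked walks through a, oriented so that the mark reads a *)
Definition marks (S : set (seq letter)) (a : arr B) : set (seq letter * nat) :=
  [set m | S m.1 /\ onth m.1 m.2 = Some (a, true)].
Definition distinguished (S : set (seq letter)) (a : arr B) (m : seq letter * nat) :=
  marks S a m /\ forall m', marks S a m' -> m' <> m -> prec m' m.
Definition dist_pos (S : set (seq letter)) (w : seq letter) (k : nat) : Prop :=
  match onth w k with
  | Some (a, true) => distinguished S a (w, k)
  | Some (a, false) => distinguished S a (winv w, (size w - k.+1)%N)
  | None => False
  end.
Definition dpos (F : set (seq letter)) (w : seq letter) : seq nat :=
  [seq k <- iota 0 (size w) | `[< dist_pos (Sext F) w k >]].

Definition mvec (s : string) (v : vtx Q) : R := (count (pred1 (iv v)) s.1)%:R.

(* c(w,F) = +/- m_sigma(w,F), sigma between the two distinguished arrows *)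
Definition cvec (F : set (seq letter)) (w : seq letter) (v : vtx Q) : R :=
  let k1 := head 0%N (dpos F w) in
  let k2 := last 0%N (dpos F w) in
  if topocc w k1.+1 k2 then mvec (sub w k1.+1 k2) v
  else if botocc w k1.+1 k2 then - mvec (sub w k1.+1 k2) v
  else 0.

Definition pvec (F : set (seq letter)) (v : vtx Q) : R :=
  \sum_(w \in F) kappa w * cvec F w v.

Definition dotp (y x : vtx Q -> R) : R := \sum_(v : vtx Q) y v * x v.

Definition conv_hull (A : set (vtx Q -> R)) : set (vtx Q -> R) :=
  [set x | exists n (p : 'I_n -> vtx Q -> R) (l : 'I_n -> R),
     (forall i, A (p i)) /\ (forall i, 0 <= l i) /\ \sum_(i < n) l i = 1 /\
     x = fun v => \sum_(i < n) l i * p i v].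

Definition cone (A : set (vtx Q -> R)) : set (vtx Q -> R) :=
  [set x | exists n (p : 'I_n -> vtx Q -> R) (l : 'I_n -> R),
     (forall i, A (p i)) /\ (forall i, 0 <= l i) /\
     x = fun v => \sum_(i < n) l i * p i v].

Definition argmax (P : set (vtx Q -> R)) (y : vtx Q -> R) : set (vtx Q -> R) :=
  [set x | P x /\ forall z, P z -> dotp y z <= dotp y x].
Definition ncone (P G : set (vtx Q -> R)) : set (vtx Q -> R) :=
  [set y | G `<=` argmax P y].
Definition normal_fan (P : set (vtx Q -> R)) : set (set (vtx Q -> R)) :=
  [set C | exists y, C = ncone P (argmax P y)].

Definition gfan : set (set (vtx Q -> R)) :=
  [set C | exists F, faces F /\ C = cone [set gvec w | w in F]].

Definition asso_conv : set (vtx Q -> R) :=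
  conv_hull [set pvec F | F in facets].
Definition asso_half : set (vtx Q -> R) :=
  [set x | forall w, cwalk w -> nsk w -> dotp (gvec w) x <= kappa w].

End Walks.
Arguments asso_conv R {Q B} iv _.
Arguments asso_half R {Q B} iv _.
Arguments gfan R {Q B} iv _.
Arguments kappa R {Q B} iv w.
Arguments gvec R {Q B} iv w v.
Arguments pvec R {Q B} iv F v.

(* Main.v *)
Require Import Defs.
From HB Require Import structures.
From mathcomp Require Import all_boot all_order all_algebra.
From mathcomp Require Import boolp classical_sets functions cardinality fsbigop reals.
From mathcomp Require Import zify ring lra.
Set Implicit Arguments. Unset Strict Implicit. Unset Printing Implicit Defensive.
Import Order.TTheory GRing.Theory Num.Theory.

(* Group the coincidences of a walk w with a substring sigma of another walk into
   maximal common stretches.  Along a stretch the peaks and deeps of w telescope,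
   so <g(w), m_sigma> is a signed count of stretches, the positive ones inside a
   bottom substring being kisses.  Three consequences drive the proof.

   - Between its two distinguished arrows a walk of a face F cuts out a string
     whose characteristic vector is, up to sign, dual to the g-vectors of F.
     Hence these are independent, and for faces with |Q_0| walks the c-vectors
     form the dual basis.
   - For a face F and a walk w', the union S of the substrings of w' kissed by F
     satisfies <g(w), m_S> <= kappa(w, w') for every walk w, with equality for w
     in F.  Summing over w' and over both kinds of kisses gives a point of the
     polytope on all the facets indexed by F and off those indexed by walks
     kissing F.
   - If y is positive on the top and negative on the bottom substrings of some
     walks, these walks do not kiss.  With y = K sum_{F - w} g - g(w), K large,
     this exhibits the flip of w in a face F with |Q_0| walks.

   Maximising y over the points p(F) and flipping as long as a coefficient of y
   in the basis g(F) is negative then shows that the fan is complete; purity,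
   the two descriptions of the polytope and the normal fan follow. *)

(** * Letters around a vertex *)

(** Walks are undirected, while telescoping needs words running in parallel. Every pairing is
    therefore a sum over the two orientations of one of the words: where two walks meet, exactly one
    orientation crosses the vertex in the same way, because the four letters around it form two
    sides. A face is not known beforehand to extend to one with |Q_0| walks, nor a walk to have only
    two distinguished arrows. One distinguished arrow per direction exists in every face; uniqueness
    is derived only when the g-vectors span, since a string between two distinguished arrows of the
    same direction is orthogonal to all of them. Hence flips and c-vectors are treated for spanning
    faces only, and purity is a consequence of completeness. In y the large multiple decides the
    sign of a pairing except on strings orthogonal to all g-vectors of F - w. By duality the vector
    of such a string is a multiple of the c-vector of w, and there -g(w) decides. Pairings are
    integers, so K only has to exceed a bound in the sizes of the words. Thus y lies just across the
    wall spanned by F - w. *)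

Lemma card2_enum (T : finType) (P : pred T) : #|P| = 2 ->
  exists x y, x != y /\ forall z, P z = (z == x) || (z == y).
Proof.
move=> h; have := enum_uniq P; have he z : (z \in enum P) = P z by rewrite mem_enum.
have : size (enum P) = 2 by rewrite -cardE.
case: (enum P) he => [|x [|y [|]]] //= he _; rewrite inE andbT => xy.
by exists x, y; split=> // z; rewrite -he !inE.
Qed.

Section Local.
Variables (Q B : bquiver) (iv : vtx Q -> vtx B) (ia : arr Q -> arr B).
Hypothesis hbl : blossoming Q B iv ia.
Notation inQ0 := (inQ0 iv).

Lemma linvK : involutive (@linv B).
Proof. by case=> a b; rewrite /linv /= negbK. Qed.

Lemma ltgt_linv (l : letter B) : ltgt (linv l) = lsrc l.
Proof. by case: l => a []. Qed.

Lemma lsrc_linv (l : letter B) : lsrc (linv l) = ltgt l.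
Proof. by case: l => a []. Qed.

Lemma adm2_linv (l l' : letter B) : adm2 (linv l') (linv l) = adm2 l l'.
Proof.
rewrite /adm2 ltgt_linv lsrc_linv linvK eq_sym; congr (_ && _).
rewrite (_ : (linv l != l') = (l' != linv l)); last by rewrite eq_sym.
congr (_ && _); rewrite /linv /= !negbK andbC; congr (_ && _).
  by congr (~~ _); rewrite andbCA.
by congr (~~ _); rewrite andbCA.
Qed.

Lemma adm2_vtx (l l' : letter B) : adm2 l l' -> ltgt l = lsrc l'.
Proof. by case/and4P=> /eqP. Qed.

Lemma gentleB : gentle B.
Proof. by move: hbl; rewrite /blossoming; do 8!case=> _. Qed.

Lemma rel_in_inj (a a' d : arr B) : tgt a = src d -> tgt a' = src d ->
  Defs.rel B a d = Defs.rel B a' d -> a = a'.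
Proof.
have [_ [_ [_ [h1 [h2 _]]]]] := gentleB => ta ta' e.
case: (boolP (Defs.rel B a d)) => r.
  by move/card_le1_eqP: (h2 d); apply; rewrite !inE ?ta ?ta' eqxx // -e.
by move/card_le1_eqP: (h1 d); apply; rewrite !inE ?ta ?ta' eqxx // -e.
Qed.

Lemma rel_out_inj (a d d' : arr B) : src d = tgt a -> src d' = tgt a ->
  Defs.rel B a d = Defs.rel B a d' -> d = d'.
Proof.
have [_ [_ [_ [_ [_ [h1 h2]]]]]] := gentleB => ta ta' e.
case: (boolP (Defs.rel B a d)) => r.
  by move/card_le1_eqP: (h2 a); apply; rewrite !inE ?ta ?ta' eqxx // -e.
by move/card_le1_eqP: (h1 a); apply; rewrite !inE ?ta ?ta' eqxx // -e.
Qed.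

(* The four letters arriving at a vertex of Q fall into two sides, each with
   one letter of either direction; going on after [l] means leaving through
   the other side. *)
Lemma side_exists (x : vtx B) : inQ0 x -> exists side : letter B -> bool,
  [/\ forall l m, ltgt l = x -> ltgt m = x -> adm2 l (linv m) = (side l != side m),
      forall l m, ltgt l = x -> ltgt m = x -> side l = side m -> l.2 = m.2 -> l = m
    & forall s d, exists l, [/\ ltgt l = x, side l = s & l.2 = d] ].
Proof.
case/codomP=> v ->; move: hbl; rewrite /blossoming => -[_ [_ [_ [_ [_ [_ [_ [h _]]]]]]]].
have [/card2_enum[a [a' [aa' ha]]] /card2_enum[d [d' [dd' hd]]]] := h v.
have ta : tgt a = iv v by apply/eqP; have := ha a; rewrite /= eqxx.
have ta' : tgt a' = iv v by apply/eqP; have := ha a'; rewrite /= eqxx orbT.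
have sd : src d = iv v by apply/eqP; have := hd d; rewrite /= eqxx.
have sd' : src d' = iv v by apply/eqP; have := hd d'; rewrite /= eqxx orbT.
have ina z : tgt z = iv v -> z = a \/ z = a'.
  by move=> tz; have := ha z; rewrite /= tz eqxx => /esym/orP[]/eqP; auto.
have outd z : src z = iv v -> z = d \/ z = d'.
  by move=> tz; have := hd z; rewrite /= tz eqxx => /esym/orP[]/eqP; auto.
have rin z : src z = iv v -> Defs.rel B a' z = ~~ Defs.rel B a z.
  move=> sz; apply/eqP; case: (Defs.rel B a' z =P _) => // /eqP e; case/eqP: aa'.
  by apply: (@rel_in_inj _ _ z); rewrite ?sz //; move: e; case: (Defs.rel B _ _); case: (Defs.rel B _ _).
have rout : Defs.rel B a d' = ~~ Defs.rel B a d.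
  apply/eqP; case: (Defs.rel B a d' =P _) => // /eqP e; case/eqP: dd'.
  by apply: (@rel_out_inj a); rewrite ?ta //; move: e; case: (Defs.rel B _ _); case: (Defs.rel B _ _).
have a'a : (a' == a) = false by rewrite eq_sym (negbTE aa').
have d'd : (d' == d) = false by rewrite eq_sym (negbTE dd').
pose side (l : letter B) := if l.2 then l.1 == a else Defs.rel B a l.1.
exists side; split.
- case=> z [] [y []]; rewrite /side /ltgt /adm2 /ltgt /lsrc /linv /= => hz hy;
    rewrite hz hy eqxx /= ?andbT ?andbF xpair_eqE ?andbT ?andbF /=.
  + by case: (ina _ hz) (ina _ hy) => -> [] ->; rewrite ?eqxx ?a'a ?(negbTE aa').
  + case: (ina _ hz) => ->; first by rewrite eqxx /=; case: (Defs.rel B _ _).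
    by rewrite (rin _ hy) a'a; case: (Defs.rel B _ _).
  + case: (ina _ hy) => ->; first by rewrite eqxx; case: (Defs.rel B _ _).
    by rewrite (rin _ hz) a'a; case: (Defs.rel B _ _).
  + by case: (outd _ hz) (outd _ hy) => -> [] ->;
      rewrite ?eqxx ?d'd ?(negbTE dd') ?rout; case: (Defs.rel B _ _).
- case=> z [] [y []]; rewrite /side /ltgt /= => hz hy // e _; congr pair.
    by case: (ina _ hz) (ina _ hy) e => -> [] ->; rewrite ?eqxx ?a'a.
  by case: (outd _ hz) (outd _ hy) e => -> [] ->; rewrite ?rout //; case: (Defs.rel B _ _).
- case=> [] [].
  + by exists (a, true); rewrite /side /= eqxx.
  + case: (boolP (Defs.rel B a d)) => r; first by exists (d, false); rewrite /side /=.
    by exists (d', false); rewrite /side /= rout r.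
  + by exists (a', true); rewrite /side /= a'a.
  + case: (boolP (Defs.rel B a d)) => r; first by exists (d', false); rewrite /side /= rout r.
    by exists (d, false); rewrite /side /= (negbTE r).
Qed.

(** A blossom vertex carries a single arrow, and crossing it would take a second arrow or a return
    along the first. *)
Lemma adm2_inQ0 (l l' : letter B) : adm2 l l' -> inQ0 (ltgt l).
Proof.
move=> h; apply/negPn/negP => hx; move: hbl.
rewrite /blossoming => -[_ [_ [_ [_ [_ [_ [hc _]]]]]]]; have {hc} := hc _ hx.
have {hx} [h1 h2 _ _] := and4P h; move/eqP: h1 => h1.
set x := ltgt l in h1 *; move=> hc.
have hle (P : pred (arr B)) y z : P y -> P z -> y != z -> 1 < #|P|.
  by move=> *; apply/card_gt1P; exists y, z.
have hpos (P : pred (arr B)) y : P y -> 0 < #|P| by move=> *; apply/card_gt0P; exists y.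
move: h1 h2 hc; rewrite {}/x; case: l {h} => a []; case: l' => a' [];
  rewrite /ltgt /lsrc /linv /= => e; rewrite xpair_eqE ?andbT ?andbF /= => hd.
- have p1 : 0 < #|[pred a0 : arr B | src a0 == tgt a]| by apply: (hpos _ a'); rewrite /= e.
  have p2 : 0 < #|[pred a0 : arr B | tgt a0 == tgt a]| by apply: (hpos _ a); rewrite /=.
  by move=> hc; have := leq_add p1 p2; rewrite hc.
- have p : 1 < #|[pred a0 : arr B | tgt a0 == tgt a]|.
    by apply: (hle _ _ _ _ _ hd); rewrite /= ?e.
  by move=> hc; move: p; rewrite ltnNge -hc leq_addl.
- have p : 1 < #|[pred a0 : arr B | src a0 == src a]|.
    by apply: (hle _ _ _ _ _ hd); rewrite /= ?e.
  by move=> hc; move: p; rewrite ltnNge -hc leq_addr.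
- have p1 : 0 < #|[pred a0 : arr B | src a0 == src a]| by apply: (hpos _ a); rewrite /=.
  have p2 : 0 < #|[pred a0 : arr B | tgt a0 == src a]| by apply: (hpos _ a'); rewrite /= e.
  by move=> hc; have := leq_add p1 p2; rewrite hc.
Qed.

Lemma adm2_inQ0r (l l' : letter B) : adm2 l l' -> inQ0 (lsrc l').
Proof. by move=> h; rewrite -(adm2_vtx h) (adm2_inQ0 h). Qed.

Lemma adm2_side (l l' : letter B) : adm2 l l' -> exists side : letter B -> bool,
  [/\ forall m m', ltgt m = ltgt l -> lsrc m' = ltgt l ->
        adm2 m m' = (side m != side (linv m')),
      forall l m, ltgt l = lsrc l' -> ltgt m = lsrc l' -> side l = side m -> l.2 = m.2 -> l = m
    & forall s d, exists m, [/\ ltgt m = ltgt l, side m = s & m.2 = d] ].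
Proof.
move=> h; have [side [h1 h2 h3]] := side_exists (adm2_inQ0 h).
exists side; split=> //; last by rewrite -(adm2_vtx h).
by move=> m m' e e'; rewrite -(h1 m (linv m')) ?linvK ?ltgt_linv.
Qed.

Lemma follow_inj (l x x' : letter B) : adm2 l x -> adm2 l x' -> x.2 = x'.2 -> x = x'.
Proof.
move=> hx hx' e; have [side [h1 h2 _]] := adm2_side hx.
have ex := adm2_vtx hx; have ex' := adm2_vtx hx'.
apply: (can_inj linvK); apply: h2; rewrite ?ltgt_linv -?ex //; last by rewrite /= e.
move: hx hx'; rewrite (h1 l x) ?(h1 l x') //.
by case: (side l); case: (side (linv x)); case: (side (linv x')).
Qed.

Lemma pred_inj (l l' x : letter B) : adm2 l x -> adm2 l' x -> l.2 = l'.2 -> l = l'.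
Proof.
rewrite -adm2_linv -(adm2_linv l') => h h' e; apply: (can_inj linvK).
by apply: follow_inj h h' _; rewrite /= e.
Qed.

(** Since [x] and [x'] can both follow [l], they leave through the same side; what may precede one
    may precede the other. *)
Lemma adm2_cross (l m x x' : letter B) :
  adm2 l x -> adm2 l x' -> adm2 m x -> adm2 m x'.
Proof.
move=> hx hx' hm; have [side [h1 _ _]] := adm2_side hx.
have ex := adm2_vtx hx; have ex' := adm2_vtx hx'; have em := adm2_vtx hm.
have ml : ltgt m = ltgt l by rewrite em -ex.
move: hx hx' hm; rewrite !(h1 _ x) // !(h1 _ x') //.
by case: (side l); case: (side m); case: (side (linv x)); case: (side (linv x')).
Qed.

(** Both passes go from one side of the vertex to the other, so they agree in exactly one of the two
    relative orientations. This is why a coincidence of two undirected walks is counted once. *)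
Lemma adm2_orient (x x' z z' : letter B) : adm2 x x' -> adm2 z z' -> ltgt x = ltgt z ->
  adm2 (linv x') z' = ~~ adm2 x z'.
Proof.
move=> hx hz e; have [side [h1 _ _]] := adm2_side hx.
have ex := adm2_vtx hx; have ez := adm2_vtx hz.
rewrite !h1 ?ltgt_linv -?ez -?ex //; move: hx; rewrite h1 -?ex //.
by case: (side x); case: (side (linv x')); case: (side (linv z')).
Qed.

Lemma follow_exists (l : letter B) b : inQ0 (ltgt l) -> exists x, adm2 l x /\ x.2 = b.
Proof.
case/side_exists=> side [h1 h2 h3]; have [m [m1 m2 m3]] := h3 (~~ side l) (~~ b).
exists (linv m); rewrite h1 //= m3 negbK m2; split=> //; by case: (side l).
Qed.

Lemma pred_exists (x : letter B) b : inQ0 (lsrc x) -> exists l, adm2 l x /\ l.2 = b.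
Proof.
rewrite -ltgt_linv => /follow_exists-/(_ (~~ b))[m [h e]]; exists (linv m).
by rewrite -adm2_linv linvK h /= e negbK.
Qed.

End Local.

(** * Walks and distinguished arrows *)

Ltac arith_hyp T :=
  lazymatch T with
  | is_true (leq _ _) => idtac
  | is_true (_ && _) => idtac
  | is_true (_ || _) => idtac
  | is_true (~~ _) => idtac
  | is_true (_ != _) => idtac
  | @eq nat _ _ => idtac
  | @eq bool _ _ => idtac
  | not (@eq nat _ _) => idtac
  | ?A /\ ?C => arith_hyp A; arith_hyp C
  | nat => idtac
  end.
Ltac nlia :=
  repeat match goal with H : ?T |- _ => tryif arith_hyp T then fail else clear H end; lia.

Section Words.
Variables (Q B : bquiver) (iv : vtx Q -> vtx B) (ia : arr Q -> arr B).
Hypothesis hbl : blossoming Q B iv ia.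
Variable l0 : letter B.
Notation inQ0 := (inQ0 iv).
Notation is_walk := (is_walk iv).
Notation L := (nth l0).
Implicit Types (u w : seq (letter B)) (i j k t : nat) (b : bool).

Lemma size_winv w : size (winv w) = size w.
Proof. by rewrite /winv size_rev size_map. Qed.

Lemma nth_winv w i : i < size w -> L (winv w) i = linv (L w (size w - i.+1)).
Proof.
move=> h; rewrite /winv nth_rev ?size_map // (nth_map l0) //.
by rewrite ltn_subrL; case: (size w) h.
Qed.

Lemma winvK : involutive (@winv B).
Proof. by move=> w; rewrite /winv map_rev revK -map_comp map_id_in // => x _; apply: linvK. Qed.

Lemma is_walkP w : reflect
  [/\ 0 < size w, forall i, i.+1 < size w -> adm2 (L w i) (L w i.+1),
      ~~ inQ0 (lsrc (L w 0)) & ~~ inQ0 (ltgt (L w (size w).-1))] (is_walk w).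
Proof.
case: w => [|l w]; first by right; case.
rewrite /Defs.is_walk; apply: (iffP and3P).
  case=> /(sortedP l0) h h1 h2; split=> //.
  by move: h2; rewrite (last_nth l0).
case=> _ h h1 h2; split=> //; first by apply/(sortedP l0).
by rewrite (last_nth l0).
Qed.

Lemma walk_pos w : is_walk w -> 0 < size w.
Proof. by case/is_walkP. Qed.

Lemma walk_adm w i : is_walk w -> i.+1 < size w -> adm2 (L w i) (L w i.+1).
Proof. by case/is_walkP=> _ h _ _; apply: h. Qed.

(** Whether a walk goes on after a letter can be read off the letter alone, so two walks sharing a
    letter stop together or not at all. *)
Lemma walk_tgt w i : is_walk w -> i < size w -> inQ0 (ltgt (L w i)) = (i.+1 < size w).
Proof.
move=> hw hi; case: ltnP => h; first exact: (adm2_inQ0 hbl (walk_adm hw h)).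
have [_ _ _ /negbTE <-] := is_walkP _ hw.
by congr (inQ0 (ltgt (L w _))); move: hi h; case: (size w) => //= n; rewrite !ltnS => *; apply/eqP; rewrite eqn_leq; apply/andP.
Qed.

Lemma walk_src w i : is_walk w -> i < size w -> inQ0 (lsrc (L w i)) = (0 < i).
Proof.
move=> hw; case: i => [|i] hi; first by have [_ _ /negbTE] := is_walkP _ hw.
by rewrite -(adm2_vtx (walk_adm hw hi)) walk_tgt // ltnW.
Qed.

Lemma walk_winv w : is_walk w -> is_walk (winv w).
Proof.
move=> hw; have hs := walk_pos hw; apply/is_walkP; rewrite size_winv; split=> //.
- move=> i hi; rewrite (nth_winv hi) (nth_winv (ltnW hi)) adm2_linv.
  have -> : size w - i.+1 = (size w - i.+2).+1 by nlia.
  by apply: walk_adm => //; nlia.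
- by rewrite nth_winv // lsrc_linv subn1 walk_tgt // ?prednK ?ltnn //; nlia.
- rewrite nth_winv ?ltgt_linv; last by nlia.
  by rewrite walk_src //; nlia.
Qed.

(** A word equal to its inverse would have a middle letter that is its own inverse, or two middle
    letters that cancel. *)
Lemma winv_neq_adm w : 0 < size w ->
  (forall i, i.+1 < size w -> adm2 (L w i) (L w i.+1)) -> winv w != w.
Proof.
move=> hs hw; apply/eqP => e.
have h i : i < size w -> L w i = linv (L w (size w - i.+1)).
  by move=> hi; rewrite -nth_winv // e.
have hl (l : letter B) : l <> linv l by case: l => a [].
have [m [e1|e1]] : exists m, size w = m.*2.+1 \/ size w = m.*2.
  by exists (size w)./2; move: (odd_double_half (size w)); case: odd; nlia.
  have := h m; rewrite e1 (_ : m.*2.+1 - m.+1 = m); last by nlia.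
  by move=> /(_ ltac:(nlia)); apply: hl.
case: m e1 => [|m] e1; first by rewrite e1 in hs.
have := h m; rewrite e1 (_ : m.+1.*2 - m.+1 = m.+1); last by nlia.
move=> /(_ ltac:(nlia)) e2.
have := hw m; rewrite e1 => /(_ ltac:(nlia)).
by rewrite e2 => /and4P[_]; rewrite linvK eqxx.
Qed.

Lemma winv_neq w : is_walk w -> winv w != w.
Proof. by move=> hw; apply: winv_neq_adm => [|i]; [apply: walk_pos | apply: walk_adm]. Qed.

(** After a common letter, equal directions force equal letters, and neither word can end before the
    other. So the words part with different directions or run together to a common end. *)
Lemma right_dich u w i k : is_walk u -> is_walk w -> i < size u -> k < size w ->
  L u i = L w k ->
  (exists t, [/\ 0 < t, i + t < size u, k + t < size w,
     forall s, s < t -> L u (i + s) = L w (k + s) & (L u (i + t)).2 != (L w (k + t)).2]) \/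
  (size u - i = size w - k /\ forall s, i + s < size u -> L u (i + s) = L w (k + s)).
Proof.
move=> hu hw hi hk e.
pose P t := [|| size u <= i + t, size w <= k + t | L u (i + t) != L w (k + t)].
have exP : exists t, P t by exists (size u); rewrite /P leq_addl.
case: (ex_minnP exP) => t Pt tmin.
have hs s : s < t -> [/\ i + s < size u, k + s < size w & L u (i + s) = L w (k + s)].
  move=> st; have : ~~ P s by apply/negP => /tmin; rewrite leqNgt st.
  by rewrite /P !negb_or negbK -!ltnNge => /and3P[-> -> /eqP].
case: t Pt tmin hs => [|t] Pt tmin hs.
  by move: Pt; rewrite /P !addn0 e eqxx orbF (leqNgt (size u)) (leqNgt (size w)) hi hk.
have [h1 h2 h3] := hs t (ltnSn _).
have h4 : (i + t.+1 < size u) = (k + t.+1 < size w).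
  by rewrite !addnS -(walk_tgt hu) // -(walk_tgt hw) // h3.
case: (ltnP (i + t.+1) (size u)) => h5; last first.
  right; have h6 : size w <= k + t.+1 by rewrite leqNgt -h4 -leqNgt.
  by split=> [|s h]; [nlia | case: (hs s) => //; nlia].
left; exists t.+1; split=> //; first by rewrite -h4.
  by move=> s /hs[].
move: Pt; rewrite /P (leqNgt (size u)) (leqNgt (size w)) -h4 h5 /=; apply: contra => /eqP h; apply/eqP.
apply: (follow_inj hbl _ _ h); last first.
  by rewrite addnS; apply: walk_adm => //; rewrite -addnS -h4.
by rewrite -h3 addnS; apply: walk_adm => //; rewrite -addnS.
Qed.

Lemma left_dich u w i k : is_walk u -> is_walk w -> i < size u -> k < size w ->
  L u i = L w k ->
  (exists t, [/\ 0 < t, t <= i, t <= k,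
     forall s, s < t -> L u (i - s) = L w (k - s) & (L u (i - t)).2 != (L w (k - t)).2]) \/
  (i = k /\ forall s, s <= i -> L u (i - s) = L w (k - s)).
Proof.
move=> hu hw hi hk e.
have := @right_dich (winv u) (winv w) (size u - i.+1) (size w - k.+1)
  (walk_winv hu) (walk_winv hw).
rewrite !size_winv => /(_ ltac:(nlia) ltac:(nlia)).
have E1 s : s <= i -> L (winv u) (size u - i.+1 + s) = linv (L u (i - s)).
  by move=> h; rewrite nth_winv; [congr (linv (L u _)); nlia | nlia].
have E2 s : s <= k -> L (winv w) (size w - k.+1 + s) = linv (L w (k - s)).
  by move=> h; rewrite nth_winv; [congr (linv (L w _)); nlia | nlia].
have := E1 0; have := E2 0; rewrite !addn0 !subn0 => -> // -> //.
rewrite e => /(_ erefl) [[t [h1 h2 h3 h4 h5]]|[h1 h2]].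
  left; exists t; split=> //; try nlia.
    by move=> s st; have := h4 s st; rewrite E1 ?E2 //; [move/(can_inj (@linvK B)) | nlia | nlia].
  by move: h5; rewrite E1 ?E2; [rewrite /= (inj_eq negb_inj) | nlia | nlia].
right; split=> [|s hs]; first by nlia.
have := h2 s; rewrite E1 ?E2; [|nlia|nlia].
by move=> /(_ ltac:(nlia)) /(can_inj (@linvK B)).
Qed.

(* A kiss of [u] to [w], read in the same orientation, for [b = true]; the
   substring runs between the letters [i], [i+t+1] of [u] and [j], [j+t+1]
   of [w].  For [b = false] the roles of top and bottom are exchanged. *)
Definition kpat b u i w j t :=
  [&& (i + t).+1 < size u, (j + t).+1 < size w, adm2 (L u i) (L w j.+1),
      (L u i).2 == ~~ b, (L w j).2 == b, (L u (i + t).+1).2 == b,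
      (L w (j + t).+1).2 == ~~ b & [forall s : 'I_t, L u (i + s).+1 == L w (j + s).+1]].

Lemma kpatP b u i w j t : reflect
  [/\ (i + t).+1 < size u /\ (j + t).+1 < size w, adm2 (L u i) (L w j.+1),
      (L u i).2 = ~~ b /\ (L w j).2 = b, (L u (i + t).+1).2 = b /\ (L w (j + t).+1).2 = ~~ b &
      forall s, s < t -> L u (i + s).+1 = L w (j + s).+1] (kpat b u i w j t).
Proof.
apply: (iffP idP).
  case/and5P=> h1 h2 h3 /eqP h4 /and4P[/eqP h5 /eqP h6 /eqP h7 /forallP h8].
  by split=> // s hs; have /eqP := h8 (Ordinal hs).
case=> [[h1 h2] h3 [/eqP h4 /eqP h5] [/eqP h6 /eqP h7] h8]; apply/and5P; split=> //.
by apply/and4P; split=> //; apply/forallP => s; rewrite h8.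
Qed.

Lemma compat_sym u w i j : is_walk u -> is_walk w -> i.+1 < size u -> j.+1 < size w ->
  adm2 (L u i) (L w j.+1) = adm2 (L w j) (L u i.+1).
Proof.
move=> hu hw hi hj; have au := walk_adm hu hi; have aw := walk_adm hw hj.
apply/idP/idP => h; first exact: (adm2_cross hbl h au aw).
exact: (adm2_cross hbl h aw au).
Qed.

Lemma kpat_sym b u i w j t : is_walk u -> is_walk w ->
  kpat b u i w j t -> kpat (~~ b) w j u i t.
Proof.
move=> hu hw /kpatP[[h1 h2] h3 [h4 h5] [h6 h7] h8]; apply/kpatP; split=> //.
- by rewrite compat_sym //; nlia.
- by rewrite negbK.
- by rewrite negbK.
- by move=> s hs; rewrite h8.
Qed.

Lemma kpat_winv b u i w j t : kpat b u i w j t -> is_walk u -> is_walk w ->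
  kpat b (winv u) (size u - (i + t).+2) (winv w) (size w - (j + t).+2) t.
Proof.
move=> /kpatP[[h1 h2] h3 [h4 h5] [h6 h7] h8] hu hw; apply/kpatP; rewrite !size_winv.
split; first by nlia.
- rewrite !nth_winv ?adm2_linv; [|nlia..].
  have -> : size u - (size u - (i + t).+2).+1 = (i + t).+1 by nlia.
  have -> : size w - (size w - (j + t).+2).+2 = j + t by nlia.
  case: t h1 h2 h6 h7 h8 => [|t] h1 h2 h6 h7 h8; first by rewrite !addn0 -compat_sym // ; nlia.
  by rewrite !addnS -h8 //; apply: walk_adm => //; nlia.
- rewrite !nth_winv /=; [|nlia..].
  have -> : size u - (size u - (i + t).+2).+1 = (i + t).+1 by nlia.
  have -> : size w - (size w - (j + t).+2).+1 = (j + t).+1 by nlia.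
  by rewrite h6 h7 negbK.
- rewrite !nth_winv /=; [|nlia..].
  have -> : size u - (size u - (i + t).+2 + t).+2 = i by nlia.
  have -> : size w - (size w - (j + t).+2 + t).+2 = j by nlia.
  by rewrite h4 h5 negbK.
- move=> s hs; rewrite !nth_winv /=; [|nlia..].
  have -> : size u - (size u - (i + t).+2 + s).+2 = (i + (t - s.+1)).+1 by nlia.
  have -> : size w - (size w - (j + t).+2 + s).+2 = (j + (t - s.+1)).+1 by nlia.
  by rewrite h8 //; nlia.
Qed.

Definition nk u w := forall b i j t, ~~ kpat b u i w j t.

Definition nkfam (Fs : seq (letter B) -> Prop) :=
  (forall u, Fs u -> is_walk u) /\ (forall u w, Fs u -> Fs w -> nk u w).

Definition sepR b u i w k t :=
  [/\ i + t < size u, k + t < size w, forall s, s < t -> L u (i + s) = L w (k + s),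
      (L u (i + t)).2 = ~~ b & (L w (k + t)).2 = b].
Definition sepL b u i w k t :=
  [/\ t <= i, t <= k, forall s, s < t -> L u (i - s) = L w (k - s),
      (L u (i - t)).2 = ~~ b & (L w (k - t)).2 = b].

(* The letter [k] of [w] is a distinguished arrow with respect to [Fs]; the
   definition treats both directions of reading at once. *)
Definition topl (Fs : seq (letter B) -> Prop) w k :=
  forall u i, Fs u -> i < size u -> L u i = L w k ->
  forall t, ~ sepR (L w k).2 u i w k t /\ ~ sepL (L w k).2 u i w k t.

(** A word above another at one end of their common part and below it at the other end kisses it.
    For non-kissing words the comparisons at the two ends therefore never disagree. *)
Lemma sep_kpat b u i w k t1 t2 : is_walk u -> is_walk w -> i < size u -> k < size w ->
  L u i = L w k -> sepL b u i w k t1 -> sepR (~~ b) u i w k t2 ->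
  kpat b u (i - t1) w (k - t1) (t1 + t2).-1.
Proof.
move=> hu hw hi hk e [a1 a2 a3 a4 a5] [c1 c2 c3 c4 c5].
have t1p : 0 < t1 by case: t1 a1 a2 a3 a4 a5 => // _ _ _; rewrite !subn0 e => -> ; case: b {c4 c5}.
have t2p : 0 < t2 by case: t2 c1 c2 c3 c4 c5 => // _ _ _; rewrite !addn0 e => -> ; case: b {a4 a5}.
have hh s : s < (t1 + t2).-1 -> L u (i - t1 + s).+1 = L w (k - t1 + s).+1.
  move=> hs; case: (ltnP s t1) => h.
    have -> : (i - t1 + s).+1 = i - (t1 - s.+1) by nlia.
    have -> : (k - t1 + s).+1 = k - (t1 - s.+1) by nlia.
    by apply: a3; nlia.
  have -> : (i - t1 + s).+1 = i + (s - t1).+1 by nlia.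
  have -> : (k - t1 + s).+1 = k + (s - t1).+1 by nlia.
  by apply: c3; nlia.
have E1 : (i - t1 + (t1 + t2).-1).+1 = i + t2 by nlia.
have E2 : (k - t1 + (t1 + t2).-1).+1 = k + t2 by nlia.
apply/kpatP; rewrite E1 E2; split=> //; last by rewrite c4 negbK.
have := hh 0; rewrite !addn0 => <-; last by nlia.
by apply: walk_adm => //; nlia.
Qed.

(* Overlaps of [w] with words passing above it are laminar by non-kissing, so
   one of maximal length would have to be all of [w]. *)
Lemma topl_exists Fs w k b : nkfam Fs -> Fs w -> k < size w -> (L w k).2 = b ->
  exists k', [/\ k' < size w, (L w k').2 = b & topl Fs w k'].
Proof.
move=> [Fw Fnk] hw hk hb; apply: contrapT => hno.
have ww := Fw _ hw.
(* [O l n]: a word of the family shares the letters [l] to [l + n - 1] of [w], not all of [w], and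
   lies above [w] at each end of this stretch where [w] continues. *)
pose O l n := exists u lu, [/\ Fs u, l + n <= size w /\ lu + n <= size u,
  forall s, s < n -> L u (lu + s) = L w (l + s),
  l = 0 \/ [/\ 0 < l, 0 < lu, (L w l.-1).2 = b & (L u lu.-1).2 = ~~ b] &
  [/\ l + n = size w \/ [/\ l + n < size w, lu + n < size u, (L w (l + n)).2 = b &
         (L u (lu + n)).2 = ~~ b], ~ (l = 0 /\ n = size w) & 0 < n ] ].
have cover k' : k' < size w -> (L w k').2 = b -> exists l n, O l n /\ l <= k' < l + n.
  move=> hk' hb'; have /existsNP[u /existsNP[i ]] : ~ topl Fs w k'.
    by move=> ht; apply: hno; exists k'.
  move=> /not_implyP[Fu] /not_implyP[hi] /not_implyP[e] /existsNP[t /not_andP]; rewrite !notK hb'.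
  have uw := Fw _ Fu.
  case=> [hR|hL].
    have [c1 c2 c3 c4 c5] := hR.
    have tp : 0 < t by case: t c4 c5 {hR c1 c2 c3} => //; rewrite !addn0 e => ->; case: b {hb hno O hb'}.
    case: (left_dich uw ww hi hk' e) => [[t1 [d1 d2 d3 d4 d5]]|[d1 d2]].
      case: (eqVneq (L w (k' - t1)).2 b) => d6; last first.
        have d6' : (L w (k' - t1)).2 = ~~ b by move: d6; case: (_.2); case: (b).
        have d7 : (L u (i - t1)).2 = b by move: d5; rewrite d6'; case: (_.2); case: (b).
        have hL : sepL (~~ b) u i w k' t1 by split; rewrite ?negbK.
        have := sep_kpat uw ww hi hk' e hL; rewrite negbK => /(_ _ hR).
        by rewrite (negbTE (Fnk _ _ Fu hw _ _ _ _)).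
      have d7 : (L u (i - t1)).2 = ~~ b by move: d5; rewrite d6; case: (_.2); case: (b).
      exists (k' - t1).+1, (t1 + t).-1; split; last by nlia.
      have E1 : (k' - t1).+1 + (t1 + t).-1 = k' + t by nlia.
      have E2 : (i - t1).+1 + (t1 + t).-1 = i + t by nlia.
      exists u, (i - t1).+1; rewrite E1 E2; split=> //; first by nlia.
      - move=> s hs; case: (ltnP s t1) => h.
          have -> : (i - t1).+1 + s = i - (t1 - s.+1) by nlia.
          have -> : (k' - t1).+1 + s = k' - (t1 - s.+1) by nlia.
          by apply: d4; nlia.
        have -> : (i - t1).+1 + s = i + (s - t1).+1 by nlia.
        have -> : (k' - t1).+1 + s = k' + (s - t1).+1 by nlia.
        by apply: c3; nlia.
      - by right.
      - by split; [right|nlia|nlia].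
    exists 0, (k' + t); split; last by nlia.
    exists u, 0; rewrite !add0n; rewrite d1 in c1 c4 d2 c3; split=> //; first by nlia.
    - move=> s hs; rewrite !add0n; case: (ltnP s k') => h.
        by rewrite -{1 2}(subKn (ltnW h)) d2 //; nlia.
      by rewrite -{1 2}(subnKC h) c3 //; nlia.
    - by left.
    - by split; [right|nlia|nlia].
  have [c1 c2 c3 c4 c5] := hL.
  have tp : 0 < t by case: t c4 c5 {hL c1 c2 c3} => //; rewrite !subn0 e => ->; case: b {hb hno O hb'}.
  case: (right_dich uw ww hi hk' e) => [[t1 [d1 d2 d3 d4 d5]]|[d1 d2]].
    case: (eqVneq (L w (k' + t1)).2 b) => d6; last first.
      have d6' : (L w (k' + t1)).2 = ~~ b by move: d6; case: (_.2); case: (b).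
      have d7 : (L u (i + t1)).2 = b by move: d5; rewrite d6'; case: (_.2); case: (b).
      have hR : sepR (~~ b) u i w k' t1 by split; rewrite ?negbK.
      by have := sep_kpat uw ww hi hk' e hL hR; rewrite (negbTE (Fnk _ _ Fu hw _ _ _ _)).
    have d7 : (L u (i + t1)).2 = ~~ b by move: d5; rewrite d6; case: (_.2); case: (b).
    exists (k' - t).+1, (t + t1).-1; split; last by nlia.
    have E1 : (k' - t).+1 + (t + t1).-1 = k' + t1 by nlia.
    have E2 : (i - t).+1 + (t + t1).-1 = i + t1 by nlia.
    exists u, (i - t).+1; rewrite E1 E2; split=> //; first by nlia.
    - move=> s hs; case: (ltnP s t) => h.
        have -> : (i - t).+1 + s = i - (t - s.+1) by nlia.
        have -> : (k' - t).+1 + s = k' - (t - s.+1) by nlia.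
        by apply: c3; nlia.
      have -> : (i - t).+1 + s = i + (s - t).+1 by nlia.
      have -> : (k' - t).+1 + s = k' + (s - t).+1 by nlia.
      by apply: d4; nlia.
    - by right.
    - by split; [right|nlia|nlia].
  exists (k' - t).+1, (size w - (k' - t).+1); split; last by nlia.
  exists u, (i - t).+1; split=> //; first by nlia.
  - move=> s hs; case: (ltnP s t) => h.
      have -> : (i - t).+1 + s = i - (t - s.+1) by nlia.
      have -> : (k' - t).+1 + s = k' - (t - s.+1) by nlia.
      by apply: c3; nlia.
    have -> : (i - t).+1 + s = i + (s - t).+1 by nlia.
    have -> : (k' - t).+1 + s = k' + (s - t).+1 by nlia.
    by apply: d2; nlia.
  - by right.
  - by split; [left|nlia|nlia]; nlia.
(* If two stretches overlap or touch without being nested, each of the two words is above [w], hence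
   above the other word, at one end of the intersection: they kiss along it. *)
have cross l n l' n' : O l n -> O l' n' -> l < l' -> l' <= l + n -> l + n < l' + n' -> False.
  move=> [u [lu [Fu [a1 a1'] a2 a3 [a4 a5 a6]]]] [u' [lu' [Fu' [c1 c1'] c2 c3 [c4 c5 c6]]]] h1 h2 h3.
  case: c3 => [|[c31 c32 c33 c34]]; first by nlia.
  case: a4 => [|[a41 a42 a43 a44]]; first by nlia.
  have uw := Fw _ Fu; have uw' := Fw _ Fu'.
  have /negP := Fnk _ _ Fu' Fu b lu'.-1 (lu + (l'.-1 - l)) (l + n - l').
  apply; apply/kpatP.
  have E1 : (lu'.-1 + (l + n - l')).+1 = lu' + (l + n - l') by nlia.
  have E2 : (lu + (l'.-1 - l) + (l + n - l')).+1 = lu + n by nlia.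
  rewrite E1 E2; split=> //; first by nlia.
  - have H1 : adm2 (L u' lu'.-1) (L w l').
      rewrite -{1}(addn0 l') -c2 ?addn0; last by nlia.
      by have := walk_adm uw' (i := lu'.-1); rewrite prednK //; apply; nlia.
    case: (ltnP l' (l + n)) => h4.
      have -> : (lu + (l'.-1 - l)).+1 = lu + (l' - l) by nlia.
      by rewrite a2; [rewrite subnKC // ltnW | nlia].
    have -> : (lu + (l'.-1 - l)).+1 = lu + n by nlia.
    have H2 : adm2 (L w l'.-1) (L w l').
      by have := walk_adm ww (i := l'.-1); rewrite prednK //; apply; nlia.
    apply: (adm2_cross hbl H2 _ H1).
    have -> : l'.-1 = l + n.-1 by nlia.
    rewrite -a2; last by nlia.
    have -> : lu + n = (lu + n.-1).+1 by nlia.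
    by apply: walk_adm => //; nlia.
  - split=> //; rewrite a2; last by nlia.
    by rewrite (_ : l + (l'.-1 - l) = l'.-1) //; nlia.
  - rewrite a44; split=> //; rewrite c2; last by nlia.
    by rewrite (_ : l' + _ = l + n) //; nlia.
  - move=> s hs; have -> : (lu'.-1 + s).+1 = lu' + s by nlia.
    have -> : (lu + (l'.-1 - l) + s).+1 = lu + (l' - l + s) by nlia.
    rewrite c2 ?a2; [|nlia|nlia].
    by congr (L w _); nlia.
pose P n := `[< exists l, O l n >].
have exP : exists n, P n by have [l [n [h _]]] := cover _ hk hb; exists n; apply/asboolP; exists l.
have bP n : P n -> n <= size w.
  by move=> /asboolP[l [u [lu [_ [h _] _ _ _]]]]; nlia.
case: (ex_maxnP exP bP) => n /asboolP[l Oln] nmax.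
have mx l' n' : O l' n' -> n' <= n by move=> h; apply: nmax; apply/asboolP; exists l'.
have := Oln => -[u [lu [Fu [a1 a1'] a2 a3 [a4 a5 a6]]]].
(* Where the longest stretch stops inside [w], the next letter of [w] has direction [b] and is
   covered as well; the stretch covering it is not longer, so it crosses the longest one. *)
case: a4 => [a4|[a41 a42 a43 a44]].
  case: a3 => [a3|[a31 a32 a33 a34]]; first by apply: a5; nlia.
  have [l' [n' [O' h']]] := cover l.-1 ltac:(nlia) a33.
  have := mx _ _ O' => hn; apply: (cross _ _ _ _ O' Oln); nlia.
have [l' [n' [O' h']]] := cover (l + n) a41 a43.
have := mx _ _ O' => hn; apply: (cross _ _ _ _ Oln O'); nlia.
Qed.

End Words.

Local Open Scope ring_scope.

(** * Common stretches of two walks *)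

Lemma sum_diag_shift (m n : nat) (G : nat -> nat -> int) :
  (forall i j, ((m <= i.+1) || (n <= j.+1))%N -> G i j = 0) ->
  \sum_(i < m) \sum_(j < n) (if (0 < i)%N && (0 < j)%N then G i.-1 j.-1 else 0) =
  \sum_(i < m) \sum_(j < n) G i j.
Proof.
move=> h; case: m h => [|m] h; first by rewrite !big_ord0.
rewrite big_ord_recl big1 ?add0r // big_ord_recr /= [X in _ + X]big1 ?addr0; last first.
  by move=> j _; apply: h; rewrite leqnn.
apply: eq_bigr => i _; case: n h => [|n] h; first by rewrite !big_ord0.
rewrite big_ord_recl /= add0r big_ord_recr /= h ?leqnn ?orbT // addr0.
by apply: eq_bigr.
Qed.

Section Telescope.
Variables (m n : nat) (c lk : nat -> nat -> bool) (f : nat -> int).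
Hypothesis cm : forall i j, c i j -> (i < m)%N && (j < n)%N.
Hypothesis lkc : forall i j, lk i j -> c i j && c i.+1 j.+1.

Let st i j := c i j && ~~ [&& (0 < i)%N, (0 < j)%N & lk i.-1 j.-1].

(** [k] is fuel: every link advances the first index, which stays below [m], so fuel [m] reaches the
    end of the chain. *)
Fixpoint run_end k i j : int :=
  if k is k'.+1 then if lk i j then run_end k' i.+1 j.+1 else f i.+1 else f i.+1.

Lemma run_end_fuel k i j : (m <= i + k)%N -> run_end k.+1 i j = run_end k i j.
Proof.
elim: k i j => [|k IH] i j h.
  by rewrite /=; case: ifP => // /lkc/andP[_ /cm/andP[]]; nlia.
rewrite -[LHS]/(if lk i j then run_end k.+1 i.+1 j.+1 else f i.+1).
rewrite -[RHS]/(if lk i j then run_end k i.+1 j.+1 else f i.+1).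
by case: ifP => // _; apply: IH; rewrite addSnnS.
Qed.

Lemma run_endE i j : run_end m i j = if lk i j then run_end m i.+1 j.+1 else f i.+1.
Proof.
case: (posnP m) => [m0|]; first by rewrite m0 /=; case: ifP => // /lkc/andP[/cm]; rewrite m0.
case: m run_end_fuel => // m' hf _.
rewrite -[LHS]/(if lk i j then run_end m' i.+1 j.+1 else f i.+1).
by case: ifP => // _; rewrite hf //; nlia.
Qed.

Lemma run_end_exists i j : c i j -> exists t, [/\ forall s, (s < t)%N -> lk (i + s) (j + s),
  c (i + t) (j + t), ~~ lk (i + t) (j + t) & run_end m i j = f (i + t).+1].
Proof.
move: {2}(m - i)%N (leqnn (m - i)) => k; elim: k i j => [|k IH] i j hk hc.
  by have /andP[] := cm hc; nlia.
case: (boolP (lk i j)) => h; last by exists 0%N; rewrite !addn0 run_endE (negbTE h).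
have /andP[h1 h2] := lkc h; have [|t [t1 t2 t3 t4]] := IH i.+1 j.+1 _ h2.
  by have /andP[] := cm h1; nlia.
exists t.+1; rewrite run_endE h !addnS -!addSn; split=> //.
by case=> [|s] hs; rewrite ?addn0 // !addnS -!addSn t1.
Qed.

(** No chain is enumerated. Over a linked cell, [run_end] minus [f] exceeds the increment of [f] by
    its own value at the next diagonal cell; shifting the sum of these excesses by one diagonal step
    cancels everything but the chain starts. *)
Lemma telescope_runs :
  \sum_(i < m) \sum_(j < n) (if c i j then f i.+1 - f i else 0) =
  \sum_(i < m) \sum_(j < n) (if st i j then run_end m i j - f i else 0).
Proof.
have h1 : \sum_(i < m) \sum_(j < n) (if (0 < i)%N && (0 < j)%N then
    (if lk i.-1 j.-1 then run_end m i.-1 j.-1 - f i.-1.+1 else 0) else 0) =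
  \sum_(i < m) \sum_(j < n) (if lk i j then run_end m i j - f i.+1 else 0).
  apply: (@sum_diag_shift m n (fun i j => if lk i j then run_end m i j - f i.+1 else 0)).
  by move=> i j hij; case: ifP => // /lkc/andP[_ /cm]; nlia.
apply: (addIr (\sum_(i < m) \sum_(j < n) (if lk i j then run_end m i j - f i.+1 else 0))).
rewrite -{2}h1 -!big_split; apply: eq_bigr => i _ /=; rewrite -!big_split.
apply: eq_bigr => j _ /=; rewrite /st.
case: (boolP (c i j)) => hc /=; last first.
  rewrite (_ : lk i j = false); last by apply/negP => /lkc/andP[h _]; rewrite h in hc.
  case: ifP => // /andP[i0 j0]; case: ifP => // /lkc/andP[_]; rewrite !prednK // => h.
  by rewrite h in hc.
have -> : (if lk i j then run_end m i j - f i.+1 else 0) = run_end m i j - f i.+1.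
  by rewrite run_endE; case: (lk i j) => //; rewrite subrr.
have tel (x y z : int) : x - y + (z - x) = z - y by ring.
case: (posnP i) => [->|i0] /=; first by rewrite addr0; apply: tel.
case: (posnP j) => [->|j0] /=; first by rewrite addr0; apply: tel.
case: ifP => hl /=; first by rewrite (negbTE hl) addr0; apply: tel.
move/negbFE: hl => hl; rewrite hl (run_endE i.-1 j.-1) hl !prednK // add0r; exact: tel.
Qed.

End Telescope.

(** * The pairing of two words in one orientation *)

Section Pairing.
Variables (Q B : bquiver) (iv : vtx Q -> vtx B) (ia : arr Q -> arr B).
Hypothesis hbl : blossoming Q B iv ia.
Variable l0 : letter B.
Notation is_walk := (is_walk iv).
Notation L := (nth l0).
Implicit Types (u w : seq (letter B)) (i j k t : nat) (b : bool) (S : nat -> bool).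

Definition isdir b (l : letter B) : int := Posz (l.2 == b).

Definition compat u w i j := [&& i.+1 < size u, j.+1 < size w & adm2 (L u i) (L w j.+1)]%N.

(** For [b = true] the increment is 1 at a peak of [u], -1 at a deep, 0 elsewhere. This is the part
    of the pairing of g(u) with the vector of the mask [S] that comes from passes where [u], read in
    this orientation, crosses the vertex as [w] does. *)
Definition gpair1 b S u w : int := \sum_(i < size u) \sum_(j < size w)
  (if S j && compat u w i j then isdir b (L u i.+1) - isdir b (L u i) else 0).

(* Pass [i] of a word is its vertex between the letters [i] and [i.+1], i.e.
   the position [i.+1] of Defs.  A run is a maximal stretch of passes of [w],
   inside the mask [S], that is shared with [u]. *)
Definition run S u i w j t := [/\ ((i + t).+1 < size u)%N /\ ((j + t).+1 < size w)%N,
  adm2 (L u i) (L w j.+1), forall s, (s < t)%N -> L u (i + s).+1 = L w (j + s).+1,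
  forall s, (s <= t)%N -> S (j + s)%N &
  ((L u i).2 != (L w j).2 \/ (L u i = L w j /\ (j = 0%N \/ ~~ S j.-1))) /\
  ((L u (i + t).+1).2 != (L w (j + t).+1).2 \/
    (L u (i + t).+1 = L w (j + t).+1 /\ ~~ S (j + t).+1))].

Lemma run_uniq S u i w j t t' : run S u i w j t -> run S u i w j t' -> t = t'.
Proof.
wlog: t t' / (t < t')%N => [hw h h'|h [_ _ _ _ [_ h1]] [_ _ h2 h3 _]].
  by case: (ltngtP t t') => // hh; [apply: hw h h' | apply/esym/hw].
case: h1 => [|[_ /negP[]]]; first by rewrite h2 ?eqxx.
by have := h3 t.+1; rewrite addnS; apply.
Qed.

Lemma isdir_neg b l : isdir (~~ b) l = 1 - isdir b l.
Proof. by rewrite /isdir; case: (l.2); case: b. Qed.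

Lemma gpair1_neg b S u w : gpair1 (~~ b) S u w = - gpair1 b S u w.
Proof.
rewrite /gpair1 -sumrN; apply: eq_bigr => i _; rewrite -sumrN; apply: eq_bigr => j _.
by case: ifP => _; rewrite ?oppr0 // !isdir_neg; ring.
Qed.

Definition valid S w := forall j, S j -> (j.+1 < size w)%N.

(** Passes joined by a common letter inside the mask form the runs, and along a run the increments
    telescope to the direction of leaving minus the direction of entering. *)
Lemma gpair1_val b S u w : is_walk u -> is_walk w -> valid S w ->
  exists val : nat -> nat -> int,
  gpair1 b S u w = \sum_(i < size u) \sum_(j < size w) val i j /\
  forall i j, (exists t, run S u i w j t /\ val i j = isdir b (L u (i + t).+1) - isdir b (L u i)) \/
    ((forall t, ~ run S u i w j t) /\ val i j = 0).
Proof.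
move=> hu hw hS.
pose c i j := S j && compat u w i j.
pose lk i j := [&& c i j, c i.+1 j.+1 & L u i.+1 == L w j.+1].
pose f i := isdir b (L u i).
have cm i j : c i j -> (i < size u)%N && (j < size w)%N.
  by case/andP=> _ /and3P[h1 h2 _]; rewrite (ltnW h1) (ltnW h2).
have lkc i j : lk i j -> c i j && c i.+1 j.+1 by case/and3P=> -> ->.
exists (fun i j => if c i j && ~~ [&& (0 < i)%N, (0 < j)%N & lk i.-1 j.-1]
  then run_end lk f (size u) i j - f i else 0); split.
  exact: (telescope_runs f cm lkc).
move=> i j /=; case: ifP => [/andP[hc hs]|hs]; last first.
  right; split=> // t [[h1 h2] h3 h4 h5 [h6 h7]]; move/negP: hs; apply.
  rewrite /c (_ : S j) /=; last by have := h5 0%N; rewrite addn0; apply.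
  have hi : (i.+1 < size u)%N by nlia.
  have hj : (j.+1 < size w)%N by nlia.
  rewrite /compat h3 hi hj /=.
  apply/and3P => -[i0 j0 /and3P[/andP[hS' _] _ /eqP]]; rewrite !prednK // => e.
  by case: h6 => [|[_ [j0'|/negP]]]; [rewrite e eqxx | rewrite j0' in j0 | ].
left; have [t [t1 t2 t3 t4]] := run_end_exists f cm lkc hc.
exists t; split; last by rewrite t4.
have /andP[hS1 /and3P[h1 h2 h3]] := hc; have /andP[hS2 /and3P[h4 h5 h6]] := t2.
split=> //.
- by move=> s /t1/and3P[_ _ /eqP].
- move=> s; rewrite leq_eqVlt => /orP[/eqP ->//|/t1/and3P[/andP[]]] //.
- split.
    case: (eqVneq (L u i).2 (L w j).2) => e; [right|by left].
    have e' : L u i = L w j.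
      by apply: (pred_inj hbl h3) => //; apply: (walk_adm l0 hw).
    split=> //; case: (posnP j) => [|j0]; [by left|right].
    (* If the previous pass of [w] were in the mask, the common letter would start in Q, so [u]
       would have a previous pass too, linked to this one. *)
    apply: contra hs => hSj; have i0 : (0 < i)%N.
      by rewrite -(walk_src hbl l0 hu) ?e' ?(walk_src hbl l0 hw) // ltnW.
    rewrite i0 j0 /= /lk /c /compat hSj !prednK // hS1 h1 h2 h3 e' eqxx !andbT /=.
    rewrite !(ltnW h1) (ltnW h2) /=.
    by have := walk_adm l0 hw (i := j.-1); rewrite prednK // -e'; 
       have := walk_adm l0 hu (i := i.-1); rewrite prednK // => hh _; apply: hh; nlia.
  case: (eqVneq (L u (i + t).+1).2 (L w (j + t).+1).2) => e; [right|by left].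
  have e' : L u (i + t).+1 = L w (j + t).+1.
    by apply: (follow_inj hbl _ h6) => //; apply: (walk_adm l0 hu).
  split=> //; apply: contra t3 => hS3; have h7 := hS _ hS3.
  have h8 : ((i + t).+2 < size u)%N.
    by rewrite -(walk_tgt hbl l0 hu) // e' (walk_tgt hbl l0 hw).
  rewrite /lk t2 /c /compat hS3 h7 h8 e' eqxx andbT /=.
  exact: (walk_adm l0 hw).
Qed.

Lemma gpair1_le0 b S u w : is_walk u -> is_walk w -> valid S w ->
  (forall i j t, run S u i w j t -> (L u i).2 = ~~ b -> (L u (i + t).+1).2 = b -> False) ->
  gpair1 b S u w <= 0.
Proof.
move=> hu hw hS h; have [val [-> hv]] := gpair1_val b hu hw hS.
apply: sumr_le0 => i _; apply: sumr_le0 => j _.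
have [[t [r ->]]|[_ -> //]] := hv i j.
have := h _ _ _ r; rewrite /isdir; case: (L u i).2; case: (L u (i + t).+1).2; case: b {h hv};
 by move=> // /(_ erefl erefl).
Qed.

Lemma gpair1_lt0 b S u w i j t : is_walk u -> is_walk w -> valid S w ->
  (forall i j t, run S u i w j t -> (L u i).2 = ~~ b -> (L u (i + t).+1).2 = b -> False) ->
  run S u i w j t -> (L u i).2 = b -> (L u (i + t).+1).2 = ~~ b ->
  gpair1 b S u w <= -1.
Proof.
move=> hu hw hS h r e1 e2; have [val [-> hv]] := gpair1_val b hu hw hS.
have le0 i' j' : val i' j' <= 0.
  have [[t' [r' ->]]|[_ -> //]] := hv i' j'.
  have := h _ _ _ r'; rewrite /isdir; case: (L u i').2; case: (L u (i' + t').+1).2.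
  by case: b {h hv e1 e2}; move=> // /(_ erefl erefl).
  by case: b {h hv e1 e2}; move=> // /(_ erefl erefl).
  by case: b {h hv e1 e2}; move=> // /(_ erefl erefl).
  by case: b {h hv e1 e2}; move=> // /(_ erefl erefl).
have hi : (i < size u)%N by case: r => -[]; nlia.
have hj : (j < size w)%N by case: r => -[]; nlia.
rewrite (bigD1 (Ordinal hi)) //= (bigD1 (Ordinal hj)) //=.
have -> : val i j = -1.
  have [[t' [r' ->]]|[/(_ t) //]] := hv i j.
  by rewrite -(run_uniq r r') /isdir e1 e2; case: b {h hv e1 e2 le0}.
rewrite -addrA gerDl -(addr0 0); apply: lerD; first by apply: sumr_le0.
by apply: sumr_le0 => ? _; apply: sumr_le0.
Qed.

End Pairing.

Lemma neq_negb (x y b : bool) : x != y -> x = b -> y = ~~ b.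
Proof. by case: x; case: y; case: b. Qed.

(** * Signs of the pairing for non-kissing words *)

Section Signs.
Variables (Q B : bquiver) (iv : vtx Q -> vtx B) (ia : arr Q -> arr B).
Hypothesis hbl : blossoming Q B iv ia.
Variable l0 : letter B.
Notation is_walk := (is_walk iv).
Notation L := (nth l0).
Notation kpat := (kpat l0).
Notation gpair1 := (gpair1 l0).
Notation run := (run l0).
Notation nk := (nk l0).
Notation topl := (topl l0).
Notation sepR := (sepR l0).
Notation sepL := (sepL l0).
Implicit Types (u w : seq (letter B)) (i j k t p q : nat) (b : bool) (S : nat -> bool).

Definition itv p q j := (p <= j < q)%N.

Lemma valid_itv p q w : (q < size w)%N -> valid (itv p q) w.
Proof. by move=> h j /andP[_ h']; nlia. Qed.

Lemma run_kpat b S u i w j t : run S u i w j t -> (L u i).2 = ~~ b -> (L w j).2 = b ->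
  (L u (i + t).+1).2 = b -> (L w (j + t).+1).2 = ~~ b -> kpat b u i w j t.
Proof. by move=> [h1 h2 h3 _ _] *; apply/kpatP. Qed.

Lemma run_sepR b S u i w j t : run S u i w j t -> L u i = L w j ->
  (L u (i + t).+1).2 = ~~ b -> (L w (j + t).+1).2 = b -> sepR b u i w j t.+1.
Proof.
move=> [[h1 h1'] h2 h3 _ _] e e1 e2; split; rewrite ?addnS //.
by case=> [|s] hs; rewrite ?addn0 // !addnS h3.
Qed.

Lemma run_sepL b S u i w j t : run S u i w j t -> L u (i + t).+1 = L w (j + t).+1 ->
  (L u i).2 = ~~ b -> (L w j).2 = b -> sepL b u (i + t).+1 w (j + t).+1 t.+1.
Proof.
move=> [[h1 h1'] h2 h3 _ _] e e1 e2; have E1 k : ((k + t).+1 - t.+1 = k)%N by nlia.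
split; rewrite ?E1 ?ltnS ?leq_addl // => s hs.
case: s hs => [|s] hs; first by rewrite !subn0.
have -> : ((i + t).+1 - s.+1 = (i + (t - s.+1)).+1)%N by nlia.
have -> : ((j + t).+1 - s.+1 = (j + (t - s.+1)).+1)%N by nlia.
by apply: h3; nlia.
Qed.

Lemma run_itv p q u i w j t : run (itv p q) u i w j t ->
  [/\ (p <= j)%N /\ ((j + t).+1 <= q)%N, (L u i).2 != (L w j).2 \/ (L u i = L w j /\ j = p) &
   (L u (i + t).+1).2 != (L w (j + t).+1).2 \/
   (L u (i + t).+1 = L w (j + t).+1 /\ (j + t).+1 = q)].
Proof.
move=> [_ _ _ h [h1 h2]]; have /andP[] := h _ (leq0n _); rewrite addn0 => h3 h4.
have /andP[_ h5] := h _ (leqnn _); split=> //.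
  case: h1 => [|[e h1]]; [by left|right; split=> //].
  by case: h1 => [j0|]; rewrite ?/itv; nlia.
case: h2 => [|[e h2]]; [by left|right; split=> //].
by move: h2; rewrite /itv; nlia.
Qed.

(** A positive run has [u] entering in direction [~~ b] and leaving in direction [b]. If it
    separates from [w] at both ends, it is a kiss. If it reaches just one end of the interval, that
    letter is distinguished, and the separation at the other end puts [u] above [w]. Reaching both
    ends is excluded by the last hypothesis. *)
Lemma gpair1_itv_le0 b (Fs : seq (letter B) -> Prop) u w p q : is_walk u -> is_walk w ->
  Fs u -> nk u w -> (q < size w)%N ->
  (L w p).2 = b \/ topl Fs w p -> (L w q).2 = ~~ b \/ topl Fs w q ->
  ~ ((L w p).2 = ~~ b /\ (L w q).2 = b) -> gpair1 b (itv p q) u w <= 0.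
Proof.
move=> hu hw Fu hnk hq HL HR hno; apply: (gpair1_le0 hbl) => //; first exact: valid_itv.
move=> i j t r e1 e2; have [[hj1 hj2] hL hR] := run_itv r.
have [hi1 hi2] : (i < size u)%N /\ ((i + t).+1 < size u)%N by case: r => -[h _] _ _ _ _; nlia.
case: hL => [d1|[d1 d1']]; case: hR => [d2|[d2 d2']].
- have := hnk b i j t; rewrite (run_kpat r) //; first by rewrite (neq_negb d1 e1) negbK.
  exact: (neq_negb d2 e2).
- case: HR => HR; first by move: e2; rewrite d2 d2' HR; case: (b).
  have [_] := HR u (i + t).+1 Fu hi2 (etrans d2 (congr1 (L w) d2')) t.+1; apply.
  have e3 : (L w q).2 = b by rewrite -d2' -d2 e2.
  rewrite e3 -d2'; apply: (run_sepL r d2 e1).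
  by rewrite (neq_negb d1 e1) negbK.
- case: HL => HL; first by move: e1; rewrite d1 d1' HL; case: (b).
  have [] := HL u i Fu hi1 (etrans d1 (congr1 (L w) d1')) t.+1 => + _; apply.
  have e3 : (L w p).2 = ~~ b by rewrite -d1' -d1 e1.
  rewrite e3 -d1'; apply: (run_sepR r d1); first by rewrite negbK.
  exact: (neq_negb d2 e2).
- by apply: hno; rewrite -d1' -d1 -d2' -d2.
Qed.

(* The mask [S] is a union of substrings of [w] entered by a letter of
   direction [b] and left by one of direction [~~ b]: bottom substrings for
   [b = true], top substrings for [b = false]. *)
Definition bclosed b S w := [/\ valid S w,
  forall j, S j -> (j = 0%N \/ ~~ S j.-1) -> (L w j).2 = b &
  forall j, S j -> ~~ S j.+1 -> (L w j.+1).2 = ~~ b].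

Lemma bclosed_itv b p q w : (p < q)%N -> (q < size w)%N -> (L w p).2 = b -> (L w q).2 = ~~ b ->
  bclosed b (itv p q) w.
Proof.
move=> pq hq e1 e2; split; first exact: valid_itv.
  move=> j /andP[h1 h2]; rewrite /itv => h; rewrite (_ : j = p) //.
  by case: h => h; nlia.
move=> j /andP[h1 h2]; rewrite /itv => h; rewrite (_ : j.+1 = q) //; nlia.
Qed.

Lemma bclosed_run b S u i w j t : bclosed b S w -> run S u i w j t ->
  (L u i).2 = ~~ b -> (L u (i + t).+1).2 = b -> kpat b u i w j t.
Proof.
move=> [hv h1 h2] r e1 e2; have [_ _ _ hS [hL hR]] := r.
have Sj : S j by have := hS 0%N; rewrite addn0; apply.
apply: (run_kpat r) => //.
  case: hL => [d|[d h]]; first by rewrite (neq_negb d e1) negbK.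
  exact: h1.
case: hR => [d|[d h]]; first exact: (neq_negb d e2).
by apply: h2 => //; apply: hS.
Qed.

Lemma gpair1_bclosed_le0 b S u w : is_walk u -> is_walk w -> bclosed b S w -> nk u w ->
  gpair1 b S u w <= 0.
Proof.
move=> hu hw hS hn; apply: (gpair1_le0 hbl) => //; first by case: hS.
by move=> i j t r e1 e2; have := hn b i j t; rewrite (bclosed_run hS r).
Qed.

(** The leftmost component of the mask, matched with itself, is a run entered by [b] and left by
    [~~ b]: it contributes -1, and without kisses no run contributes positively. *)
Lemma gpair1_bclosed_self b S w : is_walk w -> bclosed b S w -> nk w w -> (exists j, S j) ->
  gpair1 b S w w <= -1.
Proof.
move=> hw hS hn exS; have [hv h1 h2] := hS.
case: (ex_minnP exS) => p Sp pmin.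
have exq : exists t, ~~ S (p + t).+1.
  by exists (size w); apply/negP => /hv; nlia.
case: (ex_minnP exq) => t ht tmin.
have hSt s : (s <= t)%N -> S (p + s)%N.
  case: s => [|s] hs; rewrite ?addn0 // addnS; apply/negPn/negP => /tmin; nlia.
have r : run S w p w p t.
  split=> //.
  - by split; have := hv _ (hSt t (leqnn _)).
  - by apply: (walk_adm l0 hw); have := hv _ Sp.
  - split; right; split=> //; case: (posnP p) => [|p0]; [by left|right].
    by apply/negP => /pmin; nlia.
apply: (gpair1_lt0 hbl (i := p) (j := p) (t := t)) => //.
- by move=> i j t' r' e1 e2; have := hn b i j t'; rewrite (bclosed_run hS r').
- apply: h1 => //; case: (posnP p) => [|p0]; [by left|right].
  by apply/negP => /pmin; nlia.
- by apply: h2 => //; apply: hSt.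
Qed.

(** Two distinguished letters of opposite directions forbid both ways of separating, so a word of
    the family containing the whole stretch never parts from [w]. *)
Lemma top_top_eq b (Fs : seq (letter B) -> Prop) u w i k1 k2 :
  is_walk u -> is_walk w -> Fs u -> (k1 < k2)%N -> (k2 < size w)%N ->
  (L w k1).2 = ~~ b -> (L w k2).2 = b -> topl Fs w k1 -> topl Fs w k2 ->
  (i + (k2 - k1) < size u)%N ->
  (forall s, (s <= k2 - k1)%N -> L u (i + s) = L w (k1 + s)) -> u = w /\ i = k1.
Proof.
move=> hu hw Fu k12 hk2 e1 e2 t1 t2 hi hs.
have hi1 : (i < size u)%N by nlia.
have hk1 : (k1 < size w)%N by nlia.
have a1 : L u i = L w k1 by have := hs 0%N; rewrite !addn0; apply.
have a2 : L u (i + (k2 - k1)) = L w k2 by rewrite hs // subnKC // ltnW.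
have [d1 d2] : (size u - i = size w - k1)%N /\ forall s, (i + s < size u)%N -> L u (i + s) = L w (k1 + s).
  case: (right_dich hbl hu hw hi1 hk1 a1) => // -[t [c1 c2 c3 c4 c5]]; exfalso.
  have tk : (k2 - k1 < t)%N.
    by rewrite ltnNge; apply/negP => h; move: c5; rewrite hs ?eqxx.
  case: (eqVneq (L w (k1 + t)).2 b) => e.
    have [+ _] := t2 u (i + (k2 - k1))%N Fu hi a2 (t - (k2 - k1))%N; apply.
    have E1 : (i + (k2 - k1) + (t - (k2 - k1)) = i + t)%N by nlia.
    have E2 : (k2 + (t - (k2 - k1)) = k1 + t)%N by nlia.
    rewrite e2; split; rewrite ?E1 ?E2 //; last by apply: (neq_negb _ e); rewrite eq_sym.
    move=> s hss; have -> : (i + (k2 - k1) + s = i + (k2 - k1 + s))%N by nlia.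
    have -> : (k2 + s = k1 + (k2 - k1 + s))%N by nlia.
    by apply: c4; nlia.
  have [+ _] := t1 u i Fu hi1 a1 t; apply; rewrite e1.
  have e' : (L w (k1 + t)).2 = ~~ b by apply: (neq_negb _ (erefl b)); rewrite eq_sym.
  by split=> //; rewrite -e' ; apply: (neq_negb _ (erefl _)); rewrite eq_sym.
have [d3 d4] : i = k1 /\ forall s, (s <= i)%N -> L u (i - s) = L w (k1 - s).
  case: (left_dich hbl hu hw hi1 hk1 a1) => // -[t [c1 c2 c3 c4 c5]]; exfalso.
  case: (eqVneq (L w (k1 - t)).2 b) => e.
    have [_] := t2 u (i + (k2 - k1))%N Fu hi a2 (t + (k2 - k1))%N; apply.
    have E1 : (i + (k2 - k1) - (t + (k2 - k1)) = i - t)%N by nlia.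
    have E2 : (k2 - (t + (k2 - k1)) = k1 - t)%N by nlia.
    rewrite e2; split; rewrite ?E1 ?E2 //; [nlia|nlia| |]; last by apply: (neq_negb _ e); rewrite eq_sym.
    move=> s hss; case: (leqP s (k2 - k1)) => h.
      have -> : (i + (k2 - k1) - s = i + (k2 - k1 - s))%N by nlia.
      have -> : (k2 - s = k1 + (k2 - k1 - s))%N by nlia.
      by apply: hs; nlia.
    have -> : (i + (k2 - k1) - s = i - (s - (k2 - k1)))%N by nlia.
    have -> : (k2 - s = k1 - (s - (k2 - k1)))%N by nlia.
    by apply: c4; nlia.
  have [_] := t1 u i Fu hi1 a1 t; apply; rewrite e1.
  have e' : (L w (k1 - t)).2 = ~~ b by apply: (neq_negb _ (erefl b)); rewrite eq_sym.
  by split=> //; rewrite -e' ; apply: (neq_negb _ (erefl _)); rewrite eq_sym.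
split=> //; apply: (@eq_from_nth _ l0); first by nlia.
move=> s hsz; case: (leqP s i) => h.
  by rewrite -(subKn h) d4 ?d3 //; nlia.
by rewrite -(subnKC (ltnW h)) d2 ?d3 //; nlia.
Qed.

(* The duality between g-vectors and c-vectors, for one orientation of [u]. *)
Lemma gpair1_dual b (Fs : seq (letter B) -> Prop) u w k1 k2 : is_walk u -> is_walk w ->
  Fs u -> nk u w -> (k1 < k2)%N -> (k2 < size w)%N ->
  (L w k1).2 = ~~ b -> (L w k2).2 = b -> topl Fs w k1 -> topl Fs w k2 ->
  gpair1 b (itv k1 k2) u w = Posz (u == w).
Proof.
move=> hu hw Fu hnk k12 hk2 e1 e2 t1 t2.
have [val [-> hv]] := gpair1_val hbl l0 b hu hw (@valid_itv k1 k2 w hk2).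
suff hval i j : val i j = Posz [&& u == w, i == k1 & j == k1].
  case: (eqVneq u w) => [euw|nuw]; last first.
    by rewrite big1 // => i _; rewrite big1 // => j _; rewrite hval (negbTE nuw).
  have hk1 : (k1 < size w)%N by nlia.
  have hk1' : (k1 < size u)%N by rewrite euw.
  rewrite (bigD1 (Ordinal hk1')) //= (bigD1 (Ordinal hk1)) //= hval (introT eqP euw) !eqxx /=.
  rewrite big1 ?addr0; last first.
    by move=> j hj; rewrite hval; move: hj; rewrite -val_eqE /= => /negbTE ->; rewrite !andbF.
  rewrite big1 ?addr0 // => i hi; rewrite big1 // => j _; rewrite hval.
  by move: hi; rewrite -val_eqE /= => /negbTE ->; rewrite !andbF.
have self : run (itv k1 k2) w k1 w k1 (k2 - k1.+1).
  have E1 : ((k1 + (k2 - k1.+1)).+1 = k2)%N by nlia.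
  split; rewrite ?E1 //.
  - by apply: (walk_adm l0 hw); nlia.
  - by move=> s hs; rewrite /itv; nlia.
  - by split; right; split=> //; rewrite ?/itv ?ltnn ?andbF //; case: (posnP k1); [left|right]; nlia.
have [[t [r ->]]|[nr ->]] := hv i j; last first.
  case: (eqVneq u w) nr => [->|//] nr; case: eqP nr => [->|//] nr; case: eqP nr => [->|//] nr.
  by case: (nr _ self).
have [[hj1 hj2] hL hR] := run_itv r.
have [hi1 hi2] : (i < size u)%N /\ ((i + t).+1 < size u)%N by case: r => -[h _] _ _ _ _; nlia.
have ht1 c : ~ sepR (~~ b) u i w k1 c /\ ~ sepL (~~ b) u i w k1 c \/ L u i <> L w k1.
  case: (pselect (L u i = L w k1)) => e; [left|by right].
  by have := t1 u i Fu hi1 e c; rewrite e1.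
have ht2 c : ~ sepL b u (i + t).+1 w k2 c \/ L u (i + t).+1 <> L w k2.
  case: (pselect (L u (i + t).+1 = L w k2)) => e; [left|by right].
  by have [] := t2 u (i + t).+1 Fu hi2 e c; rewrite e2.
have nkp c := negP (hnk c i j t).
have hsame : (L u i = L w j /\ j = k1) -> (L u (i + t).+1 = L w (j + t).+1 /\ (j + t).+1 = k2) ->
    [&& u == w, i == k1 & j == k1].
  move=> [d1 d1'] [d2 d2'].
  have [-> ->] : u = w /\ i = k1.
    apply: (top_top_eq hu hw Fu k12 hk2 e1 e2 t1 t2); first by nlia.
    move=> s hs; case: s hs => [|s] hs; first by rewrite !addn0 d1 d1'.
    rewrite !addnS; case: (ltnP s t) => h; last first.
      have -> : s = t by nlia.
      by rewrite d2 d1'.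
    by case: r => _ _ + _ _; rewrite -d1'; apply.
  by rewrite d1' !eqxx.
(* Apart from the run of [w] along itself, a run enters and leaves in the same direction: otherwise
   it is a kiss, or [u] passes above [w] at a distinguished letter. *)
have huw : ~~ [&& u == w, i == k1 & j == k1] -> (L u i).2 = (L u (i + t).+1).2.
  move=> hn; case: hL => [d1|d1]; case: hR => [d2|d2]; last by rewrite hsame in hn.
  - apply/eqP; apply/negPn/negP => hh.
    have := nkp (~~ (L u i).2); apply; apply: (run_kpat r); rewrite ?negbK //.
    + by apply: (neq_negb d1).
    + by apply: (neq_negb hh).
    + by rewrite (neq_negb d2 (neq_negb hh erefl)) negbK.
  - have eb : (L u (i + t).+1).2 = b by case: d2 => -> ->.
    rewrite eb; apply/eqP; apply/negPn/negP => hh.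
    have e3 : (L w j).2 = b.
      by rewrite (neq_negb d1 (erefl _)); apply/esym; apply: (neq_negb hh).
    case: (ht2 t.+1); last by case: d2 => -> ->.
    case: d2 => d2 d2'; rewrite -d2'; apply; apply: (run_sepL r d2) => //.
    by apply: (neq_negb _ e3); rewrite eq_sym.
  - have eb : (L u i).2 = ~~ b by case: d1 => -> ->.
    rewrite eb; apply/eqP; apply/negPn/negP => hh.
    have e3 : (L w (j + t).+1).2 = ~~ b.
      rewrite (neq_negb d2 (erefl _)); congr (~~ _); rewrite -[RHS]negbK.
      by apply: (neq_negb hh).
    case: (ht1 t.+1) => [[+ _]|]; last by case: d1 => -> ->.
    case: d1 => d1 d1'; rewrite -d1'; apply; apply: (run_sepR r d1) => //.
    by apply: (neq_negb _ e3); rewrite eq_sym.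
case: (boolP [&& u == w, i == k1 & j == k1]) => h; last first.
  by rewrite /isdir (huw h) subrr.
move: h r => /and3P[/eqP -> /eqP -> /eqP ->] r; rewrite (run_uniq r self).
have E1 : ((k1 + (k2 - k1.+1)).+1 = k2)%N by nlia.
by rewrite E1 /isdir e1 e2 eqxx; case: (b).
Qed.

(** A kiss is determined by where it begins in the two words, so counting beginnings counts
    kisses. *)
Definition kissn b u w : int :=
  \sum_(i < size u) \sum_(j < size w) Posz `[< exists t, kpat b u i w j t >].

(** A run contributes at most 1, and contributes 1 only if it is a kiss, because a closed mask has
    the right directions at its ends. *)
Lemma gpair1_le_kissn b S u w : is_walk u -> is_walk w -> bclosed b S w -> gpair1 b S u w <= kissn b u w.
Proof.
move=> hu hw hS; have [val [-> hv]] : exists val, _ := gpair1_val hbl l0 b hu hw (let: And3 h _ _ := hS in h).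
apply: ler_sum => i _; apply: ler_sum => j _.
have [[t [r ->]]|[_ ->]] := hv i j; last by [].
case: (boolP `[< _ >]) => /asboolP h; first by rewrite /isdir; case: (_ == b); case: (_ == b).
have : ~ ((L u i).2 = ~~ b /\ (L u (i + t).+1).2 = b).
  by move=> [e1 e2]; apply: h; exists t; apply: (bclosed_run hS r e1 e2).
by rewrite /isdir; case: (L u i).2; case: (_.2); case: (b) => // h'; case: h'.
Qed.

Definition kmask b (X : seq (letter B) -> Prop) w j := `[< exists u i j' t,
  [/\ X u, kpat b u i w j' t & (j' <= j <= j' + t)%N] >].

(** Kissed substrings may overlap or touch, but an end of their union is an end of one of them and
    inherits its direction. *)
Lemma kmask_bclosed b X w : bclosed b (kmask b X w) w.
Proof.
split.
- by move=> j /asboolP[u [i [j' [t [_ /kpatP[[_ h] _ _ _ _]]]]]]; nlia.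
- move=> j /asboolP[u [i [j' [t [Xu k h]]]]] hb.
  have -> : j = j'; last by case/kpatP: k => _ _ [].
  case: hb => [|hb]; first by nlia.
  case: (eqVneq j j') => // hj; case/negP: hb; apply/asboolP.
  by exists u, i, j', t; split=> //; nlia.
- move=> j /asboolP[u [i [j' [t [Xu k h]]]]] hb.
  have -> : j = (j' + t)%N; last by case/kpatP: k => _ _ _ [].
  case: (eqVneq j (j' + t)%N) => // hj; case/negP: hb; apply/asboolP.
  by exists u, i, j', t; split=> //; nlia.
Qed.

Lemma kpat_adm b u i w j t s : is_walk w -> kpat b u i w j t -> (s <= t)%N ->
  adm2 (L u (i + s)) (L w (j + s).+1).
Proof.
move=> hw /kpatP[[h1 h2] h3 _ _ h4]; case: s => [|s] hs; first by rewrite !addn0.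
by rewrite !addnS h4 //; apply: (walk_adm l0 hw); nlia.
Qed.

(* A run counted negatively would meet one of the kisses making up the mask, and
   the two words of [X] involved would kiss. *)
Lemma gpair1_kmask b (X : seq (letter B) -> Prop) u w : (forall u, X u -> is_walk u) ->
  (forall u v, X u -> X v -> nk u v) -> is_walk w -> X u ->
  gpair1 b (kmask b X w) u w = kissn b u w.
Proof.
move=> Xw Xn hw Xu; have hS := kmask_bclosed b X w; have hu := Xw _ Xu.
have [val [-> hv]] : exists val, _ := gpair1_val hbl l0 b hu hw (let: And3 h _ _ := hS in h).
apply: eq_bigr => i _; apply: eq_bigr => j _; set S := kmask b X w in hS hv *.
case: (boolP `[< _ >]) => /asboolP hk.
  case: hk => t k; have /kpatP[[k1 k2] k3 [k4 k5] [k6 k7] k8] := k.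
  have r : run S u i w j t.
    split=> //; first by move=> s hs; apply/asboolP; exists u, (nat_of_ord i), (nat_of_ord j), t; split=> //; nlia.
    by split; left; rewrite ?k4 ?k5 ?k6 ?k7; case: (b).
  have [[t' [r' ->]]|[/(_ t) //]] := hv i j; rewrite -(run_uniq r r') /isdir k4 k6.
  by case: (b).
have [[t [r ->]]|[_ ->]] := hv i j; last by [].
have npos : ~ ((L u i).2 = ~~ b /\ (L u (i + t).+1).2 = b).
  by move=> [e1 e2]; apply: hk; exists t; apply: (bclosed_run hS r e1 e2).
suff nneg : ~ ((L u i).2 = b /\ (L u (i + t).+1).2 = ~~ b).
  move: npos nneg; rewrite /isdir; case: (L u i).2; case: (_.2); case: (b) => // h h'.
  - by case: h'.
  - by case: h.
  - by case: h.
  - by case: h'.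
move=> [e1 e2]; have [[r1 r1'] r2 r3 r4 [r5 r6]] := r.
have := r4 0%N (leq0n _); rewrite addn0 => /asboolP[u' [i' [j' [t' [Xu' k hj]]]]].
have hu' := Xw _ Xu'.
have /kpatP[[k1 k2] k3 [k4 k5] [k6 k7] k8] := k.
have inS m : (j' <= m <= j' + t')%N -> S m.
  by move=> hm; apply/asboolP; exists u', i', j', t'; split.
(* The kiss of [u'] to [u] is on the intersection of the run with the kissed substring that contains
   its first pass. *)
have /negP := Xn _ _ Xu' Xu b (i' + (j - j'))%N i (minn (j + t) (j' + t') - j)%N; apply.
have [E1 E2] : ((i' + (j - j') + (minn (j + t) (j' + t') - j)).+1 =
     (i' + (minn (j + t) (j' + t') - j')).+1)%N /\
  ((i + (minn (j + t) (j' + t') - j)).+1 = (i + (minn (j + t) (j' + t') - j)).+1)%N by nlia.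
apply/kpatP; rewrite E1; split.
- by nlia.
- apply: (adm2_cross hbl r2); first by apply: (walk_adm l0 hu); nlia.
  by have := kpat_adm hw k (s := j - j') ; rewrite subnKC; [apply|]; nlia.
- split=> //; case: (eqVneq (nat_of_ord j) j') => [->|njj]; first by rewrite subnn addn0.
  have -> : (i' + (j - j') = (i' + (j - j').-1).+1)%N by nlia.
  rewrite k8; last by nlia.
  have -> : ((j' + (j - j').-1).+1 = j)%N by nlia.
  case: r5 => [d|[_ d]]; first exact: (neq_negb d e1).
  case: d => d; first by nlia.
  by case/negP: d; apply: inS; nlia.
- case: (ltngtP (j + t) (j' + t')) => h.
  + rewrite addKn; split=> //.
    rewrite k8; last by nlia.
    have -> : (j' + (j + t - j') = j + t)%N by nlia.
    case: r6 => [d|[_ d]]; first by rewrite (neq_negb d e2) negbK.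
    by case/negP: d; apply: inS; nlia.
  + rewrite addKn; split=> //.
    rewrite r3; last by nlia.
    by have -> : (j + (j' + t' - j) = j' + t')%N by nlia.
  + by rewrite addKn h addKn.
- move=> s hs; have -> : (i' + (j - j') + s = i' + (j - j' + s))%N by nlia.
  rewrite k8 ?r3; [|nlia|nlia].
  by congr (L w _); nlia.
Qed.

End Signs.

(** * Kisses, g-vectors and distinguished arrows as in Defs *)

Lemma Posz_sum (I : Type) (r : seq I) (P : pred I) (F : I -> nat) :
  Posz (\sum_(i <- r | P i) F i)%N = \sum_(i <- r | P i) Posz (F i).
Proof. exact: (big_morph Posz PoszD (erefl _)). Qed.

Section Translate.
Variables (Q B : bquiver) (iv : vtx Q -> vtx B) (ia : arr Q -> arr B).
Hypothesis hbl : blossoming Q B iv ia.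
Variable l0 : letter B.
Notation inQ0 := (inQ0 iv).
Notation is_walk := (is_walk iv).
Notation L := (nth l0).
Notation kpat := (kpat l0).
Notation nk := (nk l0).
Notation kissn := (kissn l0).
Implicit Types (u w : seq (letter B)) (i j k t p q : nat) (b : bool) (S : nat -> bool).

Lemma verts_nth x0 w i : (i < size w)%N -> nth x0 (verts w) i.+1 = ltgt (L w i).
Proof. by case: w => // l w hi; rewrite [LHS]/= -(nth_map l0 x0 (@ltgt B)). Qed.

Lemma size_verts w : (0 < size w)%N -> size (verts w) = (size w).+1.
Proof. by case: w => // l w _; rewrite /= size_map. Qed.

Lemma sub_verts w p q : (p < q)%N -> (q < size w)%N ->
  (sub w p.+1 q).1 = [seq ltgt (L w k) | k <- iota p (q - p)].
Proof.
move=> pq hq; have x0 := ltgt l0.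
have sv : size (verts w) = (size w).+1 by rewrite size_verts //; nlia.
apply: (@eq_from_nth _ x0); first by rewrite /sub /= size_drop size_takel ?sv ?size_map ?size_iota; nlia.
move=> i; rewrite /sub /= size_drop size_takel ?sv; last by nlia.
move=> hi; rewrite nth_drop nth_take; last by nlia.
rewrite addSn verts_nth; last by nlia.
by rewrite (nth_map 0%N) ?size_iota ?nth_iota //; nlia.
Qed.

Lemma sub_letters w p q : (p < q)%N -> (q < size w)%N ->
  (sub w p.+1 q).2 = [seq L w k | k <- iota p.+1 (q - p.+1)].
Proof.
move=> pq hq; apply: (@eq_from_nth _ l0).
  by rewrite /sub /= size_drop size_takel ?size_map ?size_iota; nlia.
move=> i; rewrite /sub /= size_drop size_takel; last by nlia.
move=> hi; rewrite nth_drop nth_take; last by nlia.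
by rewrite (nth_map 0%N) ?size_iota ?nth_iota //; nlia.
Qed.

(** [p] and [q] are the letters just before and just after the substring, hence the vertex positions
    [p.+1] to [q]: a top substring for [b = true], a bottom one for [b = false]. *)
Definition occ b w p q := [&& p < q, q < size w, (L w p).2 == ~~ b & (L w q).2 == b]%N.

Lemma onth_L w i : onth w i = if (i < size w)%N then Some (L w i) else None.
Proof. by elim: w i => [|l w IH] [|i] //=; rewrite IH. Qed.

Lemma occE w p q b : is_walk w ->
  [&& (0 < p.+1)%N, (p.+1 <= q)%N, all inQ0 (sub w p.+1 q).1,
      dir_at w p == Some (~~ b) & dir_at w q == Some b] = occ b w p q.
Proof.
move=> hw; have hX : (p < q)%N -> (q < size w)%N -> all inQ0 (sub w p.+1 q).1.
  move=> pq hq; rewrite sub_verts //; apply/allP => x /mapP[k]; rewrite mem_iota => hk ->.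
  by rewrite (walk_tgt hbl l0 hw); nlia.
rewrite /occ; move: hX; set X := all _ _ => hX; case: (ltnP p q) hX => //= pq /(_ isT) hX.
rewrite /dir_at !onth_L; case: (ltnP q (size w)) hX => hq hX /=; last by rewrite !andbF.
have -> : (p < size w)%N by nlia.
by rewrite hX.
Qed.

Lemma topoccE w p q : is_walk w -> topocc iv w p.+1 q = occ true w p q.
Proof. exact: (@occE w p q true). Qed.

Lemma botoccE w p q : is_walk w -> botocc iv w p.+1 q = occ false w p q.
Proof. exact: (@occE w p q false). Qed.

Lemma occ_winv w p q b : (p < size w)%N -> (q < size w)%N ->
  occ b (winv w) (size w - q.+1) (size w - p.+1) = occ b w p q.
Proof.
move=> hp hq; rewrite /occ size_winv !nth_winv /=; [|nlia|nlia].
have -> : (size w - (size w - q.+1).+1 = q)%N by nlia.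
have -> : (size w - (size w - p.+1).+1 = p)%N by nlia.
have -> : (size w - q.+1 < size w - p.+1)%N = (p < q)%N by nlia.
rewrite hq (_ : size w - p.+1 < size w)%N /=; last by nlia.
by case: (L w p).2; case: (L w q).2; case: b; rewrite ?andbF.
Qed.

Lemma sub_winv w p q : is_walk w -> (p < q)%N -> (q < size w)%N ->
  sub (winv w) (size w - q.+1).+1 (size w - p.+1) = sinv (sub w p.+1 q).
Proof.
move=> hw pq hq; rewrite [LHS]surjective_pairing /sinv; congr pair.
  rewrite !sub_verts ?size_winv //; [|nlia|nlia].
  apply: (@eq_from_nth _ (ltgt l0)); first by rewrite size_rev !size_map !size_iota; nlia.
  move=> i; rewrite size_map size_iota => hi; rewrite nth_rev ?size_map ?size_iota; last by nlia.
  rewrite !(nth_map 0%N) ?size_iota ?nth_iota; [|nlia..].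
  rewrite nth_winv; last by nlia.
  rewrite ltgt_linv; have -> : (size w - (size w - q.+1 + i).+1 = (p + (q - p - i.+1)).+1)%N by nlia.
  by rewrite (adm2_vtx (walk_adm l0 hw (i := p + (q - p - i.+1)) _)) //; nlia.
rewrite !sub_letters ?size_winv //; [|nlia|nlia].
apply: (@eq_from_nth _ l0); first by rewrite size_winv !size_map !size_iota; nlia.
move=> i; rewrite size_map size_iota => hi.
rewrite nth_winv ?size_map ?size_iota; last by nlia.
rewrite !(nth_map 0%N) ?size_iota ?nth_iota; [|nlia..].
by rewrite nth_winv; [congr (linv (L w _)); nlia | nlia].
Qed.

Lemma sinvK (s : string B) : sinv (sinv s) = s.
Proof. by case: s => s1 s2; rewrite /sinv /= revK winvK. Qed.

Lemma streq_sym (s s' : string B) : streq s s' = streq s' s.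
Proof.
rewrite /streq eq_sym; congr (_ || _); apply/eqP/eqP => ->; by rewrite sinvK.
Qed.

(** A string of length zero is its own inverse, so equality of substrings does not see the
    orientation there; the admissibility of the crossing does. *)
Definition same u p q w p' q' :=
  (sub u p.+1 q == sub w p'.+1 q') && adm2 (L u p) (L w p'.+1).

Lemma sub_eqP u p q w p' q' : (p < q)%N -> (q < size u)%N -> (p' < q')%N -> (q' < size w)%N ->
  sub u p.+1 q = sub w p'.+1 q' ->
  [/\ (q - p = q' - p')%N, ltgt (L u p) = ltgt (L w p') &
     forall s, (s < q - p.+1)%N -> L u (p + s).+1 = L w (p' + s).+1].
Proof.
move=> h1 h2 h3 h4 e.
have e1 : (sub u p.+1 q).1 = (sub w p'.+1 q').1 by rewrite e.
have e2 : (sub u p.+1 q).2 = (sub w p'.+1 q').2 by rewrite e.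
move: e1 e2; rewrite !sub_verts // !sub_letters // => e1 e2.
have hq : (q - p = q' - p')%N by move/(congr1 size): e1; rewrite !size_map !size_iota.
split=> //.
  move/(congr1 (fun s => nth (ltgt l0) s 0)): e1.
  by rewrite !(nth_map 0%N) ?size_iota ?nth_iota ?addn0 //; nlia.
move=> s hs; move/(congr1 (fun x => nth l0 x s)): e2.
by rewrite !(nth_map 0%N) ?size_iota ?nth_iota ?addSn //; nlia.
Qed.

Lemma sub_eqI u p q w p' q' : is_walk u -> is_walk w ->
  (p < q)%N -> (q < size u)%N -> (p' < q')%N -> (q' < size w)%N ->
  (q - p = q' - p')%N -> ltgt (L u p) = ltgt (L w p') ->
  (forall s, (s < q - p.+1)%N -> L u (p + s).+1 = L w (p' + s).+1) ->
  sub u p.+1 q = sub w p'.+1 q'.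
Proof.
move=> hu hw h1 h2 h3 h4 hq e h.
rewrite [LHS]surjective_pairing [RHS]surjective_pairing; congr pair.
  rewrite !sub_verts // -hq; apply: (@eq_from_nth _ (ltgt l0)); rewrite !size_map !size_iota //.
  move=> i hi; rewrite !(nth_map 0%N) ?size_iota ?nth_iota //.
  by case: i hi => [|i] hi; rewrite ?addn0 // !addnS h //; nlia.
rewrite !sub_letters //; have -> : (q' - p'.+1 = q - p.+1)%N by nlia.
apply: (@eq_from_nth _ l0); rewrite !size_map !size_iota // => i hi.
by rewrite !(nth_map 0%N) ?size_iota ?nth_iota // !addSn h.
Qed.

(** Equality up to inversion is realised by exactly one orientation: a string of positive length
    differs from its inverse, and at a single vertex [adm2_orient] selects one. Hence multiplicities
    of kisses survive the passage to oriented words. *)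
Lemma streq_split w p q w' p' q' b : is_walk w -> is_walk w' ->
  occ b w p q -> occ (~~ b) w' p' q' ->
  streq (sub w p.+1 q) (sub w' p'.+1 q') =
  (same w p q w' p' q' + same (winv w) (size w - q.+1) (size w - p.+1) w' p' q')%N :> nat.
Proof.
move=> hw hw' /and4P[pq hq _ _] /and4P[pq' hq' _ _].
rewrite /same sub_winv // /streq nth_winv; last by nlia.
have -> : (size w - (size w - q.+1).+1 = q)%N by nlia.
have e1 : (sub w p.+1 q == sinv (sub w' p'.+1 q')) = (sinv (sub w p.+1 q) == sub w' p'.+1 q').
  by apply/eqP/eqP => [->|<-]; rewrite sinvK.
rewrite e1; case: (ltnP p.+1 q) => h; last first.
  have {h} eq : q = p.+1 by nlia.
  have hs : sinv (sub w p.+1 q) = sub w p.+1 q.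
    rewrite [RHS]surjective_pairing /sinv sub_verts // sub_letters // eq subSnn subnn /=.
    by [].
  rewrite hs orbb; case: eqP => // e.
  have [h1 h2 _] := sub_eqP pq hq pq' hq' e.
  have := adm2_orient hbl (walk_adm l0 hw (i := p) _) (walk_adm l0 hw' (i := p') _) h2.
  rewrite -eq => ->; [|nlia..]; by case: adm2.
have a1 : sub w p.+1 q == sub w' p'.+1 q' -> adm2 (L w p) (L w' p'.+1).
  move=> /eqP /(sub_eqP pq hq pq' hq')[_ _ /(_ 0%N)]; rewrite !addn0 => <-; last by nlia.
  by apply: (walk_adm l0 hw); nlia.
have a2 : sinv (sub w p.+1 q) == sub w' p'.+1 q' -> adm2 (linv (L w q)) (L w' p'.+1).
  rewrite -sub_winv // => /eqP /(sub_eqP _ _ pq' hq'); rewrite size_winv => -[||_ _ /(_ 0%N)]; [nlia..|].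
  rewrite !addn0 => <-; last by nlia.
  rewrite nth_winv ?adm2_linv; last by nlia.
  have -> : (size w - (size w - q.+1).+2 = q.-1)%N by nlia.
  by have := walk_adm l0 hw (i := q.-1); rewrite prednK; [apply|]; nlia.
have a3 : ~~ ((sub w p.+1 q == sub w' p'.+1 q') && (sinv (sub w p.+1 q) == sub w' p'.+1 q')).
  apply/negP => /andP[/eqP <- /eqP e'].
  have /eqP : winv (sub w p.+1 q).2 = (sub w p.+1 q).2 by rewrite -{2}e'.
  apply/negP; rewrite sub_letters //; apply: (@winv_neq_adm _ l0); first by rewrite size_map size_iota; nlia.
  move=> i; rewrite size_map size_iota => hi; rewrite !(nth_map 0%N) ?size_iota ?nth_iota; [|nlia..].
  by rewrite addnS; apply: (walk_adm l0 hw); nlia.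
case: eqP a1 a3 => [e|ne] /=; [move=> /(_ isT) -> | move=> _]; last by case: eqP a2 => // _ /(_ isT) ->.
by case: eqP.
Qed.

Lemma sum_uniq2 m n (P : nat -> nat -> bool) :
  (forall i j, P i j -> (i < m)%N && (j < n)%N) ->
  (forall i j i' j', P i j -> P i' j' -> i = i' /\ j = j') ->
  (\sum_(i < m) \sum_(j < n) P i j)%N = `[< exists i j, P i j >] :> nat.
Proof.
move=> hb hu; case: asboolP => [[i [j hP]]|hn]; last first.
  rewrite big1 // => i _; rewrite big1 // => j _; case: (boolP (P i j)) => // hP.
  by case: hn; exists i, j.
have /andP[hi hj] := hb _ _ hP.
have eqb (i' j' : nat) : P i' j' = (i' == i) && (j' == j).
  apply/idP/andP => [h|[/eqP -> /eqP ->]] //.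
  by have [-> ->] := hu _ _ _ _ h hP; rewrite !eqxx.
rewrite (bigD1 (Ordinal hi)) //= (bigD1 (Ordinal hj)) //= hP big1 ?big1 //.
  move=> i' hi'; rewrite big1 // => j' _; rewrite eqb.
  by move: hi'; rewrite -val_eqE /= => /negbTE ->.
by move=> j' hj'; rewrite eqb; move: hj'; rewrite -val_eqE /= => /negbTE ->; rewrite andbF.
Qed.

Lemma kpat_sum b u w p p' : is_walk u -> is_walk w ->
  `[< exists t, kpat b u p w p' t >] =
  (\sum_(q < size u) \sum_(q' < size w)
     [&& occ b u p q, occ (~~ b) w p' q' & same u p q w p' q'])%N :> nat.
Proof.
move=> hu hw; pose P q q' := [&& occ b u p q, occ (~~ b) w p' q' & same u p q w p' q'].
rewrite (@sum_uniq2 _ _ P); last 2 first.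
- by move=> q q' /and3P[/and4P[_ -> _ _] /and4P[_ -> _ _] _].
- move=> q q' r r' /and3P[/and4P[a1 a2 a3 /eqP a4] /and4P[b1 b2 b3 /eqP b4] /andP[/eqP h _]].
  move=> /and3P[/and4P[c1 c2 c3 /eqP c4] /and4P[d1 d2 d3 /eqP d4] /andP[/eqP h' _]].
  have [e1 _ e2] := sub_eqP a1 a2 b1 b2 h; have [f1 _ f2] := sub_eqP c1 c2 d1 d2 h'.
  suff : q = r by nlia.
  have hneg : b <> ~~ b by case: (b).
  case: (ltngtP q r) => // hqr; exfalso; apply: hneg.
    have := f2 (q - p.+1)%N; rewrite (_ : (p + (q - p.+1)).+1 = q); last by nlia.
    rewrite (_ : (p' + (q - p.+1)).+1 = q'); last by nlia.
    by move=> /(_ ltac:(nlia)) hh; rewrite -[LHS]a4 -b4 hh.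
  have := e2 (r - p.+1)%N; rewrite (_ : (p + (r - p.+1)).+1 = r); last by nlia.
  rewrite (_ : (p' + (r - p.+1)).+1 = r'); last by nlia.
  by move=> /(_ ltac:(nlia)) hh; rewrite -[LHS]c4 -d4 hh.
congr (nat_of_bool _); apply/asboolP/asboolP => [[t]|[q [q']]].
  move=> /kpatP[[k1 k2] k3 [k4 k5] [k6 k7] k8]; exists (p + t).+1, (p' + t).+1.
  apply/and3P; split; rewrite /occ ?k1 ?k2 ?k4 ?k5 ?k6 ?k7 ?negbK ?eqxx ?ltnS ?leq_addr //.
  rewrite /same k3 andbT.
  have vp : ltgt (L u p) = ltgt (L w p').
    by rewrite (adm2_vtx k3) -(adm2_vtx (walk_adm l0 hw (i := p') _)) //; nlia.
  apply/eqP; apply: sub_eqI => //; rewrite ?ltnS ?leq_addr //; first by nlia.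
  by move=> s hs; apply: k8; nlia.
move=> /and3P[/and4P[a1 a2 /eqP a3 /eqP a4] /and4P[b1 b2 /eqP b3 /eqP b4] /andP[/eqP h h']].
have [e1 _ e2] := sub_eqP a1 a2 b1 b2 h.
exists (q - p.+1)%N; apply/kpatP.
have -> : ((p + (q - p.+1)).+1 = q)%N by nlia.
have -> : ((p' + (q - p.+1)).+1 = q')%N by nlia.
by rewrite negbK in b3.
Qed.

Definition kisscnt b w w' : nat := (\sum_(p < size w) \sum_(q < size w)
  \sum_(p' < size w') \sum_(q' < size w')
   [&& occ b w p q, occ (~~ b) w' p' q' & streq (sub w p.+1 q) (sub w' p'.+1 q')])%N.

Lemma kisscntE b w w' : is_walk w -> is_walk w' ->
  Posz (kisscnt b w w') = kissn b w w' + kissn b (winv w) w'.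
Proof.
move=> hw hw'.
pose G u p q := (\sum_(p' < size w') \sum_(q' < size w')
   [&& occ b u p q, occ (~~ b) w' p' q' & same u p q w' p' q'])%N.
have KcE u : is_walk u -> kissn b u w' = Posz (\sum_(p < size u) \sum_(q < size u) G u p q)%N.
  move=> hu; rewrite Posz_sum; apply: eq_bigr => p _; rewrite -Posz_sum.
  congr Posz; rewrite /G exchange_big /=; apply: eq_bigr => p' _.
  by rewrite kpat_sum.
rewrite !KcE //; last exact: walk_winv hbl l0 _ hw.
rewrite -PoszD; congr Posz; rewrite size_winv /kisscnt.
have -> : (\sum_(p < size w) \sum_(q < size w) G (winv w) p q =
  \sum_(p < size w) \sum_(q < size w) G (winv w) (size w - q.+1) (size w - p.+1))%N.
  rewrite exchange_big (reindex_inj rev_ord_inj); apply: eq_bigr => p _ /=.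
  by rewrite (reindex_inj rev_ord_inj).
rewrite -big_split; apply: eq_bigr => p _; rewrite -big_split; apply: eq_bigr => q _ /=.
rewrite /G -big_split; apply: eq_bigr => p' _; rewrite -big_split; apply: eq_bigr => q' _ /=.
rewrite occ_winv //; case: (boolP (occ b w p q)) => //= h1; case: (boolP (occ _ w' _ _)) => //= h2.
exact: (streq_split hw hw' h1 h2).
Qed.

Lemma kiss_countE w w' : is_walk w -> is_walk w' ->
  kiss_count iv w w' = kisscnt true w w' /\ kiss_count iv w' w = kisscnt false w w'.
Proof.
have gen x y : is_walk x -> is_walk y ->
  kiss_count iv x y = (\sum_(p < size x) \sum_(q < size x)
  \sum_(p' < size y) \sum_(q' < size y)
   [&& occ true x p q, occ false y p' q' & streq (sub x p.+1 q) (sub y p'.+1 q')])%N.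
  move=> hx hy; rewrite /kiss_count big_ord_recl big1 ?add0n; last first.
    by move=> q _; rewrite big1 // => p' _; rewrite big1.
  apply: eq_bigr => p _; rewrite big_ord_recr /= [X in (_ + X)%N]big1 ?addn0; last first.
    by move=> p' _; rewrite big1 // => q' _; rewrite topoccE // /occ ltnn andbF.
  apply: eq_bigr => q _; rewrite big_ord_recl big1 ?add0n; last first.
    by move=> q' _; rewrite /botocc /= andbF.
  apply: eq_bigr => p' _; rewrite big_ord_recr /= botoccE // [X in (_ + X)%N](_ : _ = 0%N) ?addn0.
    by apply: eq_bigr => q' _; rewrite topoccE // botoccE.
  by rewrite /occ ltnn !andbF.
move=> hw hw'; split; first exact: gen.
rewrite gen // /kisscnt.
transitivity (\sum_(pq : 'I_(size w') * 'I_(size w')) \sum_(pq' : 'I_(size w) * 'I_(size w))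
  [&& occ true w' pq.1 pq.2, occ false w pq'.1 pq'.2 & streq (sub w' pq.1.+1 pq.2) (sub w pq'.1.+1 pq'.2)])%N.
  rewrite pair_bigA; apply: eq_bigr => -[p q] _ /=; rewrite pair_bigA; by apply: eq_bigr => -[].
rewrite exchange_big [RHS]pair_bigA; apply: eq_bigr => -[p q] _ /=.
rewrite pair_bigA /=; apply: eq_bigr => -[p' q'] _ /=.
by rewrite andbCA streq_sym.
Qed.

Lemma kissn_ge0 b u w : 0 <= kissn b u w.
Proof. by apply: sumr_ge0 => i _; apply: sumr_ge0. Qed.

Lemma kissn_eq0 b u w : kissn b u w = 0 <-> forall i j t, ~~ kpat b u i w j t.
Proof.
split=> [h i j t|h]; last first.
  rewrite /kissn big1 // => i _; rewrite big1 // => j _; case: asboolP => // -[t].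
  by rewrite (negbTE (h _ _ _)).
apply/negP => hk; have /kpatP[[h1 h2] _ _ _ _] := hk.
have hi : (i < size u)%N by nlia.
have hj : (j < size w)%N by nlia.
have : 0 < kissn b u w; last by rewrite h.
rewrite /kissn (bigD1 (Ordinal hi)) //= (bigD1 (Ordinal hj)) //=.
rewrite (_ : `[< _ >] = true); last by apply/asboolP; exists t.
apply: ltr_pwDl; last by apply: sumr_ge0 => *; apply: sumr_ge0.
by apply: ltr_pwDl => //; apply: sumr_ge0.
Qed.

Lemma kissesP w w' : is_walk w -> is_walk w' ->
  ~~ kisses iv w w' <-> (forall i j t, ~~ kpat true w i w' j t) /\
                        (forall i j t, ~~ kpat true (winv w) i w' j t).
Proof.
move=> hw hw'; rewrite /kisses; have [-> _] := kiss_countE hw hw'.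
have := kisscntE true hw hw'; have := kissn_ge0 true w w'; have := kissn_ge0 true (winv w) w'.
rewrite -!kissn_eq0; case: kisscnt => [|n] h1 h2 h3; split=> // h.
  by split; apply/eqP; rewrite eq_le; apply/andP; split=> //; lia.
by case: h => e1 e2; move: h3; rewrite e1 e2.
Qed.

Lemma nk_winv u w : is_walk u -> is_walk w -> nk u w -> nk (winv u) (winv w).
Proof.
move=> hu hw h b i j t; apply/negP => hk.
have := kpat_winv hbl hk (walk_winv hbl l0 hu) (walk_winv hbl l0 hw).
by rewrite !winvK; apply/negP/h.
Qed.

Lemma kisses_nk w w' : is_walk w -> is_walk w' -> ~~ kisses iv w w' -> ~~ kisses iv w' w ->
  [/\ nk w w', nk (winv w) w', nk w (winv w') & nk (winv w) (winv w')].
Proof.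
move=> hw hw' /(kissesP hw hw')[h1 h2] /(kissesP hw' hw)[h3 h4].
have wi := walk_winv hbl l0 hw; have wi' := walk_winv hbl l0 hw'.
have n1 : nk w w'.
  case=> i j t; first exact: h1.
  by apply/negP => /(kpat_sym hbl hw hw'); apply/negP/h3.
have n2 : nk (winv w) w'.
  case=> i j t; first exact: h2.
  apply/negP => hk; have := kpat_winv hbl hk wi hw'; rewrite winvK.
  by move/(kpat_sym hbl hw wi'); apply/negP/h4.
split=> //; last exact: nk_winv.
by have := nk_winv wi hw' n2; rewrite winvK.
Qed.

End Translate.

(** * Scalar products of g-vectors with strings, and distinguished arrows *)

Section Vectors.
Variables (R : realType) (Q B : bquiver) (iv : vtx Q -> vtx B) (ia : arr Q -> arr B).
Hypothesis hbl : blossoming Q B iv ia.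
Variable l0 : letter B.
Notation inQ0 := (inQ0 iv).
Notation is_walk := (is_walk iv).
Notation L := (nth l0).
Notation gpair1 := (gpair1 l0).
Notation topl := (topl l0).
Notation sepR := (sepR l0).
Notation sepL := (sepL l0).
Notation compat := (compat l0).
Notation gvec := (gvec R iv).
Implicit Types (u w : seq (letter B)) (i j k t p q : nat) (b : bool) (S : nat -> bool).

Definition maskvec w S (v : vtx Q) : R :=
  (\sum_(j < size w) (S j && (ltgt (L w j) == iv v)))%N%:R.

Lemma mvec_sub w p q v : (p < q)%N -> (q < size w)%N ->
  mvec R iv (sub w p.+1 q) v = maskvec w (itv p q) v.
Proof.
move=> pq hq; rewrite /mvec /maskvec (sub_verts l0) //; congr (_%:R).
rewrite -sum1_count big_map -[iota _ _]/(index_iota p q) big_mkcond /=.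
rewrite -(big_mkord xpredT (fun j => nat_of_bool (itv p q j && (ltgt (L w j) == iv v)))).
rewrite (@big_cat_nat _ _ _ p 0 (size w)) //=; last by nlia.
rewrite (@big_cat_nat _ _ _ q p (size w)) //=; [|nlia..].
rewrite [X in (X + _)%N]big_nat [X in (X + _)%N]big1 ?add0n; last first.
  by move=> j hj; rewrite /itv (_ : (p <= j)%N = false) //; nlia.
rewrite [X in (_ + X)%N]big_nat [X in (_ + X)%N]big1 ?addn0; last first.
  by move=> j hj; rewrite /itv (_ : (j < q)%N = false) ?andbF //; nlia.
by rewrite [LHS]big_nat [RHS]big_nat; apply: eq_bigr => j hj; rewrite /itv hj /=; case: eqP.
Qed.

Definition gturn w (x : vtx B) : int := \sum_(i < size w)
  (if (i.+1 < size w)%N && (ltgt (L w i) == x) then isdir true (L w i.+1) - isdir true (L w i) else 0).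

Lemma gvecE w v : is_walk w -> gvec w v = (gturn w (iv v))%:~R.
Proof.
move=> hw; rewrite /Defs.gvec /gturn !pmulrn -rmorphB; congr (_%:~R).
rewrite !big_ord_recl /= !add0n !Posz_sum -sumrB; apply: eq_bigr => i _.
rewrite (topoccE hbl l0) // (botoccE hbl l0) // /bump /= add1n /occ ltnSn /=.
case: (ltnP i.+1 (size w)) => hi /=; last by [].
have -> : drop i.+1 (take i.+2 (verts w)) = (sub w i.+1 i.+1).1 by [].
rewrite (sub_verts l0) // subSnn /= eqseq_cons andbT.
by rewrite /isdir; case: (ltgt (L w i) == iv v); case: (L w i).2; case: (L w i.+1).2.
Qed.

(** Each pass of [u] through the vertex of a pass of [w] is compatible with it in exactly one
    orientation, so the two orientations together see every turn of [u] once. *)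
Lemma gpair1_gturn w u S : is_walk u -> is_walk w -> valid S w ->
  gpair1 true S u w + gpair1 true S (winv u) w =
  \sum_(j < size w) if S j then gturn u (ltgt (L w j)) else 0.
Proof.
move=> hu hw hS; apply/esym.
have -> : gpair1 true S (winv u) w = \sum_(i < size u) \sum_(j < size w)
   (if [&& S j, i.+1 < size u, j.+1 < size w & adm2 (linv (L u i.+1)) (L w j.+1)]%N
    then isdir true (L u i.+1) - isdir true (L u i) else 0).
  rewrite /gpair1 size_winv; have := walk_pos l0 hu; case esz : (size u) => [//|n] _.
  rewrite big_ord_recr [RHS]big_ord_recr /= [X in _ + X = _]big1 ?addr0; last first.
    by move=> j _; rewrite /compat size_winv esz ltnn andbF.
  rewrite [X in _ = _ + X]big1 ?addr0; last by move=> j _; rewrite ltnn andbF.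
  rewrite (reindex_inj rev_ord_inj); apply: eq_bigr => i _; apply: eq_bigr => j _ /=.
  have hi := ltn_ord i.
  rewrite /compat size_winv esz !nth_winv; [|nlia..].
  have -> : (size u - (n - i.+1).+1 = i.+1)%N by nlia.
  have -> : (size u - (n - i.+1).+2 = i)%N by nlia.
  have -> : ((n - i.+1).+1 < n.+1)%N = (i.+1 < n.+1)%N by nlia.
  (* Reading [u] backwards exchanges the two letters of a pass and negates their directions, which
     leaves the increment unchanged. *)
  case: ifP => // _; rewrite /isdir /=.
  by case: (L u i).2; case: (L u i.+1).2.
rewrite /gpair1 -big_split /=; under [RHS]eq_bigr => i _ do rewrite -big_split /=.
rewrite exchange_big /=; apply: eq_bigr => j _; rewrite /gturn.
case: ifP => [Sj|_] /=; last by rewrite big1.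
have hj := hS _ Sj.
apply: eq_bigr => i _; rewrite /compat hj /=.
case: (ltnP i.+1 (size u)) => hi /=; last by [].
have aw := walk_adm l0 hw hj; have au := walk_adm l0 hu hi.
case: eqP => e.
  by rewrite (adm2_orient hbl au aw e); case: adm2; rewrite ?addr0 ?add0r.
rewrite ifN ?ifN //; first by apply/negP => /adm2_vtx; rewrite ltgt_linv -(adm2_vtx au) -(adm2_vtx aw).
by apply/negP => /adm2_vtx; rewrite -(adm2_vtx aw).
Qed.

Lemma dotp_maskvec w u S : is_walk u -> is_walk w -> valid S w ->
  dotp (gvec u) (maskvec w S) = (gpair1 true S u w + gpair1 true S (winv u) w)%:~R.
Proof.
move=> hu hw hS; rewrite gpair1_gturn // /dotp.
under eq_bigr => v _ do rewrite gvecE // /maskvec natr_sum mulr_sumr.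
rewrite exchange_big rmorph_sum /=; apply: eq_bigr => j _.
case: ifP => [Sj|_] /=; last by rewrite big1 // => v _; rewrite mulr0.
have /codomP[v0 e] : ltgt (L w j) \in codom iv.
  by have := walk_tgt hbl l0 hw (ltn_ord j); rewrite hS // /Defs.inQ0 => ->.
have ivI : injective iv by move: hbl; rewrite /blossoming; case.
rewrite (bigD1 v0) //= e eqxx mulr1 big1 ?addr0 // => v hv.
by rewrite (inj_eq ivI) eq_sym (negbTE hv) mulr0.
Qed.

Lemma sepR_winv b u i w k t : (i < size u)%N -> (k < size w)%N -> sepR b u i w k t ->
  sepL (~~ b) (winv u) (size u - i.+1) (winv w) (size w - k.+1) t.
Proof.
move=> hi hk [h1 h2 h3 h4 h5].
have Eq x m s : (m + s < size x)%N -> L (winv x) (size x - m.+1 - s) = linv (L x (m + s)).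
  by move=> h; rewrite nth_winv; [congr (linv (L x _)); nlia | nlia].
split; rewrite ?Eq ?h4 ?h5 //=; [nlia|nlia| |by rewrite h4|by rewrite h5].
by move=> s hs; rewrite !Eq; [rewrite h3 | nlia | nlia].
Qed.

Lemma sepL_winv b u i w k t : (i < size u)%N -> (k < size w)%N -> sepL b u i w k t ->
  sepR (~~ b) (winv u) (size u - i.+1) (winv w) (size w - k.+1) t.
Proof.
move=> hi hk [h1 h2 h3 h4 h5].
have Eq x m s : (m < size x)%N -> (s <= m)%N -> L (winv x) (size x - m.+1 + s) = linv (L x (m - s)).
  by move=> h hs; rewrite nth_winv; [congr (linv (L x _)); nlia | nlia].
split; rewrite ?size_winv ?Eq ?h4 ?h5 //=; [nlia|nlia| |by rewrite h4|by rewrite h5].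
by move=> s hs; rewrite !Eq; [rewrite h3 | nlia..].
Qed.

Lemma topl_winv (Fs : seq (letter B) -> Prop) w k : (forall u, Fs u -> Fs (winv u)) ->
  (k < size w)%N -> topl Fs w k -> topl Fs (winv w) (size w - k.+1).
Proof.
move=> Fi hk ht u i Fu hi e t.
have hk' : (size w - k.+1 < size (winv w))%N by rewrite size_winv; nlia.
have ek : (size w - (size w - k.+1).+1 = k)%N by nlia.
have e' : L (winv u) (size u - i.+1) = L w k.
  rewrite nth_winv; last by nlia.
  have -> : (size u - (size u - i.+1).+1 = i)%N by nlia.
  by rewrite e nth_winv ?linvK ?ek //; rewrite size_winv in hk'.
have hi' : (size u - i.+1 < size (winv u))%N by rewrite size_winv; nlia.
have ed : (L (winv w) (size w - k.+1)).2 = ~~ (L w k).2.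
  by rewrite nth_winv ?ek //; rewrite size_winv in hk'.
have [n1 n2] := ht _ _ (Fi _ Fu) hi' e' t.
rewrite ed; split=> h.
  by have := sepR_winv hi hk' h; rewrite negbK winvK size_winv ek.
by have := sepL_winv hi hk' h; rewrite negbK winvK size_winv ek.
Qed.

Definition sym (F : set (seq (letter B))) u : Prop := F u \/ F (winv u).

Lemma sym_winv F u : sym F u -> sym F (winv u).
Proof. by rewrite /sym winvK => -[]; auto. Qed.

Lemma sides_eq u w i k : (i < size u)%N -> (k < size w)%N ->
  (forall t, L u (i + t) = L w (k + t) \/ (size u <= i + t)%N) ->
  (size u - i = size w - k)%N -> i = k -> (forall s, (s <= i)%N -> L u (i - s) = L w (k - s)) -> u = w.
Proof.
move=> hi hk h1 h2 h3 h4; subst k; apply: (@eq_from_nth _ l0); first by nlia.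
move=> s hs; case: (leqP s i) => h; first by rewrite -(subKn h) h4 //; nlia.
by case: (h1 (s - i)%N); rewrite subnKC ?(ltnW h) //; nlia.
Qed.

(** A straight walk reading [a] forward reads everything forward, so it never passes above another
    word. Words that do not separate on either side of the mark coincide, so a word that is never
    surpassed is the maximum. *)
Lemma distinguished_topl (F : set (seq (letter B))) w k a : (forall u, F u -> is_walk u) ->
  F w \/ F (winv w) -> (k < size w)%N -> L w k = (a, true) ->
  distinguished (Sext iv F) a (w, k) <-> topl (sym F) w k.
Proof.
move=> Fw0 Fw hk e.
have Fwalk u : sym F u -> is_walk u.
  by case=> h; [apply: Fw0|rewrite -(winvK u); apply: (walk_winv hbl l0); apply: Fw0].
have hw := Fwalk _ Fw.
split.
  move=> [_ hd] u i Fu hi eu t; rewrite e /=.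
  have mk : marks (Sext iv F) a (u, i).
    by split; [case: Fu => ?; [left|right; left] | rewrite (onth_L l0) hi eu e].
  split=> -[h1 h2 h3 h4 h5].
    have t0 : (0 < t)%N by case: t h1 h2 h3 h4 h5 => // _ _ _; rewrite !addn0 eu e.
    have ne : (u, i) <> (w, k) by case=> uw ik; move: h4; rewrite uw ik h5.
    have [_ [_ hR]] := hd _ mk ne; have [] := hR t t0.
    - move=> s /andP[_ hs] /=; rewrite /Rside !(onth_L l0) h3 //.
      by rewrite !ifT //; nlia.
    - by rewrite /Rside /= !(onth_L l0) h1 h2 => -[] hh; move: h4; rewrite hh h5.
    - move=> x [y [+ _]]; rewrite /Rside /= (onth_L l0) h1 => -[hh].
      by rewrite hh in h4.
  have t0 : (0 < t)%N by case: t h1 h2 h3 h4 h5 => // _ _ _; rewrite !subn0 eu e.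
  have ne : (u, i) <> (w, k) by case=> uw ik; move: h4; rewrite uw ik h5.
  have [_ [hL _]] := hd _ mk ne; have [] := hL t t0.
  - move=> s /andP[_ hs] /=; rewrite /Lside !(onth_L l0).
    rewrite !ifT; try nlia.
    by rewrite h3 // !ifT //; nlia.
  - rewrite /Lside /= h1 h2 !(onth_L l0) !ifT; try nlia.
    by move=> [] hh; move: h4; rewrite hh h5.
  - move=> x [y [+ _]]; rewrite /Lside /= h1 (onth_L l0) !ifT; try nlia.
    by move=> [hh]; rewrite hh in h4.
move=> ht; split.
  by split; [case: Fw => ?; [left|right; left] | rewrite (onth_L l0) hk e].
move=> [u i] [/= Su]; rewrite (onth_L l0); case: ltnP => // hi [eu] ne.
have hu : is_walk u.
  by case: Su => [?|[?|[]]] //; apply: Fwalk; [left|right].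
have euw : L u i = L w k by rewrite eu e.
have strt : (is_walk u /\ straight u) -> forall j, (j < size u)%N -> (L u j).2.
  move=> [_ /orP[]] /all_nthP h j hj; first exact: h.
  by have := h l0 i hi; rewrite eu.
have rd := right_dich hbl hu hw hi hk euw; have ld := left_dich hbl hu hw hi hk euw.
have dR t : (0 < t)%N -> (i + t < size u)%N -> (k + t < size w)%N ->
    (forall s, (s < t)%N -> L u (i + s) = L w (k + s)) -> (L u (i + t)).2 != (L w (k + t)).2 ->
    (L u (i + t)).2 = true /\ (L w (k + t)).2 = false.
  move=> t0 h1 h2 h3 h4; suff h : (L u (i + t)).2 by move: h4; rewrite h; case: (_.2).
  case: Su => [Fu|[Fu|hs]]; last exact: strt.
    have [hn _] := ht u i (or_introl Fu) hi euw t; apply/negPn/negP => hh; apply: hn.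
    by rewrite e; split=> //=; move: h4 hh; case: (_.2); case: (_.2).
  have [hn _] := ht u i (or_intror Fu) hi euw t; apply/negPn/negP => hh; apply: hn.
  by rewrite e; split=> //=; move: h4 hh; case: (_.2); case: (_.2).
have dL t : (0 < t)%N -> (t <= i)%N -> (t <= k)%N ->
    (forall s, (s < t)%N -> L u (i - s) = L w (k - s)) -> (L u (i - t)).2 != (L w (k - t)).2 ->
    (L u (i - t)).2 = true /\ (L w (k - t)).2 = false.
  move=> t0 h1 h2 h3 h4; suff h : (L u (i - t)).2 by move: h4; rewrite h; case: (_.2).
  case: Su => [Fu|[Fu|hs]]; last by apply: strt => //; nlia.
    have [_ hn] := ht u i (or_introl Fu) hi euw t; apply/negPn/negP => hh; apply: hn.
    by rewrite e; split=> //=; move: h4 hh; case: (_.2); case: (_.2).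
  have [_ hn] := ht u i (or_intror Fu) hi euw t; apply/negPn/negP => hh; apply: hn.
  by rewrite e; split=> //=; move: h4 hh; case: (_.2); case: (_.2).
split.
  case: ld => [[t [h1 h2 h3 h4 h5]]|[h1 h2]].
    left; exists t; split=> //; split.
      move=> s /andP[_ hs]; rewrite /Lside /= !(onth_L l0) h4 //.
      by rewrite !ifT //; nlia.
    rewrite /Lside /= h2 h3 !(onth_L l0) !ifT; try nlia.
    by move=> [hh]; rewrite hh eqxx in h5.
  case: rd => [[t [h3 h4 h5 h6 h7]]|[h3 h4]].
    right; exists t; split=> //; split.
      move=> s /andP[_ hs]; rewrite /Rside /= !(onth_L l0) h6 //.
      by rewrite !ifT //; nlia.
    by rewrite /Rside /= !(onth_L l0) h4 h5 => -[hh]; rewrite hh eqxx in h7.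
  exfalso; apply: ne; congr pair => //; apply: (sides_eq hi hk) => //.
  by move=> t; case: (ltnP (i + t) (size u)) => h; [left; apply: h4|right].
split=> s s0 /= hag hdiff.
  case: ld => [[t [h1 h2 h3 h4 h5]]|[h1 h2]]; last first.
    case: hdiff; rewrite /Lside /= !(onth_L l0) -h1; case: (leqP s i) => // hs.
    by rewrite h2 // -h1 !ifT //; nlia.
  have st : s = t.
    case: (ltngtP s t) => // hst; exfalso.
      apply: hdiff; rewrite /Lside !(onth_L l0) h4 //.
      by rewrite !ifT //; nlia.
    have := hag t; rewrite h1 hst => /(_ isT); rewrite /Lside /= h2 h3 !(onth_L l0).
    rewrite !ifT; try nlia.
    by move=> [hh]; rewrite hh eqxx in h5.
  rewrite {}st in hag hdiff *; have [d1 d2] := dL t h1 h2 h3 h4 h5.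
  exists (L u (i - t)).1, (L w (k - t)).1; rewrite /Lside h2 h3 !(onth_L l0).
  rewrite !ifT; try nlia.
  by split; congr Some; [rewrite -d1|rewrite -d2]; apply: surjective_pairing.
case: rd => [[t [h1 h2 h3 h4 h5]]|[h1 h2]]; last first.
  case: hdiff; rewrite /Rside /= !(onth_L l0); case: (ltnP (i + s) (size u)) => hs.
    by rewrite h2 // !ifT //; nlia.
  by rewrite (_ : (k + s < size w)%N = false) //; nlia.
have st : s = t.
  case: (ltngtP s t) => // hst; exfalso.
    apply: hdiff; rewrite /Rside !(onth_L l0) h4 //.
    by rewrite !ifT //; nlia.
  have := hag t; rewrite h1 hst => /(_ isT); rewrite /Rside /= !(onth_L l0) h2 h3.
  by move=> [hh]; rewrite hh eqxx in h5.
rewrite {}st in hag hdiff *; have [d1 d2] := dR t h1 h2 h3 h4 h5.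
exists (L u (i + t)).1, (L w (k + t)).1; rewrite /Rside !(onth_L l0) h2 h3.
by split; congr Some; [rewrite -d1|rewrite -d2]; apply: surjective_pairing.
Qed.

Lemma dist_pos_topl (F : set (seq (letter B))) w k : (forall u, F u -> is_walk u) -> F w ->
  (k < size w)%N -> dist_pos (Sext iv F) w k <-> topl (sym F) w k.
Proof.
move=> Fw0 Fw hk; rewrite /dist_pos (onth_L l0) hk; case e : (L w k) => [a []].
  by apply: distinguished_topl => //; left.
have hk' : (size w - k.+1 < size (winv w))%N by rewrite size_winv; nlia.
have ek : (size w - (size w - k.+1).+1 = k)%N by nlia.
rewrite distinguished_topl //; last 2 first.
- by right; rewrite winvK.
- by rewrite nth_winv ?ek ?e //; rewrite size_winv in hk'.
split=> h; last by apply: topl_winv => // u; apply: sym_winv.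
have := topl_winv (@sym_winv F) hk' h; rewrite winvK size_winv ek; exact.
Qed.

End Vectors.

(** * Fans with flips and a supporting point for every face *)

Section Farkas.
Variables (R : realFieldType) (V : finType).
Implicit Types (x y b : V -> R) (a : nat -> V -> R).

Definition dot y x : R := \sum_v y v * x v.

Lemma dot_combr y x x' (s : R) : dot y (fun v => x v + s * x' v) = dot y x + s * dot y x'.
Proof.
by rewrite /dot mulr_sumr -big_split; apply: eq_bigr => v _ /=; ring.
Qed.

Lemma dot_combl y y' x (s : R) : dot (fun v => y v + s * y' v) x = dot y x + s * dot y' x.
Proof.
by rewrite /dot mulr_sumr -big_split; apply: eq_bigr => v _ /=; ring.
Qed.

(** Induction on the number of generators: if the functional separating [b] from the first ones is
    negative on the last one, everything is projected along that last vector onto the kernel of the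
    functional. *)
Lemma farkas m a b :
  (exists l : nat -> R, (forall i, 0 <= l i) /\ forall v, b v = \sum_(i < m) l i * a i v) \/
  (exists y, (forall i, (i < m)%N -> 0 <= dot y (a i)) /\ dot y b < 0).
Proof.
elim: m a b => [|m IH] a b.
  case: (pselect (forall v, b v = 0)) => [h|/existsNP[v /eqP hv]].
    by left; exists (fun=> 0); split=> // v; rewrite big_ord0.
  right; exists (fun v => - b v); split=> //; rewrite /dot (bigD1 v) //=.
  apply: (@le_lt_trans _ _ (- b v * b v)).
    by rewrite gerDl; apply: sumr_le0 => u _; rewrite mulNr oppr_le0 -expr2 sqr_ge0.
  by rewrite mulNr oppr_lt0 -expr2 lt_neqAle sqr_ge0 eq_sym expf_neq0.
have [[l [l0 hl]]|[y1 [h1 h2]]] := IH a b.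
  left; exists (fun i => if (i < m)%N then l i else 0); split=> [i|v]; first by case: ifP.
  rewrite big_ord_recr /= ltnn mul0r addr0 hl; apply: eq_bigr => i _; by rewrite ltn_ord.
case: (lerP 0 (dot y1 (a m))) => ham.
  right; exists y1; split=> // i; rewrite ltnS leq_eqVlt => /orP[/eqP ->//|]; exact: h1.
pose r x := - (dot y1 x / dot y1 (a m)).
pose proj x v := x v + r x * a m v.
have dproj y x : dot y (proj x) = dot y x + r x * dot y (a m) by rewrite dot_combr.
have r_ge0 i : (i < m)%N -> 0 <= r (a i).
  by move=> hi; rewrite /r -mulrN mulr_ge0 ?h1 // -invrN invr_ge0 oppr_ge0 ltW.
have rb : r b <= 0.
  by rewrite /r oppr_le0 -mulrNN -invrN mulr_ge0 ?invr_ge0 ?oppr_ge0 // ltW.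
have [[l [l0 hl]]|[y2 [h3 h4]]] := IH (fun i => proj (a i)) (proj b).
  left; exists (fun i => if (i < m)%N then l i else \sum_(i < m) l i * r (a i) - r b).
  split=> [i|v].
    case: ifP => // _; rewrite subr_ge0 (le_trans rb) //; apply: sumr_ge0 => j _.
    by rewrite mulr_ge0 // r_ge0.
  rewrite big_ord_recr /= ltnn.
  have := hl v; rewrite {1}/proj => /(canRL (addrK _)) ->.
  rewrite mulrBl addrA; congr (_ - _); rewrite mulr_suml -big_split /=; apply: eq_bigr => i _.
  by rewrite ltn_ord /proj; ring.
(* With this [s] the functional [y2 + s * y1] vanishes on [a m]. *)
right; pose s := - (dot y2 (a m) / dot y1 (a m)).
have ey x : dot (fun v => y2 v + s * y1 v) x = dot y2 (proj x).
  by rewrite dot_combl dproj /s /r; ring.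
exists (fun v => y2 v + s * y1 v); split; last by rewrite ey.
move=> i; rewrite ltnS leq_eqVlt ey => /orP[/eqP ->|hi]; last exact: h3.
by rewrite dproj /r divff ?lt_eqF // mulN1r subrr.
Qed.

End Farkas.

Lemma mulmx1C_rect (F : comNzRingType) m n (e : m = n) (A : 'M[F]_(m, n)) (C : 'M[F]_(n, m)) :
  A *m C = 1%:M -> C *m A = 1%:M.
Proof. by case: _ / e A C => A C; apply: mulmx1C. Qed.

(** * Completeness, purity and the polytope of a fan with flips *)

Section Fan.
Local Open Scope classical_set_scope.
Variables (R : realType) (Q : bquiver).
Notation V := (vtx Q).
Notation vec := (V -> R).
Implicit Types (x y z : vec).

Lemma dotp_sumr (I : Type) (r : seq I) (P : pred I) (l : I -> R) (a : I -> vec) y :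
  dotp y (fun v => \sum_(i <- r | P i) l i * a i v) = \sum_(i <- r | P i) l i * dotp y (a i).
Proof.
rewrite /dotp; under eq_bigr => v _ do rewrite mulr_sumr.
rewrite exchange_big; apply: eq_bigr => i _ /=; rewrite mulr_sumr.
by apply: eq_bigr => v _; rewrite mulrCA.
Qed.

Lemma dotpC x y : dotp x y = dotp y x.
Proof. by apply: eq_bigr => v _; rewrite mulrC. Qed.

Lemma dotp_suml (I : Type) (r : seq I) (P : pred I) (l : I -> R) (a : I -> vec) y :
  dotp (fun v => \sum_(i <- r | P i) l i * a i v) y = \sum_(i <- r | P i) l i * dotp (a i) y.
Proof. by rewrite dotpC dotp_sumr; apply: eq_bigr => i _; rewrite dotpC. Qed.

Lemma dotp_comb y x x' (s : R) : dotp y (fun v => x v + s * x' v) = dotp y x + s * dotp y x'.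
Proof. exact: (@dot_combr _ V). Qed.

(** An extra coordinate equal to 1 turns convex combinations into conic ones. *)
Lemma conv_or_separated (m : nat) (p : nat -> vec) x :
  (exists l : nat -> R, [/\ forall i, 0 <= l i, \sum_(i < m) l i = 1 &
     x = fun v => \sum_(i < m) l i * p i v]) \/
  (exists y, forall i, (i < m)%N -> dotp y (p i) < dotp y x).
Proof.
pose lift (z : vec) (v : V + unit) : R := if v is inl v then z v else 1.
have dlift (y : V + unit -> R) z : dot y (lift z) = dotp (fun v => y (inl v)) z + y (inr tt).
  rewrite /dot big_sumType /=; congr (_ + _).
  by rewrite (big_pred1 tt) ?mulr1 // => -[].
have [[l [l0 hl]]|[y [h1 h2]]] := farkas m (fun i => lift (p i)) (lift x).
  left; exists l; split=> //.
    by have /= := hl (inr tt); under eq_bigr => i _ do rewrite mulr1; move=> <-.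
  by apply/funext => v; have /= := hl (inl v).
right; exists (fun v => - y (inl v)) => i hi.
have hN z : dotp (fun v => - y (inl v)) z = - dotp (fun v => y (inl v)) z.
  by rewrite /dotp -sumrN; apply: eq_bigr => v _; rewrite mulNr.
have := h1 i hi; move: h2; rewrite !dlift !hN; lra.
Qed.

Variables (T : finType) (g : T -> vec) (kap : T -> R) (face : pred {set T}).
Implicit Types (X Y F : {set T}) (w : T).

Definition dual X (c : T -> vec) :=
  forall w w', w \in X -> w' \in X -> dotp (g w) (c w') = (w == w')%:R.

Lemma dual_mx X c : dual X c ->
  (\matrix_(i < #|X|, j < #|V|) g (enum_val i) (enum_val j)) *m
  (\matrix_(j < #|V|, i < #|X|) c (enum_val i) (enum_val j)) = 1%:M.
Proof.
move=> d; apply/matrixP => i j; rewrite !mxE.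
under eq_bigr => k _ do rewrite !mxE.
rewrite -(big_enum_val (fun v => g (enum_val i) v * c (enum_val j) v)) /=.
rewrite -/(dotp _ _); have := d _ _ (enum_valP i) (enum_valP j).
by rewrite (inj_eq enum_val_inj) => <-; apply: eq_bigl.
Qed.

Lemma dual_card X c : dual X c -> (#|X| <= #|V|)%N.
Proof. by move/dual_mx/mulmx1_min. Qed.

Lemma dual_delta X c : dual X c -> #|X| = #|V| ->
  forall v v', \sum_(w in X) c w v * g w v' = (v == v')%:R.
Proof.
move=> /dual_mx d e v v'; have := mulmx1C_rect e d.
move/matrixP/(_ (enum_rank v) (enum_rank v')); rewrite !mxE.
rewrite (inj_eq enum_rank_inj) => <-.
rewrite (big_enum_val (fun w => c w v * g w v')) /=; apply: eq_bigr => i _.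
by rewrite !mxE !enum_rankK.
Qed.

Lemma dual_expl X c : dual X c -> #|X| = #|V| ->
  forall y, y = fun v => \sum_(w in X) dotp y (c w) * g w v.
Proof.
move=> d e y; apply/funext => v'; rewrite /dotp.
under eq_bigr => w _ do rewrite mulr_suml.
rewrite exchange_big /=.
under eq_bigr => v _ do (under eq_bigr => w _ do rewrite -mulrA; rewrite -mulr_sumr (dual_delta d e)).
by rewrite (bigD1 v') //= eqxx mulr1 big1 ?addr0 // => v /negbTE ->; rewrite mulr0.
Qed.

Lemma dual_expr X c : dual X c -> #|X| = #|V| ->
  forall x, x = fun v => \sum_(w in X) dotp (g w) x * c w v.
Proof.
move=> d e x; apply/funext => v; rewrite /dotp.
under eq_bigr => w _ do rewrite mulr_suml.
rewrite exchange_big /=.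
under eq_bigr => v' _ do (under eq_bigr => w _ do rewrite mulrC mulrA; rewrite -mulr_suml (dual_delta d e)).
by rewrite (bigD1 v) //= eqxx mul1r big1 ?addr0 // => v'; rewrite eq_sym => /negbTE ->; rewrite mul0r.
Qed.

Hypothesis face_sub : forall X Y, face X -> Y \subset X -> face Y.
Hypothesis face_dual : forall X, face X -> exists c, dual X c.
Hypothesis nface_exists : exists X, face X /\ #|X| = #|V|.
Hypothesis flip : forall X w, face X -> #|X| = #|V| -> w \in X ->
  exists w', w' \notin X /\ face (w' |: X :\ w).
Hypothesis kap_supp : forall X, face X -> exists x,
  [/\ forall w, w \in X -> dotp (g w) x = kap w, forall w, dotp (g w) x <= kap w &
      forall w, ~~ face (w |: X) -> dotp (g w) x < kap w].

Definition nface X := face X && (#|X| == #|V|).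
Definition poly : set vec := [set x | forall w, dotp (g w) x <= kap w].

Lemma nface_not_face X w : nface X -> w \notin X -> ~~ face (w |: X).
Proof.
case/andP=> _ /eqP hX hw; apply/negP => /face_dual[c /dual_card].
by rewrite cardsU1 hw hX add1n ltnn.
Qed.

Lemma nface_uniq X x x' : nface X -> (forall w, w \in X -> dotp (g w) x = dotp (g w) x') -> x = x'.
Proof.
case/andP=> /face_dual[c d] /eqP e h; rewrite (dual_expr d e x) (dual_expr d e x').
by apply/funext => v; apply: eq_bigr => w hw; rewrite h.
Qed.

(** The implication stands under the existential so that choice gives a function [vert] defined on
    all sets. *)
Lemma vertex_exists X : exists x, nface X ->
  [/\ forall w, w \in X -> dotp (g w) x = kap w, poly x &
      forall w, w \notin X -> dotp (g w) x < kap w].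
Proof.
case: (boolP (nface X)) => [hX|_]; last by exists (fun=> 0).
have /andP[fX _] := hX; have [x [h1 h2 h3]] := kap_supp fX; exists x => _; split=> // w hw.
exact: h3 (nface_not_face hX hw).
Qed.

Definition vert X : vec := projT1 (cid (vertex_exists X)).

Lemma vertP X : nface X -> [/\ forall w, w \in X -> dotp (g w) (vert X) = kap w, poly (vert X) &
      forall w, w \notin X -> dotp (g w) (vert X) < kap w].
Proof. exact: (projT2 (cid (vertex_exists X))). Qed.

(* The simplex algorithm: at a vertex maximising [y], a negative coefficient
   of [y] would allow an improving flip. *)
Lemma complete y : exists X (l : T -> R),
  [/\ nface X, forall w, 0 <= l w & y = fun v => \sum_(w in X) l w * g w v].
Proof.
have [X0 [f0 c0]] := nface_exists.
have n0 : nface X0 by rewrite /nface f0 c0 eqxx.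
case: (arg_maxP (fun X => dotp y (vert X)) n0) => X nX Xmax.
have /andP[/face_dual[c d] /eqP e] := nX.
have hge w : w \in X -> 0 <= dotp y (c w).
  move=> wX; rewrite leNgt; apply/negP => neg.
  have [w' [w'X fX']] : exists w', w' \notin X /\ face (w' |: X :\ w).
    by apply: flip => //; case/andP: nX.
  have nX' : nface (w' |: X :\ w).
    rewrite /nface fX' cardsU1 !inE (negbTE w'X) andbF /= add1n.
    by have := cardsD1 w X; rewrite wX add1n e => <-.
  have ww' : w \notin w' |: X :\ w.
    by rewrite !inE eqxx /= orbF; apply: contra w'X => /eqP <-.
  have [p1 p2 p3] := vertP nX; have [q1 q2 q3] := vertP nX'.
  (* The two vertices lie on the common facets indexed by [X :\ w], so they differ by a multiple of
     [c w]; the factor is negative because [w] is not in the flipped face. *)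
  have hd : vert (w' |: X :\ w) = fun v => vert X v +
      (dotp (g w) (vert (w' |: X :\ w)) - kap w) * c w v.
    apply: (nface_uniq nX) => u uX; rewrite dotp_comb p1 // d //.
    case: (eqVneq u w) => [->|uw]; first by rewrite mulr1; ring.
    by rewrite mulr0 addr0 q1 // !inE uw uX orbT.
  have := Xmax _ nX'; rewrite /= {1}hd dotp_comb gerDl leNgt.
  by rewrite nmulr_rgt0 ?neg // subr_lt0 q3.
exists X, (fun w => if w \in X then dotp y (c w) else 0); split=> //.
  by move=> w; case: ifP => // /hge.
rewrite {1}(dual_expl d e y); apply/funext => v; apply: eq_bigr => w ->; by [].
Qed.

(** The sum [y] of the g-vectors of [F] lies in the cone of some [nface] [X], so [vert X] maximises
    [y] on the polytope. The supporting point of [F] attains the sum of [kap] over [F], which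
    [vert X] misses as soon as some element of [F] is outside [X]. *)
Lemma facet_nface F : face F -> (forall Y, face Y -> F \subset Y -> Y = F) -> nface F.
Proof.
move=> fF Fmax; pose y : vec := fun v => \sum_(w in F) 1 * g w v.
have [X [l [nX l0 hy]]] := complete y.
have [x [x1 x2 x3]] := kap_supp fF; have [p1 p2 p3] := vertP nX.
have FX : F \subset X.
  apply/fintype.subsetP => w0 w0F; apply/negPn/negP => w0X.
  have e1 : dotp y x = \sum_(w in F) kap w.
    by rewrite dotp_suml; apply: eq_bigr => w wF; rewrite mul1r x1.
  have e2 : dotp y x <= dotp y (vert X).
    rewrite hy !dotp_suml; apply: ler_sum => w wX; rewrite ler_wpM2l // p1 //.
  have e3 : dotp y (vert X) < \sum_(w in F) kap w.
    rewrite dotp_suml (bigD1 w0) //= [X in _ < X](bigD1 w0) //=.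
    rewrite mul1r ltr_leD ?p3 //; apply: ler_sum => w _; rewrite mul1r; exact: p2.
  by move: e2; rewrite e1 leNgt e3.
by rewrite -(Fmax X) //; case/andP: nX.
Qed.

Lemma face_in_nface F : face F -> exists X, nface X /\ F \subset X.
Proof.
move=> fF; have [X /maxsetP[fX mX] FX] := maxset_exists fF; exists X; split=> //.
by apply: facet_nface => // Y fY XY; apply: mX.
Qed.

(** A functional separating a point from the hull lies in the cone of an [nface], whose vertex
    maximises it on the whole polytope. *)
Lemma polyE : poly = conv_hull [set vert X | X in [set X | nface X]].
Proof.
apply/seteqP; split=> x.
  move=> hx; pose s := enum nface; pose X0 : {set T} := finset.set0.
  have ns i : (i < size s)%N -> nface (nth X0 s i).
    by move=> hi; have := mem_nth X0 hi; rewrite mem_enum.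
  have [[l [l0 l1 hl]]|[y hy]] := conv_or_separated (size s) (fun i => vert (nth X0 s i)) x.
    exists (size s), (fun i : 'I__ => vert (nth X0 s i)), (fun i : 'I__ => l i).
    by split=> //= i; exists (nth X0 s i) => //; apply: ns.
  have [X [l [nX l0 e]]] := complete y; have [p1 p2 p3] := vertP nX.
  have hX : (index X s < size s)%N by rewrite index_mem mem_enum.
  have := hy _ hX; rewrite nth_index ?mem_enum // e !dotp_suml ltNge.
  by case/negP; apply: ler_sum => w wX; rewrite ler_wpM2l // p1.
move=> [n [p [l [hp [l0 [l1 ->]]]]]] w; rewrite dotp_sumr.
apply: (@le_trans _ _ (\sum_i l i * kap w)); last by rewrite -mulr_suml l1 mul1r.
apply: ler_sum => i _; rewrite ler_wpM2l //; have [X nX <-] := hp i.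
by have [_ + _] := vertP nX; apply.
Qed.

Lemma coneP F y : cone [set g w | w in [set w | w \in F]] y <->
  exists l : T -> R, (forall w, 0 <= l w) /\ y = fun v => \sum_(w in F) l w * g w v.
Proof.
split=> [[n [p [l [hp [l0 ->]]]]]|[l [l0 ->]]].
  have hq i : exists w, w \in F /\ g w = p i by have [w wF <-] := hp i; exists w.
  have [f hf] := choice hq.
  exists (fun w => \sum_(i < n | f i == w) l i); split=> [w|]; first exact: sumr_ge0.
  apply/funext => v; rewrite (partition_big f (mem F)) /=; last by move=> i _; case: (hf i).
  apply: eq_bigr => w wF; rewrite mulr_suml; apply: eq_bigr => i /eqP <-.
  by have [_ ->] := hf i.
exists #|F|, (fun i => g (enum_val i)), (fun i => l (enum_val i)); split; last split=> //.
  by move=> i; exists (enum_val i) => //=; apply: enum_valP.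
by apply/funext => v; rewrite (big_enum_val (fun w => l w * g w v)).
Qed.

Lemma argmax_poly F (l : T -> R) : face F -> (forall w, w \in F -> 0 < l w) ->
  argmax poly (fun v => \sum_(w in F) l w * g w v) =
  [set x | poly x /\ forall w, w \in F -> dotp (g w) x = kap w].
Proof.
move=> fF l0; have [x0 [a1 a2 a3]] := kap_supp fF.
apply/seteqP; split=> x [px hx]; split=> //.
  move=> w0 w0F; apply/eqP; rewrite eq_le px /= leNgt; apply/negP => lt.
  have := hx x0 a2; rewrite !dotp_suml leNgt => /negP; apply.
  rewrite (bigD1 w0) //= [X in _ < X](bigD1 w0) //= ltr_leD //.
    by rewrite ltr_pM2l ?l0 // a1.
  apply: ler_sum => w /andP[wF _]; rewrite ler_wpM2l ?a1 //; exact: ltW (l0 _ wF).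
move=> z pz; rewrite !dotp_suml; apply: ler_sum => w wF.
by rewrite ler_wpM2l ?hx // ltW // l0.
Qed.

Lemma small_step (I : finType) (a b : I -> R) (P : pred I) : (forall i, P i -> a i < b i) ->
  forall c : I -> R, exists2 e : R, 0 < e & forall i, P i -> a i + e * c i <= b i.
Proof.
move=> h c; pose d i := if P i then (b i - a i) / (1 + `|c i|) else 1.
have d0 i : 0 < d i.
  rewrite /d; case: ifP => // Pi; rewrite divr_gt0 ?subr_gt0 ?h //.
  by rewrite ltr_pwDl.
exists (\big[Num.min/1]_i d i).
  by apply: (big_ind (fun e => 0 < e)) => // x y x0 y0; rewrite lt_min x0.
move=> i Pi; have le1 : \big[Num.min/1]_i d i <= d i by apply: bigmin_le_cond.
have pos : 0 < \big[Num.min/1]_i d i by apply: (big_ind (fun e => 0 < e)) => // x y x0 y0; rewrite lt_min x0.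
rewrite addrC -lerBrDr; apply: (@le_trans _ _ (d i * (1 + `|c i|))).
  apply: (@le_trans _ _ (\big[Num.min/1]_i0 d i0 * (1 + `|c i|))).
    rewrite ler_wpM2l ?(ltW pos) // (le_trans (ler_norm _)) // ler_wpDl //.
  by rewrite ler_wpM2r // addr_ge0.
by rewrite /d Pi divfK // gt_eqF // ltr_pwDl.
Qed.

Lemma ncone_poly F : face F ->
  ncone poly [set x | poly x /\ forall w, w \in F -> dotp (g w) x = kap w] =
  cone [set g w | w in [set w | w \in F]].
Proof.
move=> fF; apply/seteqP; split=> y hy; last first.
  have [l [l0 ->]] := (coneP F y).1 hy => x [px hx]; split=> // z pz.
  by rewrite !dotp_suml; apply: ler_sum => w wF; rewrite ler_wpM2l ?hx.
have [X [l [nX l0 e]]] := complete y; have [p1 p2 p3] := vertP nX.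
suff hF w : w \in X -> w \notin F -> l w = 0.
  apply/coneP; exists (fun w => if w \in X then l w else 0); split.
    by move=> w; case: ifP.
  rewrite e; apply/funext => v; rewrite big_mkcond [RHS]big_mkcond; apply: eq_bigr => w _.
  case: (boolP (w \in X)) => wX; case: (boolP (w \in F)) => wF //.
    by rewrite hF // mul0r.
  by rewrite mul0r.
move=> w0X w0F; apply/eqP; apply/negPn/negP => lw0.
have lpos : 0 < l w by rewrite lt_neqAle eq_sym lw0 l0.
(* The supporting point of [F] is a maximiser of [y], so it also lies on the facet of [w]; hence [w]
   is compatible with [F]. *)
have fG : face (w |: F).
  have [x [x1 x2 x3]] := kap_supp fF; apply/negPn/negP => /x3 hlt.
  have [_ /(_ _ p2)] := hy x (conj x2 x1); rewrite e !dotp_suml leNgt => /negP; apply.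
  rewrite (bigD1 w) //= [X in _ < X](bigD1 w) //= ltr_leD //.
    by rewrite ltr_pM2l ?p1.
  by apply: ler_sum => u /andP[uX _]; rewrite ler_wpM2l ?p1.
have [Y [nY GY]] := face_in_nface fG; have [q1 q2 q3] := vertP nY.
have /andP[/face_dual[c d] _] := nY.
have wY : w \in Y by apply: (fintype.subsetP GY); rewrite !inE eqxx.
have FY u : u \in F -> u \in Y by move=> uF; apply: (fintype.subsetP GY); rewrite !inE uF orbT.
have [eps eps0 heps] := @small_step T (fun u => dotp (g u) (vert Y)) kap
   (fun u => u \notin Y) q3 (fun u => - dotp (g u) (c w)).
(* A small step from a vertex along [- c w] stays in the polytope and on the facets of [F] but
   leaves that of [w], so [y], having a positive coefficient at [w], is not maximal there. *)
pose x v := vert Y v + (- eps) * c w v.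
have dx u : dotp (g u) x = dotp (g u) (vert Y) + eps * (- dotp (g u) (c w)).
  by rewrite dotp_comb mulNr mulrN.
have px : poly x.
  move=> u; rewrite dx; case: (boolP (u \in Y)) => uY; last exact: heps.
  by rewrite q1 // d // mulrN gerDl oppr_le0 mulr_ge0 // ltW.
have hx : forall u, u \in F -> dotp (g u) x = kap u.
  move=> u uF; have uY := FY _ uF; rewrite dx d // q1 //; case: eqP => [uw|]; last by rewrite oppr0 mulr0 addr0.
  by rewrite -uw uF in w0F.
have [_ /(_ _ p2)] := hy x (conj px hx); rewrite e !dotp_suml leNgt => /negP; apply.
rewrite (bigD1 w) //= [X in _ < X](bigD1 w) //= ltr_leD //.
  by rewrite ltr_pM2l // p1 // dx q1 // d // eqxx mulrN mulr1 gtrDl oppr_lt0.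
by apply: ler_sum => u /andP[uX _]; rewrite ler_wpM2l ?p1.
Qed.

Lemma normal_fan_poly : normal_fan poly =
  [set C | exists F, face F /\ C = cone [set g w | w in [set w | w \in F]]].
Proof.
apply/seteqP; split=> C.
  move=> [y ->]; have [X [l [nX l0 e]]] := complete y.
  (* Dropping the zero coefficients puts [y] in the relative interior of the cone of [F]. *)
  pose F : {set T} := finset (fun w => (w \in X) && (0 < l w)); have /andP[fX _] := nX.
  have fF : face F by apply: face_sub fX _; apply/fintype.subsetP => w; rewrite !inE => /andP[].
  exists F; split=> //; rewrite -(ncone_poly fF) -(argmax_poly (l := l) fF); last first.
    by move=> w; rewrite !inE => /andP[].
  congr (ncone _ (argmax _ _)); rewrite e; apply/funext => v.
  rewrite big_mkcond [RHS]big_mkcond; apply: eq_bigr => w _; rewrite !inE.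
  case: (boolP (w \in X)) => //= wX; case: ltP => //.
  by rewrite le_eqVlt ltNge l0 orbF => /eqP ->; rewrite mul0r.
move=> [F [fF ->]]; exists (fun v => \sum_(w in F) 1 * g w v).
by rewrite (argmax_poly (l := fun=> 1)) // ncone_poly.
Qed.

End Fan.

(** * Duality and supporting points *)

Section Faces.
Variables (R : realType) (Q B : bquiver) (iv : vtx Q -> vtx B) (ia : arr Q -> arr B).
Hypothesis hbl : blossoming Q B iv ia.
Variable l0 : letter B.
Notation inQ0 := (inQ0 iv).
Notation is_walk := (is_walk iv).
Notation L := (nth l0).
Notation gpair1 := (gpair1 l0).
Notation kissn := (kissn l0).
Notation nk := (nk l0).
Notation topl := (topl l0).
Notation gvec := (gvec R iv).
Notation maskvec := (maskvec R iv l0).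
Notation kmask := (kmask l0).
Notation cwalk := (cwalk iv).
Notation nsk := (nsk iv).
Implicit Types (u w : seq (letter B)) (i j k t p q : nat) (b : bool) (S : nat -> bool).
Implicit Types (X : set (seq (letter B))).

Definition bend w := [&& cwalk w, nsk w & ~~ straight w].

Definition nkset X := (forall w, X w -> bend w) /\ (forall w w', X w -> X w' -> ~~ kisses iv w w').

Lemma bend_walk w : bend w -> is_walk w.
Proof. by case/and3P=> /andP[]. Qed.

Lemma canon_winv w : Defs.canon w || Defs.canon (winv w).
Proof. by rewrite /Defs.canon winvK leq_total. Qed.

Lemma winv_canon_neq w w' : cwalk w -> cwalk w' -> winv w != w'.
Proof.
move=> /andP[hw c] /andP[hw' c']; apply/eqP => e; subst w'.
have e : w = winv w.
  apply: (pcan_inj pickleK); apply/eqP; rewrite eqn_leq; apply/andP; split; first exact: c.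
  by move: c'; rewrite /Defs.canon winvK.
by have := winv_neq l0 hw; rewrite -e eqxx.
Qed.

Lemma nkset_walk X u : nkset X -> sym X u -> is_walk u.
Proof.
case=> h _ [/h/bend_walk //|/h/bend_walk h']; rewrite -(winvK u); exact: (walk_winv hbl l0).
Qed.

Lemma nkset_nk X u w : nkset X -> sym X u -> sym X w -> nk u w.
Proof.
move=> [hb hk] hu hw.
have wu v : X v -> is_walk v by move=> /hb/bend_walk.
case: hu => hu; case: hw => hw;
  have [n1 n2 n3 n4] := kisses_nk hbl l0 (wu _ hu) (wu _ hw) (hk _ _ hu hw) (hk _ _ hw hu);
  move: n1 n2 n3 n4; rewrite ?winvK //.
Qed.

Lemma nkset_fam X : nkset X -> nkfam iv l0 (sym X).
Proof.
by move=> h; split; [move=> u; apply: nkset_walk | move=> u w; apply: nkset_nk].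
Qed.

Definition signr b : R := if b then 1 else -1.

Lemma signrK b : signr b * signr b = 1.
Proof. by rewrite /signr; case: b; rewrite ?mulr1 // mulrNN mulr1. Qed.

Definition gpair b S u w : int := gpair1 b S u w + gpair1 b S (winv u) w.

Lemma signr_dotp b u w S : is_walk u -> is_walk w -> valid S w ->
  signr b * dotp (gvec u) (maskvec w S) = (gpair b S u w)%:~R.
Proof.
move=> hu hw hS; rewrite (dotp_maskvec R hbl l0 hu hw hS) /gpair; case: b; rewrite /signr ?mul1r //.
by rewrite -[false]/(~~ true) !gpair1_neg mulN1r -opprD rmorphN.
Qed.

Lemma gpair_le0 b S u w X : nkset X -> sym X u -> sym X w -> bclosed l0 b S w -> gpair b S u w <= 0.
Proof.
move=> nX hu hw hS; have iu := sym_winv hu.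
rewrite /gpair -(addr0 0); apply: lerD;
by apply: (gpair1_bclosed_le0 hbl) => //; [apply: (nkset_walk nX)..|apply: (nkset_nk nX)].
Qed.

Lemma gpair_self b S w X : nkset X -> sym X w -> bclosed l0 b S w -> (exists j, S j) ->
  gpair b S w w <= -1.
Proof.
move=> nX hw hS exS; have iw := sym_winv hw.
rewrite /gpair -(addr0 (-1)); apply: lerD.
  by apply: (gpair1_bclosed_self hbl) => //; [apply: (nkset_walk nX)|apply: (nkset_nk nX)].
by apply: (gpair1_bclosed_le0 hbl) => //; [apply: (nkset_walk nX)..|apply: (nkset_nk nX)].
Qed.

Lemma gpair_itv_le0 b u w p q Fs : nk u w -> nk (winv u) w -> is_walk u -> is_walk w ->
  Fs u -> Fs (winv u) -> (q < size w)%N ->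
  (L w p).2 = b \/ topl Fs w p -> (L w q).2 = ~~ b \/ topl Fs w q ->
  ~ ((L w p).2 = ~~ b /\ (L w q).2 = b) -> gpair b (itv p q) u w <= 0.
Proof.
move=> n1 n2 hu hw f1 f2 hq h1 h2 h3; have hu' := walk_winv hbl l0 hu.
rewrite /gpair -(addr0 0); apply: lerD; exact: (gpair1_itv_le0 hbl _ _ _ _ hq h1 h2 h3).
Qed.

Lemma bend_dirs w b : bend w -> exists2 k, (k < size w)%N & (L w k).2 = b.
Proof.
move=> /and3P[_ _ hs]; apply: contrapT => hno; case/negP: hs.
have h k : (k < size w)%N -> (L w k).2 = ~~ b.
  move=> hk; case: (eqVneq (L w k).2 b) => e; first by case: hno; exists k.
  by move: e; case: (_.2); case: (b).
rewrite /straight; case: b h {hno} => h; [apply/orP; right|apply/orP; left];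
  apply/(all_nthP l0) => k hk; by rewrite h.
Qed.

(** A bending walk has letters of both directions, and each direction provides a distinguished
    letter. *)
Lemma two_tops X w : nkset X -> X w -> exists b k1 k2,
  [/\ (k1 < k2)%N /\ (k2 < size w)%N, (L w k1).2 = ~~ b /\ (L w k2).2 = b,
      topl (sym X) w k1 & topl (sym X) w k2].
Proof.
move=> nX hw; have bw := nX.1 _ hw.
have [k hk ek] := bend_dirs true bw; have [k' hk' ek'] := bend_dirs false bw.
have hs : sym X w by left.
have [p [p1 p2 p3]] := topl_exists hbl (nkset_fam nX) hs hk ek.
have [q [q1 q2 q3]] := topl_exists hbl (nkset_fam nX) hs hk' ek'.
case: (ltngtP p q) => h.
- by exists false, p, q.
- by exists true, q, p.
- by move: p2; rewrite h q2.
Qed.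

Lemma dual_tops X w b k1 k2 u : nkset X -> X w -> X u ->
  (k1 < k2)%N -> (k2 < size w)%N -> (L w k1).2 = ~~ b -> (L w k2).2 = b ->
  topl (sym X) w k1 -> topl (sym X) w k2 ->
  signr b * dotp (gvec u) (maskvec w (itv k1 k2)) = (u == w)%:R.
Proof.
move=> nX hw hu k12 hk2 e1 e2 t1 t2.
have su : sym X u by left. have sw : sym X w by left. have iu := sym_winv su.
rewrite signr_dotp; [|exact: (nkset_walk nX)..|exact: valid_itv].
rewrite /gpair !(gpair1_dual hbl (Fs := sym X) (b := b)) //;
  [|by apply: (nkset_walk nX)|by apply: (nkset_walk nX)|by apply: (nkset_nk nX)|
    by apply: (nkset_walk nX)|by apply: (nkset_walk nX)|by apply: (nkset_nk nX)].
rewrite (negbTE (winv_canon_neq _ _)) ?addr0 //.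
- by have /and3P[] := nX.1 _ hu.
- by have /and3P[] := nX.1 _ hw.
Qed.

(** The sign rule for intervals applies with [b] and with [~~ b], and the two pairings are
    opposite. *)
Lemma same_tops X w b k1 k2 u : nkset X -> X w -> X u ->
  (k1 < k2)%N -> (k2 < size w)%N -> (L w k1).2 = b -> (L w k2).2 = b ->
  topl (sym X) w k1 -> topl (sym X) w k2 -> dotp (gvec u) (maskvec w (itv k1 k2)) = 0.
Proof.
move=> nX hw hu k12 hk2 e1 e2 t1 t2.
have su : sym X u by left. have sw : sym X w by left. have iu := sym_winv su.
have wu := nkset_walk nX su; have ww := nkset_walk nX sw.
have n1 := nkset_nk nX su sw; have n2 := nkset_nk nX iu sw.
have h b' : b' = b \/ b' = ~~ b -> gpair b' (itv k1 k2) u w <= 0.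
  by case=> ->; apply: (gpair_itv_le0 n1 n2 wu ww su iu hk2); rewrite ?e1 ?e2 ?negbK; auto;
    case: (b); case.
have h1 := h b (or_introl erefl); have h2 := h (~~ b) (or_intror erefl).
have e : gpair b (itv k1 k2) u w = 0.
  by apply/eqP; rewrite eq_le h1 /= -oppr_le0 /gpair opprD -!gpair1_neg.
have := signr_dotp b wu ww (@valid_itv _ k1 k2 w hk2); rewrite e.
by move/(congr1 (fun x => signr b * x)); rewrite mulrA signrK mul1r mulr0.
Qed.

Definition spanning X := forall x : vtx Q -> R, (forall u, X u -> dotp (gvec u) x = 0) -> x = (fun=> 0).

Lemma maskvec_neq0 w p q : is_walk w -> (p < q)%N -> (q < size w)%N ->
  exists v, 0 < maskvec w (itv p q) v.
Proof.
move=> hw pq hq; have hp : (p < size w)%N by nlia.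
have /codomP[v e] : ltgt (L w p) \in codom iv.
  by have := walk_tgt hbl l0 hw hp; rewrite /Defs.inQ0 => ->; nlia.
by exists v; rewrite /maskvec ltr0n (bigD1 (Ordinal hp)) //= /itv leqnn pq e eqxx.
Qed.

Lemma maskvec_ge0 w S v : 0 <= maskvec w S v.
Proof. by rewrite /maskvec ler0n. Qed.

Lemma cvecE X w : nkset X -> X w -> spanning X -> exists b k1 k2,
  [/\ (k1 < k2)%N /\ (k2 < size w)%N, (L w k1).2 = ~~ b /\ (L w k2).2 = b,
      topl (sym X) w k1, topl (sym X) w k2 &
      cvec R iv X w = fun v => signr b * maskvec w (itv k1 k2) v].
Proof.
move=> nX hw hsp; have [b [k1 [k2 [[k12 hk2] [e1 e2] t1 t2]]]] := two_tops nX hw.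
exists b, k1, k2; split=> //.
have ww : is_walk w by apply: bend_walk; apply: nX.1.
have hk1 : (k1 < size w)%N by nlia.
(* Two distinguished letters of the same direction would enclose a nonzero string orthogonal to a
   spanning family. *)
have uniqt k k' : (k < size w)%N -> (k' < size w)%N -> topl (sym X) w k -> topl (sym X) w k' ->
    (L w k).2 = (L w k').2 -> k = k'.
  wlog: k k' / (k < k')%N => [hwl hk hk' tk tk' e|lt hk hk' tk tk' e].
    by case: (ltngtP k k') => // h; [|apply/esym]; apply: hwl.
  have h0 : maskvec w (itv k k') = (fun=> 0).
    by apply: hsp => u hu; apply: (same_tops nX hw hu lt hk' e erefl tk tk').
  by have [v] := maskvec_neq0 ww lt hk'; rewrite h0 ltxx.
have hd : dpos iv X w = [:: k1; k2].
  apply: (irr_sorted_eq ltn_trans ltnn).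
  - by apply: sorted_filter; [exact: ltn_trans|exact: iota_ltn_sorted].
  - by rewrite /= andbT.
  move=> k; rewrite mem_filter mem_iota add0n !inE /=.
  case: (ltnP k (size w)) => hk; last first.
    rewrite andbF; apply/esym/negbTE; rewrite negb_or; apply/andP; split; apply/eqP; nlia.
  rewrite andbT; have hX u : X u -> is_walk u by move=> /nX.1/bend_walk.
  apply/asboolP/orP => [|h].
    move/(dist_pos_topl hbl l0 hX hw hk) => tk.
    case: (eqVneq (L w k).2 b) => e; [right|left]; apply/eqP; apply: uniqt => //.
      by rewrite e.
    by rewrite e1; move: e; case: (_.2); case: (b).
  by apply/(dist_pos_topl hbl l0 hX hw hk); case: h => /eqP ->.
apply/funext => v; rewrite /cvec hd /= (topoccE hbl l0) // (botoccE hbl l0) //.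
rewrite /occ k12 hk2 e1 e2 /=; case: (b) => /=; rewrite (mvec_sub R iv l0) // /signr ?mul1r //.
by rewrite mulN1r.
Qed.

(** * A point supporting a given face *)

Section Support.
Variable sT : seq (seq (letter B)).
Hypothesis uT : uniq sT.
Hypothesis hT : forall w, (w \in sT) = bend w.

Lemma straight_noKN w w' : is_walk w -> is_walk w' -> straight w' -> KN iv w w' = 0%N.
Proof.
move=> hw hw' hs; have [k1 k2] := kiss_countE hbl l0 hw hw'; rewrite /KN k1 k2.
have dirs p q b : occ l0 b w' p q = false.
  apply/negP => /and4P[pq hq /eqP e1 /eqP e2]; have hp : (p < size w')%N by nlia.
  case/orP: hs => /(all_nthP l0) h; have := h _ hq; have := h _ hp; rewrite e1 e2; case: (b) => //.
by rewrite /kisscnt; rewrite !big1 // => p _; rewrite big1 // => q _; rewrite big1 // => p' _;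
  rewrite big1 // => q' _; rewrite dirs andbF.
Qed.

Lemma kappaE w : is_walk w -> kappa R iv w = \sum_(w' <- sT) (KN iv w w')%:R.
Proof.
move=> hw; rewrite /kappa [RHS]fsbig_seq //; apply/esym; apply: fsbig_widen.
- by move=> u /=; rewrite hT => /and3P[-> ->].
- move=> u /= [/andP[cu nu] hu]; rewrite straight_noKN //; first by case/andP: cu.
  by apply/negPn/negP => hs; apply: hu; rewrite /= hT /bend cu nu.
Qed.

Lemma KN_kisscnt w w' : is_walk w -> is_walk w' ->
  KN iv w w' = (kisscnt l0 true w w' + kisscnt l0 false w w')%N.
Proof. by move=> hw hw'; rewrite /KN; have [-> ->] := kiss_countE hbl l0 hw hw'. Qed.

Lemma gpair_le_kisscnt b S u w : is_walk u -> is_walk w -> bclosed l0 b S w ->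
  gpair b S u w <= Posz (kisscnt l0 b u w).
Proof.
move=> hu hw hS; rewrite (kisscntE hbl) //; apply: lerD; apply: (gpair1_le_kissn hbl) => //.
exact: (walk_winv hbl l0).
Qed.

Lemma gpair_kmask b X u w : nkset X -> X u -> is_walk w ->
  gpair b (kmask b (sym X) w) u w = Posz (kisscnt l0 b u w).
Proof.
move=> nX hu hw; have su : sym X u by left.
rewrite (kisscntE hbl) //; last exact: (nkset_walk nX).
rewrite /gpair !(gpair1_kmask hbl) //; try exact: sym_winv.
- by move=> v; apply: nkset_walk.
- by move=> v v'; apply: nkset_nk.
- by move=> v; apply: nkset_walk.
- by move=> v v'; apply: nkset_nk.
Qed.

(** Bottom substrings kissed by [X] count positively and top substrings kissing [X] negatively;
    pairing with the g-vector of a walk of [X] then counts its kisses of both kinds, that is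
    [kappa]. *)
Definition suppv X (v : vtx Q) : R :=
  \sum_(w <- sT) (maskvec w (kmask true (sym X) w) v - maskvec w (kmask false (sym X) w) v).

Lemma dotp_suppv X u : is_walk u -> dotp (gvec u) (suppv X) =
  \sum_(w <- sT) (gpair true (kmask true (sym X) w) u w + gpair false (kmask false (sym X) w) u w)%:~R.
Proof.
move=> hu; rewrite /dotp /suppv; under eq_bigr => v _ do rewrite mulr_sumr.
rewrite exchange_big big_seq [RHS]big_seq; apply: eq_bigr => w; rewrite hT => /bend_walk hw.
have hv b : valid (kmask b (sym X) w) w by have [] := kmask_bclosed l0 b (sym X) w.
rewrite rmorphD /= -!signr_dotp // /signr mul1r mulN1r -sumrB.
by apply: eq_bigr => v _; rewrite mulrBr.
Qed.

Lemma suppv_le X u : is_walk u -> dotp (gvec u) (suppv X) <= kappa R iv u.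
Proof.
move=> hu; rewrite dotp_suppv // kappaE // big_seq [leRHS]big_seq.
apply: ler_sum => w; rewrite hT => /bend_walk hw; rewrite KN_kisscnt // pmulrn ler_int PoszD.
by apply: lerD; apply: gpair_le_kisscnt => //; apply: kmask_bclosed.
Qed.

Lemma suppv_eq X u : nkset X -> X u -> dotp (gvec u) (suppv X) = kappa R iv u.
Proof.
move=> nX hu; have su : sym X u by left. have wu := nkset_walk nX su.
rewrite dotp_suppv // kappaE // big_seq [RHS]big_seq.
apply: eq_bigr => w; rewrite hT => /bend_walk hw.
by rewrite KN_kisscnt // !gpair_kmask // pmulrn PoszD.
Qed.

(** The strict loss is in the summand of [u] itself: a kiss between [X] and [u] makes a mask of [u]
    nonempty, and a non-self-kissing walk pairs negatively with its own closed mask. *)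
Lemma suppv_lt X u : nkset X -> bend u -> ~ nkset (X `|` [set u])%classic ->
  dotp (gvec u) (suppv X) < kappa R iv u.
Proof.
move=> nX bu hno; have wu := bend_walk bu.
have nu : nkset [set u]%classic.
  by split=> [w ->|w w' -> ->] //; have /and3P[_ + _] := bu.
have su : sym [set u]%classic u by left.
have [v hv hk] : exists2 v, X v & kisses iv v u \/ kisses iv u v.
  apply: contrapT => hn; apply: hno; split.
    by move=> w [|->] //; apply: nX.1.
  move=> w w' [hw|->] [hw'|->].
  - exact: nX.2.
  - by apply/negP => h; apply: hn; exists w; auto.
  - by apply/negP => h; apply: hn; exists w'; auto.
  - by have /and3P[_ + _] := bu.
have wv : is_walk v by apply: bend_walk; apply: nX.1.
have [b [j hj]] : exists b j, kmask b (sym X) u j.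
  have [k1 k2] := kiss_countE hbl l0 wv wu.
  have [b hb] : exists b, (0 < kisscnt l0 b v u)%N.
    by case: hk; rewrite /kisses ?k1 ?k2 => h; [exists true|exists false].
  have : 0 < kissn b v u + kissn b (winv v) u by rewrite -(kisscntE hbl).
  have [x [hx hxK]] : exists x, sym X x /\ (0 < kissn b v u + kissn b (winv v) u -> kissn b x u <> 0).
    case: (eqVneq (kissn b v u) 0) => [->|ne]; last by exists v; split; [left|move=> _; apply/eqP].
    exists (winv v); split; first by right; rewrite winvK.
    by rewrite add0r => /gt_eqF/eqP.
  move/hxK => h; apply: contrapT => hn; apply: h; apply/kissn_eq0 => i j t; apply/negP => hp.
  apply: hn; exists b, j; apply/asboolP; exists x, i, j, t; split=> //; nlia.
rewrite dotp_suppv // kappaE //.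
have uT' : u \in sT by rewrite hT.
have hle w : w \in sT -> ((gpair true (kmask true (sym X) w) u w + gpair false (kmask false (sym X) w) u w)%:~R : R)
    <= (KN iv u w)%:R.
  rewrite hT => /bend_walk hw; rewrite KN_kisscnt // pmulrn ler_int PoszD.
  by apply: lerD; apply: gpair_le_kisscnt => //; apply: kmask_bclosed.
rewrite (bigD1_seq u) //= [ltRHS](bigD1_seq u) //=; apply: ltr_leD; last first.
  rewrite big_seq_cond [leRHS]big_seq_cond.
  by apply: ler_sum => w /andP[hw _]; apply: hle.
apply: (@lt_le_trans _ _ 0); last by rewrite ler0n.
rewrite ltrz0.
have hs b' : gpair b' (kmask b' (sym X) u) u u <= 0.
  by apply: (gpair_le0 nu) => //; apply: kmask_bclosed.
have hb : gpair b (kmask b (sym X) u) u u <= -1.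
  by apply: (gpair_self nu) => //; [apply: kmask_bclosed|exists j].
by case: b hb {hj} => hb; have := hs true; have := hs false; lia.
Qed.

End Support.
End Faces.

(** * Stable walks *)

(* Binary value of a bit sequence, so that lexicographic comparison becomes
   comparison of numbers. *)
Fixpoint bval (M : nat) (f : nat -> bool) : nat :=
  if M is M'.+1 then (f 0 * 2 ^ M' + bval M' (fun s => f s.+1))%N else 0%N.

Lemma bval_lt M f : (bval M f < 2 ^ M)%N.
Proof.
elim: M f => [|M IH] f //=; rewrite expnS mul2n -addnn.
have := IH (fun s => f s.+1); case: (f 0%N); rewrite ?mul1n ?mul0n ?ltn_add2l //.
by move=> h; rewrite ?add0n ltn_addr.
Qed.

Lemma bval_lex M (f h : nat -> bool) t : (t < M)%N -> (forall s, (s < t)%N -> f s = h s) -> f t -> ~~ h t ->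
  (bval M h < bval M f)%N.
Proof.
elim: M f h t => [|M IH] f h [|t] //= ht e ft ht'.
  rewrite ft (negbTE ht') mul0n mul1n add0n; apply: (leq_trans (bval_lt _ _)); exact: leq_addr.
rewrite (e 0%N) // ltn_add2l; apply: (IH _ _ t) => // s hs; exact: e.
Qed.

Lemma eq_bval M (f h : nat -> bool) : (forall s, f s = h s) -> bval M f = bval M h.
Proof. by elim: M f h => [|M IH] f h //= e; rewrite e (IH _ (fun s => h s.+1)). Qed.

Section Stable.
Variables (Q B : bquiver) (iv : vtx Q -> vtx B) (ia : arr Q -> arr B).
Hypothesis hbl : blossoming Q B iv ia.
Variable l0 : letter B.
Notation is_walk := (is_walk iv).
Notation L := (nth l0).
Notation gpair1 := (gpair1 l0).
Notation nk := (nk l0).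
Notation topl := (topl l0).
Notation gturn := (gturn l0).
Notation gpair := (gpair l0).
Notation occ := (occ l0).
Notation sepR := (sepR l0).
Notation sepL := (sepL l0).
Notation nkset := (nkset iv).
Implicit Types (u w : seq (letter B)) (i j k t p q : nat) (b : bool) (S : nat -> bool).
Implicit Types (y : vtx B -> int) (X : set (seq (letter B))).

Definition signz b : int := if b then 1 else -1.

Lemma signz_neg b : signz (~~ b) = - signz b.
Proof. by case: b. Qed.

Definition Ysum y w p q : int := \sum_(p <= j < q) y (ltgt (L w j)).

Lemma Ysum_ord y w p q : Ysum y w p q = \sum_(j < q - p) y (ltgt (L w (p + j))).
Proof.
rewrite /Ysum -{1}(add0n p) big_addn big_mkord; apply: eq_bigr => j _.
by rewrite addnC.
Qed.

Lemma Ysum_cat y w p q r : (p <= q)%N -> (q <= r)%N ->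
  Ysum y w p q + Ysum y w q r = Ysum y w p r.
Proof. by move=> h1 h2; rewrite /Ysum (big_cat_nat h1 h2). Qed.

Lemma Ysum_winv y w p q : is_walk w -> (p <= q)%N -> (q < size w)%N ->
  Ysum y (winv w) (size w - q.+1) (size w - p.+1) = Ysum y w p q.
Proof.
move=> hw pq hq; rewrite !Ysum_ord.
have -> : (size w - p.+1 - (size w - q.+1) = q - p)%N by nlia.
rewrite (reindex_inj rev_ord_inj); apply: eq_bigr => j _ /=; have hj := ltn_ord j.
rewrite nth_winv ?ltgt_linv; last by nlia.
have -> : (size w - (size w - q.+1 + (q - p - j.+1)).+1 = (p + j).+1)%N by nlia.
by rewrite (adm2_vtx (walk_adm l0 hw (i := p + j) _)) //; nlia.
Qed.

(* A kiss would pair with [y] both positively and negatively, so stable walks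
   do not kiss. *)
Definition stable y w := forall b p q, occ b w p q -> 0 < signz b * Ysum y w p q.

Lemma stable_winv y w : is_walk w -> stable y w -> stable y (winv w).
Proof.
move=> hw hs b p q h; have := h => /and4P[pq]; rewrite size_winv => hq _ _.
have := hs b (size w - q.+1)%N (size w - p.+1)%N.
rewrite -(occ_winv l0 (w := w)); [|nlia..].
rewrite -Ysum_winv //; [|nlia..].
have -> : (size w - (size w - p.+1).+1 = p)%N by nlia.
have -> : (size w - (size w - q.+1).+1 = q)%N by nlia.
exact.
Qed.

Lemma stable_nk y u w : is_walk u -> is_walk w -> stable y u -> stable y w -> nk u w.
Proof.
move=> hu hw su sw b i j t; apply/negP => /kpatP[[h1 h2] h3 [h4 h5] [h6 h7] h8].
have := su b i (i + t).+1; have := sw (~~ b) j (j + t).+1.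
rewrite /occ h1 h2 h4 h5 h6 h7 negbK !eqxx !ltnS !leq_addr => /(_ isT) + /(_ isT).
have -> : Ysum y u i (i + t).+1 = Ysum y w j (j + t).+1.
  rewrite !Ysum_ord; have -> : ((i + t).+1 - i = (j + t).+1 - j)%N by nlia.
  apply: eq_bigr => -[s hs] _ /=; case: s hs => [|s] hs.
    rewrite !addn0 (adm2_vtx h3) -(adm2_vtx (walk_adm l0 hw (i := j) _)) //; nlia.
  by rewrite !addnS h8 //; nlia.
by rewrite signz_neg mulNr oppr_gt0 => h h'; have := lt_trans h h'; rewrite ltxx.
Qed.

(** [H] is a potential: its drop between the two letters around a substring is twice the signed sum
    of [y] over it. The factor 2 allows potentials with odd values, for which weak inequalities
    become strict. *)
Lemma pot_stable y w b (H : nat -> int) :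
  (forall k, (k.+1 < size w)%N -> H k.+1 = H k - 2 * (signz b * y (ltgt (L w k)))) ->
  (forall k, (k < size w)%N -> (L w k).2 = b -> H k < 0) ->
  (forall k, (k < size w)%N -> (L w k).2 = ~~ b -> 0 < H k) -> stable y w.
Proof.
move=> hH hb hnb.
have hS p d : (p + d < size w)%N -> H (p + d)%N = H p - 2 * (signz b * Ysum y w p (p + d)).
  elim: d => [|d IH] h; first by rewrite addn0 /Ysum big_geq // !mulr0 subr0.
  rewrite addnS hH; last by rewrite -addnS.
  rewrite IH; last by nlia.
  rewrite -(@Ysum_cat y w p (p + d) (p + d).+1) ?leq_addr ?leqnSn //.
  by rewrite [Ysum y w (p + d) _]/Ysum big_nat1; ring.
move=> b' p q /and4P[pq hq /eqP e1 /eqP e2]; have hp : (p < size w)%N by nlia.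
have := hS p (q - p)%N; rewrite (subnKC (ltnW pq)) => /(_ hq) e.
case: (eqVneq b' b) => [bb|bb].
  rewrite bb in e1 e2 *; have := hnb _ hp e1; have := hb _ hq e2; lia.
have bb' : b' = ~~ b by move: bb; case: (b'); case: (b).
rewrite bb' in e1 e2 *; rewrite negbK in e1.
have := hb _ hp e1; have := hnb _ hq e2; rewrite signz_neg; lia.
Qed.

Lemma gpair_signz b S u w : gpair b S u w = signz b * gpair true S u w.
Proof.
case: b; rewrite /signz ?mul1r // /gpair -[false]/(~~ true) !gpair1_neg mulN1r opprD //.
Qed.

Lemma gpair_Ysum b u w p q : is_walk u -> is_walk w -> (p <= q)%N -> (q < size w)%N ->
  gpair b (itv p q) u w = signz b * Ysum (gturn u) w p q.
Proof.
move=> hu hw pq hq; rewrite gpair_signz; congr (_ * _).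
rewrite /gpair (gpair1_gturn hbl) //; last exact: valid_itv.
rewrite -(big_mkord xpredT (fun j => if itv p q j then gturn u (ltgt (L w j)) else 0)).
rewrite (@big_cat_nat _ _ _ p 0 (size w)) //=; last by nlia.
rewrite (@big_cat_nat _ _ _ q p (size w)) //=; last by nlia.
rewrite [X in X + _]big_nat [X in X + _]big1 ?add0r; last first.
  by move=> j hj; rewrite ifF // /itv; apply/negbTE; nlia.
rewrite [X in _ + X]big_nat [X in _ + X]big1 ?addr0; last first.
  by move=> j hj; rewrite ifF // /itv; apply/negbTE; nlia.
by rewrite /Ysum [LHS]big_nat [RHS]big_nat; apply: eq_bigr => j hj; rewrite /itv hj.
Qed.

Lemma gpair1_bound b S u w : `|gpair1 b S u w| <= Posz (size u * size w).
Proof.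
have h : forall (i : 'I_(size u)) (j : 'I_(size w)),
  `|if S j && compat l0 u w i j then isdir b (L u i.+1) - isdir b (L u i) else 0 : int| <= 1.
  by move=> i j; case: ifP => // _; rewrite /isdir; case: (_ == b); case: (_ == b).
rewrite /gpair1; apply: (le_trans (ler_norm_sum _ _ _)).
apply: (@le_trans _ _ (\sum_(i < size u) \sum_(j < size w) 1)).
  apply: ler_sum => i _; apply: (le_trans (ler_norm_sum _ _ _)); exact: ler_sum.
by rewrite !sumr_const !card_ord -mulrnA mulnC natz.
Qed.

Lemma gpair_bound b S u w : `|gpair b S u w| <= Posz (2 * size u * size w).
Proof.
apply: (le_trans (ler_normD _ _)).
have := gpair1_bound b S u w; have := gpair1_bound b S (winv u) w; rewrite size_winv; nia.
Qed.

(** A numerical rank among the words through a letter: on either side, letters of direction other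
    than [b] are binary digits 1, read outwards from the mark, and positions past the end are 0.
    Passing above raises the value on one side and, without kisses, does not lower it on the
    other. *)
Definition markval M b u i : nat :=
  (bval M (fun s => (i + s < size u) && ((L u (i + s)).2 != b)) +
   bval M (fun s => (s <= i) && ((L u (i - s)).2 != b)))%N.

Lemma sep_markval M b u i w k t : is_walk u -> is_walk w -> nk u w ->
  (size u < M)%N -> (size w < M)%N -> (i < size u)%N -> (k < size w)%N -> L u i = L w k ->
  sepR b u i w k t \/ sepL b u i w k t -> (markval M b w k < markval M b u i)%N.
Proof.
move=> hu hw hn Mu Mw hi hk e hs.
have R1 t' : sepR b u i w k t' -> (bval M (fun s => (k + s < size w) && ((L w (k + s)).2 != b)) <
    bval M (fun s => (i + s < size u) && ((L u (i + s)).2 != b)))%N.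
  move=> [h1 h2 h3 h4 h5]; apply: (@bval_lex _ _ _ t'); first by nlia.
  - move=> s st; rewrite h3 //; congr andb.
    have -> : (i + s < size u)%N by nlia.
    by have -> : (k + s < size w)%N by nlia.
  - by rewrite h1 h4; case: (b).
  - by rewrite h2 h5 eqxx.
have L1 t' : sepL b u i w k t' -> (bval M (fun s => (s <= k) && ((L w (k - s)).2 != b)) <
    bval M (fun s => (s <= i) && ((L u (i - s)).2 != b)))%N.
  move=> [h1 h2 h3 h4 h5]; apply: (@bval_lex _ _ _ t'); first by nlia.
  - move=> s st; rewrite h3 //; congr andb.
    have -> : (s <= i)%N by nlia.
    by have -> : (s <= k)%N by nlia.
  - by rewrite h1 h4; case: (b).
  - by rewrite h2 h5 eqxx.
case: hs => hs; rewrite /markval.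
  rewrite -addSn; apply: leq_add; first exact: (R1 t).
  case: (left_dich hbl hu hw hi hk e) => [[t' [d1 d2 d3 d4 d5]]|[d1 d2]]; last first.
    rewrite leq_eqVlt; apply/orP; left; apply/eqP/eq_bval => s; rewrite d1.
    by case: (leqP s k) => // hsk; rewrite -{2}d1 d2 // d1.
  apply: ltnW; apply: (L1 t').
  have [e1 e2] : (L u (i - t')).2 = ~~ b /\ (L w (k - t')).2 = b; last by split.
  case: (eqVneq (L w (k - t')).2 b) => d6.
    by rewrite d6; split=> //; move: d5; rewrite d6; case: (_.2); case: (b).
  have d6' : (L w (k - t')).2 = ~~ b by move: d6; case: (_.2); case: (b).
  have d7 : (L u (i - t')).2 = b by move: d5; rewrite d6'; case: (_.2); case: (b).
  have hL : sepL (~~ b) u i w k t' by split; rewrite ?negbK.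
  have := sep_kpat hu hw hi hk e hL; rewrite negbK => /(_ _ hs).
  by rewrite (negbTE (hn _ _ _ _)).
rewrite -addnS; apply: leq_add; last exact: (L1 t).
case: (right_dich hbl hu hw hi hk e) => [[t' [d1 d2 d3 d4 d5]]|[d1 d2]]; last first.
  rewrite leq_eqVlt; apply/orP; left; apply/eqP/eq_bval => s.
  have -> : (k + s < size w)%N = (i + s < size u)%N by nlia.
  by case: (ltnP (i + s) (size u)) => // hsk; rewrite d2.
apply: ltnW; apply: (R1 t').
have [e1 e2] : (L u (i + t')).2 = ~~ b /\ (L w (k + t')).2 = b; last by split.
case: (eqVneq (L w (k + t')).2 b) => d6.
  by rewrite d6; split=> //; move: d5; rewrite d6; case: (_.2); case: (b).
have d6' : (L w (k + t')).2 = ~~ b by move: d6; case: (_.2); case: (b).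
have d7 : (L u (i + t')).2 = b by move: d5; rewrite d6'; case: (_.2); case: (b).
have hR : sepR (~~ b) u i w k t' by split; rewrite ?negbK.
by have := sep_kpat hu hw hi hk e hs hR; rewrite (negbTE (hn _ _ _ _)).
Qed.

(** A word of maximal [markval] through [x] cannot be surpassed at this letter. *)
Lemma top_mark (F : seq (seq (letter B))) (x : letter B) : nkset [set` F]%classic ->
  (exists u i, [/\ sym [set` F]%classic u, (i < size u)%N & L u i = x]) ->
  exists u i, [/\ sym [set` F]%classic u, (i < size u)%N, L u i = x & topl (sym [set` F]%classic) u i].
Proof.
move=> nF ex; pose M := (\sum_(u <- F) size u).+1.
have szM u : sym [set` F]%classic u -> (size u < M)%N.
  have hF v : v \in F -> (size v < M)%N.
    by move=> hv; rewrite /M ltnS (big_rem v hv) leq_addr.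
  by case=> /= /hF //; rewrite size_winv.
pose P n := `[< exists u i, [/\ sym [set` F]%classic u, (i < size u)%N, L u i = x &
   markval M x.2 u i = n] >].
have exP : exists n, P n.
  by have [u [i [h1 h2 h3]]] := ex; exists (markval M x.2 u i); apply/asboolP; exists u, i.
have bP n : P n -> (n <= 2 ^ M + 2 ^ M)%N.
  by move=> /asboolP[u [i [_ _ _ <-]]]; rewrite leq_add // ltnW // bval_lt.
case: (ex_maxnP exP bP) => n /asboolP[w [k [h1 h2 h3 h4]]] nmax.
exists w, k; split=> // u i Fu hi e t; rewrite h3.
suff hno : ~ (sepR x.2 u i w k t \/ sepL x.2 u i w k t).
  by split=> h; apply: hno; [left|right].
move=> hs; have := sep_markval (nkset_walk hbl l0 nF Fu) (nkset_walk hbl l0 nF h1)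
  (nkset_nk hbl l0 nF Fu h1) (szM _ Fu) (szM _ h1) hi h2 e hs.
rewrite h4 ltnNge => /negP; apply; apply: nmax; apply/asboolP; exists u, i; split=> //.
by rewrite e.
Qed.

End Stable.

(** * Straight walks and the peak facet *)

Section Straight.
Local Open Scope nat_scope.
Variables (Q B : bquiver) (iv : vtx Q -> vtx B) (ia : arr Q -> arr B).
Hypothesis hbl : blossoming Q B iv ia.
Hypothesis hadm : admissible Q.
Variable l0 : letter B.
Notation inQ0 := (inQ0 iv).
Notation is_walk := (is_walk iv).
Notation L := (nth l0).
Notation nkset := (nkset iv).
Notation bend := (bend iv).
Implicit Types (u w s A C : seq (letter B)) (i j k p q : nat) (b : bool).

Definition admw w := forall i, i.+1 < size w -> adm2 (L w i) (L w i.+1).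

Lemma admwP w : reflect (admw w) (sorted (@adm2 B) w).
Proof. exact: sortedP. Qed.

Lemma admw_cat A C : admw A -> admw C ->
  (0 < size A -> 0 < size C -> adm2 (L A (size A).-1) (L C 0)) -> admw (A ++ C).
Proof.
move=> hA hC hj i; rewrite size_cat !nth_cat => hi.
case: (ltnP i.+1 (size A)) => h1.
  by rewrite ltnW //; apply: hA.
case: (ltnP i (size A)) => h2.
  have -> : i.+1 - size A = 0 by nlia.
  have -> : i = (size A).-1 by nlia.
  by apply: hj; nlia.
rewrite subSn //; apply: hC; nlia.
Qed.

Lemma admw_winv w : admw w -> admw (winv w).
Proof.
move=> hw i; rewrite size_winv => hi; rewrite !nth_winv; [|nlia..].
rewrite adm2_linv; have -> : size w - i.+1 = (size w - i.+2).+1 by nlia.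
by apply: hw; nlia.
Qed.

Lemma admw_walk w : admw w -> 0 < size w -> ~~ inQ0 (lsrc (L w 0)) ->
  ~~ inQ0 (ltgt (L w (size w).-1)) -> is_walk w.
Proof. by move=> *; apply/(is_walkP iv l0). Qed.

Lemma arr_in_codom (a : arr B) : inQ0 (src a) -> inQ0 (tgt a) -> a \in codom ia.
Proof.
move=> h1 h2; apply/negPn/negP => h; move: hbl; rewrite /blossoming.
by move=> [_ [_ [_ [_ [_ [/(_ a h) + _]]]]]]; rewrite [_ \in _]h1 [_ \in _]h2.
Qed.

Lemma map_codom (p : seq (arr B)) : {subset p <= codom ia} -> exists p' : seq (arr Q), p = map ia p'.
Proof.
elim: p => [|a p IH] h; first by exists [::].
have [|p' ->] := IH; first by move=> x hx; apply: h; rewrite inE hx orbT.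
have /codomP[a' ->] := h a (mem_head _ _); by exists (a' :: p').
Qed.

Lemma path_bound : exists m, forall p : seq (arr B), size p = m -> {subset p <= codom ia} ->
  ~~ sorted (fun a c => (tgt a == src c) && ~~ Defs.rel B a c) p.
Proof.
have [m hm] := hadm; exists m => p hp /map_codom[p' e]; subst p.
rewrite size_map in hp; apply: contra (hm p' hp); rewrite sorted_map.
move: hbl; rewrite /blossoming => -[ivI [_ [hs [ht [hr _]]]]].
by apply: sub_sorted => a c /=; rewrite ht hs (inj_eq ivI) hr.
Qed.

Lemma adm2_same_dir (x z : letter B) (r := fun a c : arr B => (tgt a == src c) && ~~ Defs.rel B a c) :
  adm2 x z -> z.2 = x.2 -> if x.2 then r x.1 z.1 else r z.1 x.1.
Proof.
rewrite {}/r; case: x => a []; case: z => c [] //=; rewrite /adm2 /ltgt /lsrc /=.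
  by case/and3P=> -> _ /andP[].
by rewrite eq_sym => /and3P[-> _].
Qed.

(** Going on in the same direction follows a path without relations; admissibility bounds its length
    inside Q, so it reaches a blossom vertex. *)
Lemma straight_ext (l : letter B) : exists s,
  [/\ path (@adm2 B) l s, all (fun x => x.2 == l.2) s & ~~ inQ0 (ltgt (last l s))].
Proof.
have [m hm] := path_bound.
have step n : (exists s, [/\ path (@adm2 B) l s, all (fun x => x.2 == l.2) s & ~~ inQ0 (ltgt (last l s))]) \/
   (exists s, [/\ size s = n, path (@adm2 B) l s, all (fun x => x.2 == l.2) s &
      all (fun x => inQ0 (ltgt x)) (l :: s)]).
  elim: n => [|n [h|[s [s1 s2 s3 s4]]]]; [|by left|].
    by case: (boolP (inQ0 (ltgt l))) => h; [right|left]; exists [::]; split=> //=; rewrite h.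
  have hl : inQ0 (ltgt (last l s)) by apply: (allP s4); apply: mem_last.
  have [z [z1 z2]] := follow_exists hbl l.2 hl.
  case: (boolP (inQ0 (ltgt z))) => h; [right|left]; exists (rcons s z).
    rewrite size_rcons s1 rcons_path s2 z1 all_rcons z2 eqxx s3; split=> //.
    by rewrite -rcons_cons all_rcons h.
  by rewrite rcons_path s2 z1 all_rcons z2 eqxx s3 last_rcons h.
case: (step m) => // -[s [s1 s2 s3 s4]]; exfalso.
pose r := fun a c : arr B => (tgt a == src c) && ~~ Defs.rel B a c.
(* The first letter [l] may itself start at a blossom vertex; only the letters after it are sure to
   be arrows of Q. *)
have srcs : all (fun x => inQ0 (lsrc x)) s.
  elim: s l s2 s4 {s1 s3 step} => //= x s IH l /andP[h1 h2] /andP[_ h3].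
  by rewrite (adm2_inQ0r hbl h1) (IH x).
have sub : {subset map fst s <= codom ia}.
  move=> a /mapP[[a' b] hx ->]; have := allP srcs _ hx; move: s4 => /= /andP[_ /allP/(_ _ hx)].
  by case: b {hx} => /= h h'; apply: arr_in_codom.
have ss : sorted (fun x y : letter B => if l.2 then r x.1 y.1 else r y.1 x.1) s.
  elim: s l s2 s3 {s1 s4 srcs sub step} => //= x s IH l /andP[h1 h2] /andP[/eqP h3 h4].
  have := IH x h2; rewrite h3 => /(_ h4); case: s h2 h4 {IH} => //= z s /andP[h5 _] /andP[/eqP h7 _] ->.
  by rewrite andbT -h3; apply: adm2_same_dir => //; rewrite h7.
case: (boolP l.2) ss => hl ss.
  have := hm (map fst s); rewrite size_map => /(_ s1 sub); rewrite sorted_map.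
  by move/negP; apply.
have := hm (rev (map fst s)); rewrite size_rev size_map => /(_ s1).
rewrite rev_sorted sorted_map => /(_ _) /negP; apply=> //.
by move=> a; rewrite mem_rev; apply: sub.
Qed.

Lemma straight_ext_nth (l : letter B) : exists C,
  [/\ 0 < size C, L C 0 = l, admw C, forall k, k < size C -> (L C k).2 = l.2 &
      ~~ inQ0 (ltgt (L C (size C).-1))].
Proof.
have [s [s1 s2 s3]] := straight_ext l; exists (l :: s); split=> //.
- by apply/admwP.
- by case=> [|k] //= hk; apply/eqP; apply: (all_nthP l0 s2).
- by rewrite nth_last.
Qed.

Lemma straight_through (x : letter B) : exists w i,
  [/\ is_walk w, straight w, i < size w & L w i = x].
Proof.
have [C [C1 C2 C3 C4 C5]] := straight_ext_nth x.
have [A [A1 A2 A3 A4 A5]] := straight_ext_nth (linv x).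
have wA : admw (winv A) by apply: admw_winv.
pose w := winv A ++ behead C.
have hC : C = x :: behead C by case: (C) C1 C2 => //= y s _ ->.
have nC k : L (behead C) k = L C k.+1 by rewrite nth_behead.
have szC : size C = (size (behead C)).+1 by rewrite {1}hC.
have lA k : k < size A -> (L (winv A) k).2 = x.2.
  by move=> hk; rewrite nth_winv //= A4 /= ?negbK //; nlia.
have sw : size w = size A + size (behead C) by rewrite size_cat size_winv.
have hx : L w (size A).-1 = x.
  rewrite nth_cat size_winv prednK // leqnn nth_winv ?prednK // subnn A2 linvK //.
have dirs k : k < size w -> (L w k).2 = x.2.
  rewrite sw nth_cat size_winv => hk; case: ltnP => h; first exact: lA.
  by rewrite nC C4 //; nlia.
exists w, (size A).-1; split=> //; last by rewrite sw; nlia.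
  apply: admw_walk.
  - apply: admw_cat => //.
      by move=> i; rewrite !nC => hi; apply: C3; rewrite szC ltnS.
    rewrite size_winv => _ h; rewrite nth_winv ?prednK // subnn A2 linvK nC -C2.
    by apply: C3; rewrite szC ltnS.
  - by rewrite sw; nlia.
  - by rewrite nth_cat size_winv A1 nth_winv // lsrc_linv subn1.
  - rewrite sw nth_cat size_winv; case: (posnP (size (behead C))) => h.
      rewrite h addn0 prednK // leqnn nth_winv ?prednK // subnn A2 linvK.
      by move: C5; rewrite szC h /= C2.
    rewrite ltnNge (_ : size A <= _) /=; last by nlia.
    rewrite nC; have -> : (size A + size (behead C)).-1 - size A = (size (behead C)).-1 by nlia.
    by move: C5; rewrite szC /= prednK.
rewrite /straight; case e : x.2; apply/orP; [left|right]; apply/(all_nthP l0) => k hk;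
  by rewrite dirs ?e.
Qed.

Definition peakw (v : vtx Q) w := is_walk w /\ exists p,
  [/\ p.+1 < size w, forall k, k < size w -> (L w k).2 = (p < k) & ltgt (L w p) = iv v].

Lemma peakw_winv v w : peakw v w -> peakw v (winv w).
Proof.
move=> [hw [p [h1 h2 h3]]]; split; first exact: (walk_winv hbl l0).
exists (size w - p.+2); rewrite size_winv; split; first by nlia.
  by move=> k hk; rewrite nth_winv //= h2; nlia.
rewrite nth_winv ?ltgt_linv; last by nlia.
have -> : size w - (size w - p.+2).+1 = p.+1 by nlia.
by rewrite -h3 (adm2_vtx (walk_adm l0 hw h1)).
Qed.

Lemma peakw_exists v : exists w, peakw v w.
Proof.
have hv : inQ0 (iv v) by apply: codom_f.
have [side [_ _ /(_ true false)[m [m1 m2 m3]]]] := side_exists hbl hv.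
have [C [C1 C2 C3 C4 C5]] := straight_ext_nth (linv m).
have sC : lsrc (linv m) = iv v by rewrite lsrc_linv.
have [d [d1 d2]] : exists d, adm2 d (linv m) /\ d.2 = false.
  by apply: (pred_exists hbl); rewrite sC.
have [A [A1 A2 A3 A4 A5]] := straight_ext_nth (linv d).
have hj : L (winv A) (size A).-1 = d by rewrite nth_winv ?prednK // subnn A2 linvK.
exists (winv A ++ C); split.
  apply: admw_walk.
  - by apply: admw_cat; [apply: admw_winv|by []|rewrite size_winv hj C2].
  - by rewrite size_cat size_winv; nlia.
  - by rewrite nth_cat size_winv A1 nth_winv // lsrc_linv subn1.
  - rewrite nth_cat size_cat size_winv ltnNge (_ : size A <= _) /=; last by nlia.
    by have -> : (size A + size C).-1 - size A = (size C).-1 by nlia.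
exists (size A).-1; rewrite size_cat size_winv; split; first by nlia.
  move=> k hk; rewrite nth_cat size_winv; case: ltnP => h.
    by rewrite nth_winv //= A4 /= ?d2; nlia.
  by rewrite C4 /= ?m3; nlia.
by rewrite nth_cat size_winv prednK // leqnn hj (adm2_vtx d1).
Qed.

Lemma peakw_nobot v w p q : peakw v w -> ~~ occ l0 false w p q.
Proof.
move=> [_ [r [_ h _]]]; apply/negP => /and4P[pq hq /eqP e1 /eqP e2].
by move: e1 e2; rewrite !h //; nlia.
Qed.

(** A walk whose only turn is a peak has no bottom substring, so such walks never kiss; there is one
    for each vertex. *)
Lemma peak_face : exists F : seq (seq (letter B)),
  [/\ uniq F, size F = #|vtx Q| & nkset [set` F]%classic].
Proof.
have hc v : exists w, peakw v w /\ Defs.canon w.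
  have [w hw] := peakw_exists v; case/orP: (canon_winv w) => h; first by exists w.
  by exists (winv w); split=> //; apply: peakw_winv.
have [f hf] := choice hc.
have nkiss v v' : ~~ kisses iv (f v) (f v').
  have [[w1 _] _] := hf v; have [pv' _] := hf v'; have w2 := pv'.1.
  rewrite /kisses; have [-> _] := kiss_countE hbl l0 w1 w2; rewrite -eqn0Ngt; apply/eqP.
  rewrite /kisscnt big1 // => p _; rewrite big1 // => q _; rewrite big1 // => p' _.
  by rewrite big1 // => q' _; rewrite (negbTE (peakw_nobot _ _ pv')) andbF.
exists [seq f v | v <- enum (vtx Q)]; split.
- rewrite map_inj_uniq ?enum_uniq // => v v' e.
  have [[_ [p [p1 p2 p3]]] _] := hf v; have [[_ [q [q1 q2 q3]]] _] := hf v'.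
  rewrite -e in q1 q2 q3; have ivI : injective iv by move: hbl; rewrite /blossoming; case.
  apply: ivI; rewrite -p3 -q3; congr (ltgt (L _ _)); case: (ltngtP p q) => // h.
    by have := p2 q (ltnW q1); rewrite (q2 _ (ltnW q1)) h ltnn.
  by have := q2 p (ltnW p1); rewrite (p2 _ (ltnW p1)) h ltnn.
- by rewrite size_map -cardE.
split=> [w|w w'] /= /mapP[v _ ->]; last by move=> /mapP[v' _ ->].
have [[hw [p [p1 p2 p3]]] c] := hf v.
rewrite /bend /cwalk hw c /= [nsk _ _]nkiss /=; apply/negP => /orP[]/(all_nthP l0) h.
  by have := h p ltac:(nlia); rewrite p2 ?ltnn //; nlia.
by have := h p.+1 p1; rewrite p2 ?ltnSn.
Qed.

End Straight.

(** * Flips *)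

Ltac zlia := clear; lia.

Lemma Posz_mul_lt (a n m : nat) : (n <= m)%N -> Posz (a * n) + 1 < Posz (a * m) + 3.
Proof. by move=> h; have := leq_mul (leqnn a) h; lia. Qed.

Lemma mulB_ge1 (K s e : int) : 1 < K -> 1 <= s -> - (K - 1) < e < K - 1 -> 1 <= K * s - e.
Proof. nia. Qed.

Lemma mulB_leN1 (K s e : int) : 1 < K -> s <= -1 -> - (K - 1) < e < K - 1 -> K * s - e <= -1.
Proof. nia. Qed.

Section Flip.
Variables (R : realType) (Q B : bquiver) (iv : vtx Q -> vtx B) (ia : arr Q -> arr B).
Hypothesis hbl : blossoming Q B iv ia.
Hypothesis hadm : admissible Q.
Variable l0 : letter B.
Notation is_walk := (is_walk iv).
Notation L := (nth l0).
Notation nk := (nk l0).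
Notation topl := (topl l0).
Notation gvec := (gvec R iv).
Notation maskvec := (maskvec R iv l0).
Notation gturn := (gturn l0).
Notation gpair := (gpair l0).
Notation occ := (occ l0).
Notation Ysum := (Ysum l0).
Notation stable := (stable l0).
Notation nkset := (nkset iv).
Notation bend := (bend iv).
Notation spanning := (@spanning R Q B iv).
Notation signr := (signr R).
Implicit Types (u xi : seq (letter B)) (i j k t p q : nat).

Lemma gpair_neg b S u xi : gpair (~~ b) S u xi = - gpair b S u xi.
Proof. by rewrite /gpair !gpair1_neg opprD. Qed.

Lemma straight_nk u xi : is_walk u -> is_walk xi -> straight xi -> nk u xi.
Proof.
move=> hu hx hs b i j t; apply/negP => /kpatP[[_ h2] _ [_ h5] [_ h7] _].
have hj : (j < size xi)%N by nlia.
by case/orP: hs => /(all_nthP l0) h; have := h _ h2; have := h _ hj; rewrite h5 h7; case: (b).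
Qed.

(** * Sign estimates on both sides of a wall *)

Section Data.
Variables (F : seq (seq (letter B))) (w : seq (letter B)).
Hypothesis uF : uniq F.
Hypothesis nF : nkset [set` F]%classic.
Hypothesis wF : w \in F.
Hypothesis hsp : spanning [set` F]%classic.
Variables (b : bool) (k1 k2 : nat).
Hypothesis k12 : (k1 < k2)%N.
Hypothesis hk2 : (k2 < size w)%N.
Hypothesis e1 : (L w k1).2 = ~~ b.
Hypothesis e2 : (L w k2).2 = b.
Hypothesis t1 : topl (sym [set` F]%classic) w k1.
Hypothesis t2 : topl (sym [set` F]%classic) w k2.

Let G := rem w F.
Let Xs := sym [set` F]%classic.
Let Gs := sym [set` G]%classic.

Lemma memG u : (u \in G) = (u != w) && (u \in F).
Proof. by rewrite /G mem_rem_uniq // !inE. Qed.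

Lemma GF u : Gs u -> Xs u.
Proof. by case=> /=; rewrite memG => /andP[_ h]; [left|right]. Qed.

Lemma nG : nkset [set` G]%classic.
Proof.
split=> [u|u u'] /=; rewrite memG => /andP[_ h]; first exact: nF.1.
by rewrite memG => /andP[_ h']; apply: nF.2.
Qed.

Lemma wXs : Xs w.
Proof. by left. Qed.

Lemma Xs_walk u : Xs u -> is_walk u.
Proof. exact: (nkset_walk hbl l0 nF). Qed.

Lemma Fwalk u : u \in F -> is_walk u.
Proof. by move=> h; apply: Xs_walk; left. Qed.

Lemma Xs_nk u u' : Xs u -> Xs u' -> nk u u'.
Proof. exact: (nkset_nk hbl l0 nF). Qed.

Variable K : int.
Let y (x : vtx B) : int := K * \sum_(u <- G) gturn u x - gturn w x.
Let cY xi p q := signz b * Ysum y xi p q.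

Lemma Ysum_y c xi p q : is_walk xi -> (p <= q)%N -> (q < size xi)%N ->
  signz c * Ysum y xi p q = K * \sum_(u <- G) gpair c (itv p q) u xi - gpair c (itv p q) w xi.
Proof.
move=> hx pq hq; rewrite (gpair_Ysum hbl) //; last exact: Fwalk.
rewrite (eq_big_seq (fun u => signz c * Ysum (gturn u) xi p q)); last first.
  by move=> u; rewrite memG => /andP[_ hu]; rewrite (gpair_Ysum hbl) //; apply: Fwalk.
rewrite -mulr_sumr mulrCA -mulrBr; congr (_ * _).
rewrite /Ysum /y sumrB; congr (_ - _); rewrite -mulr_sumr; congr (_ * _).
by rewrite exchange_big.
Qed.

(** The string pairs with [w] alone among [F], so subtracting the right multiple of the
    distinguished string of [w] leaves a vector orthogonal to a spanning family. *)
Lemma prop_sigma xi p q : is_walk xi -> (q < size xi)%N ->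
  (forall u, u \in G -> gpair b (itv p q) u xi = 0) ->
  maskvec xi (itv p q) = fun v => (gpair b (itv p q) w xi)%:~R * maskvec w (itv k1 k2) v.
Proof.
move=> hx hq h0; set tt := (_%:~R); have hv := @valid_itv _ p q xi hq.
have h : (fun v => maskvec xi (itv p q) v + (- tt) * maskvec w (itv k1 k2) v) = (fun=> 0).
  apply: hsp => u /= uFu; rewrite dotp_comb.
  have dd := dual_tops R hbl nF wF uFu k12 hk2 e1 e2 t1 t2.
  have d2 := signr_dotp R hbl l0 b (Fwalk uFu) hx hv.
  have : signr b * (dotp (gvec u) (maskvec xi (itv p q)) + - tt * dotp (gvec u) (maskvec w (itv k1 k2))) = 0.
    rewrite mulrDr mulrCA dd d2; case: (eqVneq u w) => [->|uw]; first by rewrite mulr1 subrr.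
    by rewrite h0 ?memG ?uw // mulr0 addr0.
  by move/(congr1 (fun z => signr b * z)); rewrite mulrA signrK mul1r mulr0.
apply/funext => v; have := congr1 (fun f => f v) h; rewrite mulNr => /eqP.
by rewrite subr_eq0 => /eqP.
Qed.

Hypothesis K0 : 1 < K.
(** By [gpair_bound] every pairing of [w] with [xi] is then below [K - 1] in absolute value, so a
    nonzero multiple of [K] outweighs it. *)
Definition Kbig xi := Posz (2 * size w * size xi) + 1 < K.

Lemma gpairw_bound c S xi : Kbig xi -> - (K - 1) < gpair c S w xi < K - 1.
Proof. by rewrite /Kbig; move: (gpair_bound l0 c S w xi); zlia. Qed.

Lemma sum_le0 (f : seq (letter B) -> int) : (forall u, u \in G -> f u <= 0) ->
  \sum_(u <- G) f u <= -1 \/ (\sum_(u <- G) f u = 0 /\ forall u, u \in G -> f u = 0).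
Proof.
move=> h; have h0 : \sum_(u <- G) f u <= 0 by rewrite big_seq; apply: sumr_le0.
case: (eqVneq (\sum_(u <- G) f u) 0) => [e|ne]; last by left; move: h0 ne; zlia.
right; split=> // u uG; apply/eqP; rewrite eq_le h //= leNgt; apply/negP => hu.
have uG' : uniq G by apply: rem_uniq.
have : \sum_(u <- G) f u < 0; last by rewrite e.
rewrite (bigD1_seq u) //= -(addr0 0); apply: ltr_leD => //.
by rewrite big_seq_cond; apply: sumr_le0 => v /andP[hv _]; apply: h.
Qed.

Lemma sum_ge0 (f : seq (letter B) -> int) : (forall u, u \in G -> 0 <= f u) ->
  1 <= \sum_(u <- G) f u \/ (\sum_(u <- G) f u = 0 /\ forall u, u \in G -> f u = 0).
Proof.
move=> h; have [|h1|[h1 h2]] := @sum_le0 (fun u => - f u).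
- by move=> u /h; rewrite oppr_le0.
- by left; move: h1; rewrite sumrN lerN2.
- right; split=> [|u /h2/eqP]; last by rewrite oppr_eq0 => /eqP.
  by move: h1; rewrite sumrN => /eqP; rewrite oppr_eq0 => /eqP.
Qed.

Lemma gpair_occ_ge0 c xi p q u : is_walk xi -> (forall u, Xs u -> nk u xi) -> occ c xi p q ->
  u \in F -> 0 <= gpair c (itv p q) u xi.
Proof.
move=> hx hn /and4P[pq hq /eqP h1 /eqP h2] uFu.
have hb : bclosed l0 (~~ c) (itv p q) xi by apply: bclosed_itv; rewrite ?negbK.
have su : Xs u by left. have iu := sym_winv su.
have := lerD (gpair1_bclosed_le0 hbl (Xs_walk su) hx hb (hn _ su))
             (gpair1_bclosed_le0 hbl (Xs_walk iu) hx hb (hn _ iu)).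
by rewrite -[X in X <= _]/(gpair (~~ c) (itv p q) u xi) gpair_neg addr0 oppr_le0.
Qed.

Lemma gpair_occ_self c xi p q : Xs xi -> occ c xi p q ->
  exists2 u, u \in F & (u = xi \/ u = winv xi) /\ 1 <= gpair c (itv p q) u xi.
Proof.
move=> hx /and4P[pq hq /eqP h1 /eqP h2].
have hb : bclosed l0 (~~ c) (itv p q) xi by apply: bclosed_itv; rewrite ?negbK.
have ex : exists j, itv p q j by exists p; rewrite /itv leqnn.
have := gpair_self hbl nF hx hb ex; rewrite gpair_neg lerN2 => h.
case: (hx) => h'; first by exists xi; auto.
exists (winv xi) => //; split; first by right.
by rewrite /gpair winvK addrC; apply: h.
Qed.

Lemma gpair_winvl c S u xi : gpair c S (winv u) xi = gpair c S u xi.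
Proof. by rewrite /gpair winvK addrC. Qed.

(** Every walk of [G] pairs nonnegatively with such a string of [u], and [u] itself contributes at
    least 1. *)
Lemma stable_G u : u \in G -> Kbig u -> stable y u.
Proof.
move=> uG hK c p q ho; have := ho => /and4P[pq hq _ _].
have uFu : u \in F by move: uG; rewrite memG => /andP[].
have su : Xs u by left.
rewrite (Ysum_y c (Fwalk uFu) (ltnW pq) hq).
have hn u' : Xs u' -> nk u' u by move=> h; apply: Xs_nk.
have hge u' : u' \in G -> 0 <= gpair c (itv p q) u' u.
  by rewrite memG => /andP[_ h]; apply: (gpair_occ_ge0 (Fwalk uFu) hn ho).
have [u' u'F [ue u'1]] := gpair_occ_self su ho.
have ue1 : 1 <= gpair c (itv p q) u u by case: ue u'1 => ->; rewrite ?gpair_winvl.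
have h1 : 1 <= \sum_(u' <- G) gpair c (itv p q) u' u.
  case: (sum_ge0 hge) => // -[_ /(_ _ uG) h]; by rewrite h in ue1.
exact: (lt_le_trans ltr01 (mulB_ge1 K0 h1 (gpairw_bound c (itv p q) hK))).
Qed.

Lemma half_stable xi i k : is_walk xi -> (i < size xi)%N -> (L xi i).2 = b ->
  topl Gs xi i -> straight xi \/ Gs xi -> Kbig xi -> (k <= i)%N ->
  ((L xi k).2 = b -> cY xi k i <= 0) /\ ((L xi k).2 = ~~ b -> 1 <= cY xi k i).
Proof.
move=> hx hi ei ti hs hK; rewrite leq_eqVlt => /orP[/eqP ->|ki].
  rewrite /cY /Ysum big_geq // mulr0 ei; split=> // h.
  by exfalso; move: h; case: (b).
have hn u : Xs u -> nk u xi.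
  move=> hu; case: hs => hs; first by apply: straight_nk => //; apply: Xs_walk.
  by apply: Xs_nk => //; apply: GF.
rewrite /cY (Ysum_y b hx (ltnW ki) hi); have hb := gpairw_bound b (itv k i) hK; split=> ek.
  have hle u : u \in G -> gpair b (itv k i) u xi <= 0.
    move=> uG; have gu : Gs u by left. have gi := sym_winv gu.
    have xu := GF gu; have xi' := GF gi.
    apply: (gpair_itv_le0 hbl (hn _ xu) (hn _ xi') (Xs_walk xu) hx gu gi hi); auto.
    by rewrite ek => -[h _]; move: h; case: (b).
  case: (sum_le0 hle) => [h|[-> h]]; first exact: (le_trans (mulB_leN1 K0 h hb)).
  have hm := prop_sigma hx hi h.
  have [v hv] := maskvec_neq0 R hbl l0 hx ki hi.
  rewrite mulr0 sub0r oppr_le0 -(ler0z R) leNgt; apply/negP => hneg.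
  move: hv; rewrite hm ltNge => /negP; apply.
  by rewrite nmulr_rle0 // maskvec_ge0.
have ho : occ b xi k i by rewrite /occ ki hi ek ei !eqxx.
have gx : Gs xi.
  case: hs => // /orP[] /(all_nthP l0) h; have hk : (k < size xi)%N by nlia.
    by have := h _ hi; have := h _ hk; rewrite ei ek; case: (b).
  by have := h _ hi; have := h _ hk; rewrite ei ek; case: (b).
have hge u : u \in G -> 0 <= gpair b (itv k i) u xi.
  by rewrite memG => /andP[_ h]; apply: (gpair_occ_ge0 hx hn ho).
have [u uFu [ue u1]] := gpair_occ_self (GF gx) ho.
have [x xG x1] : exists2 x, x \in G & 1 <= gpair b (itv k i) x xi.
  case: gx => h; [exists xi|exists (winv xi)] => //; case: ue u1 => ->; rewrite ?gpair_winvl //.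
have h1 : 1 <= \sum_(u <- G) gpair b (itv k i) u xi.
  case: (sum_ge0 hge) => // -[_ /(_ _ xG) h]; by rewrite h in x1.
exact: (mulB_ge1 K0 h1 hb).
Qed.

(** The sum over [G] cannot vanish here: the string before [k] would be a multiple of the whole
    distinguished string, either by a factor at least 1, which is too large for a proper part, or by
    a nonpositive one, which is impossible for a nonzero string. *)
Lemma mid_stable k : Kbig w -> (k1 < k < k2)%N ->
  ((L w k).2 = b -> 0 <= cY w k1 k) /\ ((L w k).2 = ~~ b -> cY w k1 k <= -1).
Proof.
move=> hK /andP[h1 h2]; have hk : (k < size w)%N by nlia.
have ww := Fwalk wF; have hn u : Xs u -> nk u w by move=> hu; apply: Xs_nk => //; exact: wXs.
rewrite /cY (Ysum_y b ww (ltnW h1) hk); have hb := gpairw_bound b (itv k1 k) hK; split=> ek.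
  have ho : occ b w k1 k by rewrite /occ h1 hk ek e1 !eqxx.
  have hge u : u \in G -> 0 <= gpair b (itv k1 k) u w.
    by rewrite memG => /andP[_ h]; apply: (gpair_occ_ge0 ww hn ho).
  case: (sum_ge0 hge) => [h|[_ h]]; first exact: (le_trans ler01 (mulB_ge1 K0 h hb)).
  exfalso; have hm := prop_sigma ww hk h.
  have [u uFu [ue u1]] := gpair_occ_self wXs ho.
  have w1 : 1 <= gpair b (itv k1 k) w w by case: ue u1 => ->; rewrite ?gpair_winvl.
  have [v hv] := maskvec_neq0 R hbl l0 ww h2 hk2.
  have hadd : maskvec w (itv k1 k2) v = maskvec w (itv k1 k) v + maskvec w (itv k k2) v.
    rewrite /maskvec -natrD -big_split /=; congr (_%:R); apply: eq_bigr => j _.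
    rewrite /itv; case: (_ == _); rewrite ?andbT ?andbF //; nlia.
  have : maskvec w (itv k1 k2) v <= maskvec w (itv k1 k) v.
    rewrite hm ler_peMl ?maskvec_ge0 // -[1]/(1%:~R) ler_int //.
  by rewrite hadd gerDl leNgt hv.
have hle u : u \in F -> gpair b (itv k1 k) u w <= 0.
  move=> uFu; have xu : Xs u by left. have xi' := sym_winv xu.
  apply: (gpair_itv_le0 hbl (hn _ xu) (hn _ xi') (Xs_walk xu) ww xu xi' hk); auto.
  by rewrite ek => -[_ h]; move: h; case: (b).
have hleG u : u \in G -> gpair b (itv k1 k) u w <= 0 by rewrite memG => /andP[_]; apply: hle.
case: (sum_le0 hleG) => [h|[_ h]]; first exact: (mulB_leN1 K0 h hb).
exfalso; have hm := prop_sigma ww hk h; have [v hv] := maskvec_neq0 R hbl l0 ww h1 hk.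
move: hv; rewrite hm ltNge => /negP; apply.
by rewrite mulr_le0_ge0 ?maskvec_ge0 // lerz0 hle.
Qed.

Lemma cY_sigma : cY w k1 k2 = -1.
Proof.
have ww := Fwalk wF; have hv := @valid_itv _ k1 k2 w hk2.
have dd u : u \in F -> gpair b (itv k1 k2) u w = Posz (u == w).
  move=> uFu; apply: (@intr_inj R); rewrite -(signr_dotp R hbl l0 b (Fwalk uFu) ww hv).
  by rewrite (dual_tops R hbl nF wF uFu k12 hk2 e1 e2 t1 t2) pmulrn.
rewrite /cY (Ysum_y b ww (ltnW k12) hk2) dd // eqxx big_seq big1 ?mulr0 ?sub0r // => u.
by rewrite memG => /andP[/negbTE h uFu]; rewrite dd // h.
Qed.

End Data.

(** If no walk of the family contains [x], a straight walk through [x] serves, and [topl] holds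
    vacuously. *)
Lemma half_exists (F : seq (seq (letter B))) (x : letter B) : nkset [set` F]%classic ->
  exists xi i, [/\ is_walk xi, (i < size xi)%N, L xi i = x,
    topl (sym [set` F]%classic) xi i & straight xi \/ sym [set` F]%classic xi].
Proof.
move=> nF; case: (pselect (exists u i, [/\ sym [set` F]%classic u, (i < size u)%N & L u i = x])) => h.
  have [u [i [h1 h2 h3 h4]]] := top_mark hbl nF h; exists u, i; split=> //; last by right.
  exact: (nkset_walk hbl l0 nF).
have [xi [i [h1 h2 h3 h4]]] := straight_through hbl hadm l0 x.
exists xi, i; split=> //; last by left.
by move=> u j Fu hj e; exfalso; apply: h; exists u, j; rewrite e.
Qed.

Lemma flip_exists (F : seq (seq (letter B))) w : uniq F -> nkset [set` F]%classic ->
  w \in F -> spanning [set` F]%classic ->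
  exists w', [/\ bend w', w' \notin F & nkset [set` w' :: rem w F]%classic].
Proof.
move=> uF nF wF hsp.
have [b [k1 [k2 [[k12 hk2] [e1 e2] t1 t2]]]] := two_tops hbl l0 nF wF.
have ww : is_walk w := Fwalk nF wF.
have nG' : nkset [set` rem w F]%classic by apply: nG.
(* [x] and [x'] are the other letters that may precede and follow the distinguished string; using
   both exchanges top and bottom. *)
have [x [x1 x2]] : exists x, adm2 x (L w k1.+1) /\ x.2 = b.
  by apply: (pred_exists hbl); rewrite (walk_src hbl l0 ww) //; nlia.
have [x' [x'1 x'2]] : exists x', adm2 (L w k2.-1) x' /\ x'.2 = ~~ b.
  by apply: (follow_exists hbl); rewrite (walk_tgt hbl l0 ww); nlia.
have [mu [i [m1 m2 m3 m4 m5]]] := half_exists x nG'.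
(* The right half is obtained as a left half read backwards: [linv x'] has direction [b] like [x],
   so [half_stable] applies to both. *)
have [xi [i' [n1 n2 n3 n4 n5]]] := half_exists (linv x') nG'.
pose d := (k2 - k1)%N; pose m := (i + d)%N; pose ir := (size xi - i'.+1)%N; pose nu := winv xi.
have d0 : (0 < d)%N by rewrite /d; nlia.
have wnu : is_walk nu by apply: (walk_winv hbl l0).
have snu : size nu = size xi by apply: size_winv.
have hir : (ir < size nu)%N by rewrite snu /ir; nlia.
have nuir : L nu ir = x'.
  by rewrite nth_winv -?snu // snu (_ : size xi - ir.+1 = i')%N ?n3 ?linvK // /ir; nlia.
pose mid := drop k1.+1 (take k2 w).
have smid : size mid = d.-1 by rewrite size_drop size_takel ?(ltnW hk2) // /d; nlia.
have nmid k : (k < d.-1)%N -> L mid k = L w (k1.+1 + k).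
  by move=> hk; rewrite nth_drop nth_take //; move: hk; rewrite /d; nlia.
(* The flipped walk: the distinguished string of [w], continued on both sides
   along the topmost remaining walks. *)
pose om := (take i.+1 mu ++ mid ++ drop ir nu).
have stk : size (take i.+1 mu) = i.+1 by rewrite size_takel.
have som : size om = (m + (size nu - ir))%N.
  by rewrite !size_cat stk smid size_drop /m; nlia.
have omA k : (k <= i)%N -> L om k = L mu k.
  by move=> hk; rewrite nth_cat stk ltnS hk nth_take.
have omM k : (i < k)%N -> (k < m)%N -> L om k = L w (k1 + (k - i)).
  move=> hk hk'; rewrite nth_cat stk ltnS leqNgt hk /= nth_cat smid ifT; last by rewrite /m in hk'; nlia.
  by rewrite nmid; [congr (L w _); nlia|rewrite /m in hk'; nlia].
have omB k : (m <= k)%N -> L om k = L nu (ir + (k - m)).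
  move=> hk; rewrite nth_cat stk ifF; last by apply/negbTE; rewrite /m in hk; nlia.
  rewrite nth_cat smid ifF; last by apply/negbTE; rewrite /m in hk; nlia.
  by rewrite nth_drop; congr (L nu _); rewrite /m in hk *; nlia.
have omi : L om i = x by rewrite omA.
have omm : L om m = x' by rewrite omB // subnn addn0.
have wom : is_walk om.
  apply/(is_walkP iv l0); rewrite som; split; first by rewrite /m; nlia.
  - move=> k hk; case: (ltngtP k i) => hki.
    + by rewrite !omA // 1?ltnW //; apply: (walk_adm l0 m1); nlia.
    + case: (ltngtP k.+1 m) => hkm.
      * rewrite !omM //; [|nlia..]; rewrite subSn 1?ltnW // addnS; apply: (walk_adm l0 ww).
        by rewrite /m /d in hkm; nlia.
      * rewrite !omB //; [|nlia..]; rewrite subSn // addnS; apply: (walk_adm l0 wnu).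
        by nlia.
      * rewrite hkm omm omM //; [|nlia..].
        by rewrite (_ : k1 + (k - i) = k2.-1)%N // ; rewrite /m /d in hkm; nlia.
    + rewrite hki omi; case: (ltngtP i.+1 m) => hkm.
      * by rewrite omM // subSnn addn1.
      * by rewrite /m in hkm; nlia.
      * have ek : k2 = k1.+1 by rewrite /m /d in hkm; nlia.
        rewrite hkm omm; apply: (adm2_cross hbl (l := L w k1) (x := L w k1.+1)) => //.
          by apply: (walk_adm l0 ww); nlia.
        by move: x'1; rewrite ek.
  - by rewrite omA // (walk_src hbl l0 m1) //; nlia.
  - rewrite omB; last by nlia.
    have -> : (ir + ((m + (size nu - ir)).-1 - m) = (size nu).-1)%N by nlia.
    by rewrite (walk_tgt hbl l0 wnu); nlia.
(* The total size bounds every word involved, so this single [K] satisfies [Kbig] for the walks of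
   [F], for [mu] and for [xi]. *)
pose K : int := Posz (2 * size w * (\sum_(u <- F) size u + size mu + size xi)) + 3.
have Kb z : (size z <= \sum_(u <- F) size u + size mu + size xi)%N -> Kbig w K z.
  exact: Posz_mul_lt.
have KF u : u \in F -> Kbig w K u.
  by move=> hu; apply: Kb; rewrite (big_rem u hu) /= -!addnA leq_addr.
have Kmu : Kbig w K mu by apply: Kb; rewrite -addnA addnCA leq_addr.
have Kxi : Kbig w K xi by apply: Kb; rewrite leq_addl.
have K1 : 1 < K by rewrite /K; clear; lia.
pose y (z : vtx B) : int := K * \sum_(u <- rem w F) gturn u z - gturn w z.
pose cY z p q := signz b * Ysum y z p q.
have sig : cY w k1 k2 = -1 by apply: (cY_sigma uF nF wF k12 hk2 e1 e2 t1 t2).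
have x'd : (linv x').2 = b by rewrite /= x'2 negbK.
have hA k : (k <= i)%N -> ((L mu k).2 = b -> cY mu k i <= 0) /\ ((L mu k).2 = ~~ b -> 1 <= cY mu k i).
  move=> hk; apply: (half_stable uF nF wF hsp k12 hk2 e1 e2 t1 t2) => //.
  by rewrite m3.
have hM k : (k1 < k < k2)%N -> ((L w k).2 = b -> 0 <= cY w k1 k) /\ ((L w k).2 = ~~ b -> cY w k1 k <= -1).
  by apply: (mid_stable uF nF wF hsp k12 hk2 e1 e2 t1 t2) => //; apply: KF.
have hB j : (ir <= j)%N -> (j < size nu)%N ->
    ((L nu j).2 = ~~ b -> cY nu ir j <= 0) /\ ((L nu j).2 = b -> 1 <= cY nu ir j).
  move=> h1 h2; rewrite snu in h2.
  have e : cY nu ir j = cY xi (size xi - j.+1)%N i'.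
    rewrite /cY; congr (_ * _); have hji : (size xi - j.+1 <= i')%N by rewrite /ir in h1; nlia.
    rewrite -(Ysum_winv l0 y n1 hji n2).
    by congr (Ysum _ _ _ _); rewrite /ir; nlia.
  have [g1 g2] : ((L xi (size xi - j.+1)).2 = b -> cY xi (size xi - j.+1)%N i' <= 0) /\
     ((L xi (size xi - j.+1)).2 = ~~ b -> 1 <= cY xi (size xi - j.+1)%N i').
    apply: (half_stable uF nF wF hsp k12 hk2 e1 e2 t1 t2) => //; first by rewrite n3.
    by rewrite /ir in h1; nlia.
  rewrite e nth_winv //=; split=> h; [apply: g1|apply: g2].
    by rewrite -[LHS]negbK h negbK.
  by rewrite -[LHS]negbK h.
have cYS z p q : (p <= q)%N -> cY z p q.+1 = cY z p q + signz b * y (ltgt (L z q)).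
  move=> pq; rewrite /cY -(@Ysum_cat _ l0 y z p q q.+1) // mulrDr; congr (_ + _ * _).
  by rewrite /Ysum big_nat1.
have cYl z p q : (p < q)%N -> cY z p q = signz b * y (ltgt (L z p)) + cY z p.+1 q.
  move=> pq; rewrite /cY -(@Ysum_cat _ l0 y z p p.+1 q) // mulrDr; congr (_ * _ + _).
  by rewrite /Ysum big_nat1.
have cY0 z p : cY z p p = 0 by rewrite /cY /Ysum big_geq // mulr0.
(* The potential is glued from the three pieces of [om]: it is -1 at [x], of direction [b], and 1 at
   [x'], of direction [~~ b], the jump being due to [cY w k1 k2 = -1]. *)
pose H k : int := if (k <= i)%N then - 1 + 2 * cY mu k i
  else if (k <= m)%N then - 1 - 2 * cY w k1 (k1 + (k - i))%N
  else 1 - 2 * cY nu ir (ir + (k - m))%N.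
have Hm : H m = 1.
  rewrite /H ifF ?leqnn; last by apply/negbTE; rewrite /m; nlia.
  by rewrite (_ : k1 + (m - i) = k2)%N ?sig // /m /d; nlia.
have st : stable y om.
  apply: (@pot_stable _ l0 y om b H).
  - move=> k hk; rewrite /H; case: (ltngtP k i) => hki.
    + by rewrite (cYl mu k i) // omA 1?ltnW //; ring.
    + case: (ltngtP k m) => hkm.
      * rewrite omM // subSn 1?ltnW // addnS cYS ?leq_addr //; ring.
      * rewrite omB 1?ltnW // subSn 1?ltnW // addnS cYS ?leq_addr //; ring.
      * rewrite hkm omB // subSn // subnn addn1 addn0 cYS // cY0.
        by rewrite (_ : k1 + (m - i) = k2)%N ?sig; [ring|rewrite /m /d; nlia].
    + rewrite hki cY0 ifT; last by rewrite /m; nlia.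
      rewrite omi subSnn addn1 cYS // cY0.
      have -> : ltgt (L w k1) = ltgt x.
        by rewrite (adm2_vtx x1) (adm2_vtx (walk_adm l0 ww (i := k1) _)) //; nlia.
      ring.
  - move=> k; rewrite som => hk ek; rewrite /H; case: leqP => hki.
      by rewrite omA // in ek; have [+ _] := hA k hki; move=> /(_ ek); zlia.
    case: (ltngtP k m) => hkm.
    + rewrite omM // in ek; have [+ _] := hM (k1 + (k - i))%N ltac:(rewrite /m /d in hkm; nlia).
      by move=> /(_ ek); zlia.
    + rewrite omB 1?ltnW // in ek.
      by have [_] := hB (ir + (k - m))%N (leq_addr _ _) ltac:(nlia); move=> /(_ ek); zlia.
    + by move: ek; rewrite hkm omm x'2; case: (b).
  - move=> k; rewrite som => hk ek; rewrite /H; case: leqP => hki.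
      by rewrite omA // in ek; have [_] := hA k hki; move=> /(_ ek); zlia.
    case: (ltngtP k m) => hkm.
    + rewrite omM // in ek; have [_] := hM (k1 + (k - i))%N ltac:(rewrite /m /d in hkm; nlia).
      by move=> /(_ ek); zlia.
    + rewrite omB 1?ltnW // in ek.
      by have [+ _] := hB (ir + (k - m))%N (leq_addr _ _) ltac:(nlia); move=> /(_ ek); zlia.
    + by rewrite hkm (_ : k1 + (m - i) = k2)%N ?sig // /m /d; nlia.
have stG u : u \in rem w F -> stable y u.
  move=> uG; apply: (stable_G uF nF wF K1) => //; apply: KF.
  by move: uG; rewrite mem_rem_uniq // inE => /andP[].
have kst u v : is_walk u -> is_walk v -> stable y u -> stable y v -> ~~ kisses iv u v.
  move=> hu hv su sv; apply/(kissesP hbl l0 hu hv).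
  have iu := walk_winv hbl l0 hu.
  by split=> j j' t; [apply: (stable_nk hu hv su sv)|apply: (stable_nk iu hv (stable_winv hu su) sv)].
have [w' [w'w w'c w's w'e]] : exists w', [/\ is_walk w', Defs.canon w', stable y w' & w' = om \/ winv w' = om].
  case/orP: (canon_winv om) => c; first by exists om; split; auto.
  by exists (winv om); split; auto; [apply: (walk_winv hbl l0)|apply: stable_winv wom st|rewrite winvK; right].
have symw' : forall X, X w' -> sym X om by move=> X h; case: w'e => <-; [left|right; rewrite winvK].
have bw' : bend w'.
  have hstr : ~~ straight om.
    apply/negP => /orP[]/(all_nthP l0) h.
      have := h i; have := h m; rewrite omi omm som x2 x'2.
      by move=> /(_ ltac:(rewrite /m; nlia)) + /(_ ltac:(rewrite /m; nlia)); case: (b).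
    have := h i; have := h m; rewrite omi omm som x2 x'2.
    by move=> /(_ ltac:(rewrite /m; nlia)) + /(_ ltac:(rewrite /m; nlia)); case: (b).
  apply/and3P; split; [by apply/andP|exact: kst|].
  apply: contra hstr => hs; case: w'e => <- //; rewrite /straight /winv !all_rev !all_map.
  move/orP: hs => [] h; apply/orP; [right|left]; apply: sub_all h => l /=; rewrite ?negbK //.
exists w'; split=> //.
  (* [w] and [om] kiss along the distinguished string, so they cannot both belong to [F]. *)
  apply/negP => w'F; have xom : sym [set` F]%classic om by apply: symw'.
  have : nk w om by apply: (nkset_nk hbl l0 nF) => //; left.
  move=> /(_ b k1 i d.-1)/negP; apply; apply/kpatP.
  have E1 : (k1 + d.-1).+1 = k2 by rewrite /d; nlia.
  have E2 : (i + d.-1).+1 = m by rewrite /m; nlia.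
  rewrite E1 E2 omi omm e1 e2 x2 x'2; split=> //; first by split=> //; rewrite som; nlia.
    case: (ltngtP i.+1 m) => hkm.
    * by rewrite omM // subSnn addn1; apply: (walk_adm l0 ww); nlia.
    * by rewrite /m in hkm; nlia.
    * have ek : k2.-1 = k1 by rewrite /m /d in hkm; nlia.
      by rewrite hkm omm -ek.
  move=> s hs; rewrite omM; [|nlia|rewrite /m; nlia].
  by congr (L w _); nlia.
split=> [u|u u'] /=; rewrite inE.
  by move=> /orP[/eqP ->//|]; apply: nG'.1.
have hst v : (v == w') || (v \in rem w F) -> is_walk v /\ stable y v.
  case/orP=> [/eqP ->//|h]; split; last exact: stG.
  by apply: (Fwalk nF); move: h; rewrite mem_rem_uniq // inE => /andP[].
by rewrite inE => /hst[h1 h2] /hst[h3 h4]; apply: kst.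
Qed.

End Flip.

(** * Conclusion *)

Section Final.
Local Open Scope classical_set_scope.
Variables (R : realType) (Q B : bquiver) (iv : vtx Q -> vtx B) (ia : arr Q -> arr B).
Hypothesis hbl : blossoming Q B iv ia.
Hypothesis hadm : admissible Q.
Notation is_walk := (is_walk iv).
Notation gvec := (gvec R iv).
Notation kappa := (kappa R iv).
Notation nkset := (nkset iv).
Notation bend := (bend iv).

(** Each non-self-kissing bending walk is a face by itself, so a finite complex has finitely many of
    them. *)
Lemma bend_finite : finite_set (faces iv) ->
  exists s : seq (seq (letter B)), uniq s /\ forall w, (w \in s) = bend w.
Proof.
move=> hf; pose f (w : seq (letter B)) : set (seq (letter B)) := [set w].
have hW : finite_set (f @^-1` faces iv).
  apply: finite_preimage => //; apply: in2W => w w' /= e.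
  by have : f w w by []; rewrite e.
have /finite_seqP[s hs] := hW; exists (undup s); split; first exact: undup_uniq.
move=> w; rewrite mem_undup; apply/idP/idP => h.
  have : [set` s] w by []. rewrite -hs => -[_ [+ _]]; exact.
suff : [set` s] w by [].
rewrite -hs; split; first exact: finite_set1; split=> [u ->|u u' -> ->] //.
by have /and3P[_ + _] := h.
Qed.

Variable s : seq (seq (letter B)).
Hypothesis us : uniq s.
Hypothesis hs : forall w, (w \in s) = bend w.

Notation T := (seq_sub s).
Implicit Types (X Y : {set T}).

Definition words X : seq (seq (letter B)) := [seq val t | t <- enum X].
Definition face X : bool := `[< nkset [set` words X] >].
Let g (t : T) := gvec (val t).
Let kap (t : T) := kappa (val t).

Lemma mem_words X (t : T) : (val t \in words X) = (t \in X).
Proof. by rewrite mem_map ?mem_enum //; apply: val_inj. Qed.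

Lemma words_uniq X : uniq (words X).
Proof. by rewrite map_inj_uniq ?enum_uniq //; apply: val_inj. Qed.

Lemma wordsP X w : w \in words X -> exists2 t, t \in X & w = val t.
Proof. by case/mapP=> t; rewrite mem_enum => ? ->; exists t. Qed.

Lemma bendT (t : T) : bend (val t).
Proof. by rewrite -hs; apply: valP. Qed.

Lemma letter_of w : is_walk w -> letter B.
Proof. by case: w. Qed.

Lemma letterT (t : T) : letter B.
Proof. exact: (letter_of (bend_walk (bendT t))). Qed.

Lemma nkset_sub (A C : set (seq (letter B))) : nkset A -> C `<=` A -> nkset C.
Proof.
move=> [h1 h2] hC; split=> [w /hC|w w' /hC h /hC h']; [exact: h1|exact: h2].
Qed.

Lemma face_sub X Y : face X -> Y \subset X -> face Y.
Proof.
move=> /asboolP h /fintype.subsetP YX; apply/asboolP; apply: nkset_sub h _ => w /wordsP[t tY ->] /=.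
by rewrite mem_words YX.
Qed.

Lemma face_dual X : face X -> exists c, dual g X c.
Proof.
move=> /asboolP nX.
have hex t : exists c : vtx Q -> R, t \in X -> forall u, u \in X -> dotp (g u) c = (u == t)%:R.
  have l0 := letterT t.
  case: (boolP (t \in X)) => tX; last by exists (fun=> 0).
  have wt : [set` words X] (val t) by rewrite /= mem_words.
  have [b [k1 [k2 [[k12 hk2] [e1 e2] t1 t2]]]] := two_tops hbl l0 nX wt.
  exists (fun v => 0 + signr R b * maskvec R iv l0 (val t) (itv k1 k2) v) => _ u uX.
  rewrite dotp_comb (_ : dotp _ (fun=> 0) = 0) ?add0r; last first.
    by rewrite /dotp big1 // => v _; rewrite mulr0.
  have wu : [set` words X] (val u) by rewrite /= mem_words.
  by rewrite (dual_tops R hbl nX wt wu k12 hk2 e1 e2 t1 t2) (inj_eq val_inj).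
by have [c hc] := choice hex; exists c => t u tX uX; apply: hc.
Qed.

Lemma dual_spanning X c : dual g X c -> #|X| = #|vtx Q| -> spanning R iv [set` words X].
Proof.
move=> d e x h; rewrite (dual_expr d e x); apply/funext => v; rewrite big1 // => t tX.
by rewrite h ?mul0r //= mem_words.
Qed.

Definition setof (A : set (seq (letter B))) : {set T} := finset (fun t => `[< A (val t) >]).

Lemma setofE (A : set (seq (letter B))) : (forall w, A w -> bend w) -> [set` words (setof A)] = A.
Proof.
move=> hA; apply/seteqP; split=> w.
  by move=> /wordsP[t]; rewrite inE => /asboolP h ->.
move=> Aw; have ws : w \in s by rewrite hs hA.
have : val (SeqSub ws) \in words (setof A) by rewrite mem_words inE; apply/asboolP.
exact.
Qed.

Lemma nface_exists : exists X, face X /\ #|X| = #|vtx Q|.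
Proof.
(* Without vertices the empty face already has |Q_0| walks; otherwise a letter around some vertex
   serves as default value. *)
case: (pickP (vtx Q)) => [v _|hV]; last first.
  exists finset.set0; rewrite cards0 (eq_card0 hV); split=> //; apply/asboolP.
  by rewrite /words enum_set0; split.
have hv := (codom_f iv v : inQ0 iv (iv v)).
have [side [_ _ /(_ true true)[l0 _]]] := side_exists hbl hv.
have [F [uF sF nF]] := peak_face hbl hadm l0.
have hX : words (setof [set` F]) =i F.
  move=> w; have := setofE nF.1 => /(congr1 (fun A => A w)) e; apply/idP/idP => h.
    by have : [set` words (setof [set` F])] w by []; rewrite e.
  by have : [set` F] w by []; rewrite -e.
exists (setof [set` F]); split; first by apply/asboolP; rewrite setofE //; apply: nF.1.
rewrite -sF cardE -(size_map val); apply/eqP.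
by rewrite -(uniq_size_uniq uF (fun w => esym (hX w))) words_uniq.
Qed.

Lemma flip X t : face X -> #|X| = #|vtx Q| -> t \in X ->
  exists t', t' \notin X /\ face (t' |: X :\ t).
Proof.
move=> fX e tX; have [c d] := face_dual fX; have hsp := dual_spanning d e.
have l0 := letterT t; move/asboolP: fX => nX.
have wt : val t \in words X by rewrite mem_words.
have [w' [b1 b2 b3]] := flip_exists hbl hadm l0 (words_uniq X) nX wt hsp.
have w's : w' \in s by rewrite hs.
exists (SeqSub w's); rewrite -mem_words; split=> //; apply/asboolP.
apply: nkset_sub b3 _ => w /wordsP[u]; rewrite !inE => /orP[/eqP ->|/andP[ut uX]] -> /=.
  by rewrite inE eqxx.
by rewrite inE mem_rem_uniq ?words_uniq // inE (inj_eq val_inj) ut mem_words uX orbT.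
Qed.

Lemma kap_supp X : face X -> exists x,
  [/\ forall t, t \in X -> dotp (g t) x = kap t, forall t, dotp (g t) x <= kap t &
      forall t, ~~ face (t |: X) -> dotp (g t) x < kap t].
Proof.
move=> /asboolP nX; case: (pickP (fun _ : T => true)) => [t0 _|hT]; last first.
  by exists (fun=> 0); split=> t; have := hT t.
have l0 := letterT t0.
exists (suppv R iv l0 s [set` words X]); split=> t.
- by move=> tX; apply: (suppv_eq R hbl l0 us hs) => //=; rewrite mem_words.
- by apply: (suppv_le R hbl l0 us hs); apply: bend_walk (bendT t).
- move=> hno; apply: (suppv_lt R hbl l0 us hs) => //; first exact: bendT.
  move=> nXt; case/negP: hno; apply/asboolP; apply: nkset_sub nXt _ => w /wordsP[u].
  rewrite !inE => /orP[/eqP ->|uX] ->; [by right|left].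
  by rewrite /= mem_words.
Qed.

Local Notation vert := (vert face_dual kap_supp).
Local Notation nface := (nface Q face).
Local Notation poly := (poly g kap).

Lemma facesP F : faces iv F <-> exists X, face X /\ F = [set` words X].
Proof.
split=> [[_ [h1 h2]]|[X [/asboolP [h1 h2] ->]]].
  have e : [set` words (setof F)] = F by apply: setofE => w /h1.
  by exists (setof F); rewrite e; split=> //; apply/asboolP; rewrite e; split.
split; first exact: finite_seq.
by split.
Qed.

Lemma words_inj X Y : [set` words X] `<=` [set` words Y] -> X \subset Y.
Proof. by move=> h; apply/fintype.subsetP => t tX; rewrite -mem_words; apply: h; rewrite /= mem_words. Qed.

Lemma facetsP F : facets iv F <-> exists X, nface X /\ F = [set` words X].
Proof.
split=> [[/facesP[X [fX ->]] hmax]|[X [nX ->]]].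
  exists X; split=> //; apply: (facet_nface face_dual nface_exists flip kap_supp fX) => Y fY /fintype.subsetP XY.
  have e : [set` words Y] = [set` words X].
    apply: hmax; first by apply/facesP; exists Y.
    by move=> w /wordsP[t tX ->] /=; rewrite mem_words XY.
  by apply/eqP; rewrite finset.eqEsubset !words_inj // e.
have /andP[fX _] := nX; split; first by apply/facesP; exists X.
move=> _ /facesP[Y [fY ->]] XY; apply/seteqP; split=> // w /wordsP[t tY ->] /=.
rewrite mem_words; apply/negPn/negP => tX.
have := nface_not_face face_dual nX tX; apply/negP; rewrite negbK.
apply: face_sub fY _; apply/fintype.subsetP => u; rewrite !inE => /orP[/eqP ->//|uX].
exact: (fintype.subsetP (words_inj XY)).
Qed.

(** By duality of c- and g-vectors, p(F) pairs to [kap] with every g-vector of the face, which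
    determines the vertex. *)
Lemma pvec_vert X : nface X -> pvec R iv [set` words X] = vert X.
Proof.
move=> nX; have [p1 _ _] := vertP face_dual kap_supp nX.
apply: (nface_uniq face_dual nX) => t tX; rewrite p1 //.
have /andP[fX /eqP e] := nX; have [c d] := face_dual fX; have hsp := dual_spanning d e.
have l0 := letterT t; move/asboolP: fX => nkX.
have -> : pvec R iv [set` words X] = fun v => \sum_(u in X) kap u * cvec R iv [set` words X] (val u) v.
  by apply/funext => v; rewrite /pvec -fsbig_seq ?words_uniq // big_map big_enum.
rewrite dotp_sumr.
have hc u : u \in X -> dotp (g t) (cvec R iv [set` words X] (val u)) = (t == u)%:R.
  move=> uX; have wu : [set` words X] (val u) by rewrite /= mem_words.
  have wt : [set` words X] (val t) by rewrite /= mem_words.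
  have [b [k1 [k2 [[k12 hk2] [e1 e2] t1 t2 ->]]]] := cvecE hbl l0 nkX wu hsp.
  rewrite -(inj_eq val_inj) -(dual_tops R hbl nkX wu wt k12 hk2 e1 e2 t1 t2) /dotp mulr_sumr.
  by apply: eq_bigr => v _; rewrite mulrCA.
rewrite (bigD1 t) //= hc // eqxx mulr1 big1 ?addr0 // => u /andP[uX ut].
by rewrite hc // eq_sym (negbTE ut) mulr0.
Qed.

(** A straight walk never turns, so its g-vector is zero and its inequality reads 0 <= kappa. *)
Lemma asso_halfE : asso_half R iv = poly.
Proof.
apply/seteqP; split=> x hx; first by move=> t; have /and3P[h1 h2 _] := bendT t; apply: hx.
move=> w cw nw; have ww : is_walk w by case/andP: cw.
case: (boolP (straight w)) => hst; last first.
  have ws : w \in s by rewrite hs /bend cw nw.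
  exact: (hx (SeqSub ws)).
have l0 := letter_of ww.
rewrite (kappaE R hbl l0 us hs) // (_ : dotp _ x = 0); first by apply: sumr_ge0 => ? _; rewrite ler0n.
rewrite /dotp big1 // => v _; rewrite (gvecE R hbl l0) // /gturn big1 ?mul0r // => i _.
case: ifP => // /andP[hi _]; rewrite /isdir.
by case/orP: hst => /(all_nthP l0) h; have := h _ hi; have := h _ (ltnW hi);
  do 2![case: (_.2) => //].
Qed.

Lemma asso_convE : asso_conv R iv = poly.
Proof.
rewrite (polyE face_dual nface_exists flip kap_supp) /asso_conv; congr conv_hull.
apply/seteqP; split=> x.
  by move=> [F /facetsP[X [nX ->]] <-]; exists X => //; rewrite pvec_vert.
move=> [X nX <-]; exists [set` words X]; last exact: pvec_vert.
by apply/facetsP; exists X.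
Qed.

Lemma gfanE : gfan R iv = normal_fan poly.
Proof.
rewrite (normal_fan_poly face_sub face_dual nface_exists flip kap_supp).
have he X : [set gvec w | w in [set` words X]] = [set g t | t in [set t | t \in X]].
  apply/seteqP; split=> y; first by move=> [w /wordsP[t tX ->] <-]; exists t.
  by move=> [t tX <-]; exists (val t) => //=; rewrite mem_words.
apply/seteqP; split=> C.
  by move=> [F [/facesP[X [fX ->]] ->]]; exists X; rewrite he.
by move=> [X [fX ->]]; exists [set` words X]; rewrite he; split=> //; apply/facesP; exists X.
Qed.

End Final.

Theorem theorem12p21 (R : realType) (Q Qb : bquiver)
    (iv : vtx Q -> vtx Qb) (ia : arr Q -> arr Qb) :
  gentle Q -> admissible Q -> blossoming Q Qb iv ia ->
  finite_set (faces iv) ->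
  asso_conv R iv = asso_half R iv /\
  gfan R iv = normal_fan (asso_conv R iv).
Proof.
move=> _ hadm hbl hfin; have [s [us hs]] := bend_finite hfin.
by rewrite (asso_convE R hbl hadm us hs) (asso_halfE R hbl us hs) (gfanE R hbl hadm us hs).
Qed.
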